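(* Let $X_{sym}\subset X_\infty\subset V^3_{\text{Poincar\'e}}$ be the variety (Zariski closure of the set) of complex Poincar\'e differential forms of degree $3$ that are mirror symmetric with respect to some line through the origin. Then $X_{sym}$ is an irreducible component of $X_\infty$, and it has codimension $6$ in $V^3_{\text{Poincar\'e}}$.
   Context: Differential forms. $V^3=\mathbb{C}[x,y,z]_3\oplus\mathbb{C}[x,y,z]_3$ is the vector space of pairs $(P,Q)$ of homogeneous cubic polynomials, written $Pdx+Qdy$. Such a form is a Poincar\'e differential form if at $(x,y,z)=(0,0,1)$ one has $P=Q=0$, $P_x=Q_y=1$, $P_y=Q_x=0$; the set of these is the $14$-dimensional affine space $V^3_{\text{Poincar\'e}}$. Total center variety. For a Poincar\'e form $Pdx+Qdy$ there are a unique formal power series $F=\sum a_{ij}x^iy^j$ with terms of degree $\le 2$ equal to $x^2+y^2$ and $a_{0,n}=0$ for all even $n\ge 4$, and unique scalars $s_j=s_j(P,Q)$, such that $$\det\begin{pmatrix}F_x(x,y)&F_y(x,y)\\P(x,y,1)&Q(x,y,1)\end{pmatrix}=\sum_{j\ge1}s_j\,(x^{2j+2}+y^{2j+2}).$$ The $s_j$ are polynomials with rational coefficients in the coefficients of $P,Q$. $X_\infty\subset V^3_{\text{Poincar\'e}}$ is the algebraic set where all $s_j$, $j\ge1$, vanish. Symmetry. A form $Pdx+Qdy$ is mirror symmetric with respect to the $x$-axis if $P(x,-y,z)=P(x,y,z)$ and $Q(x,-y,z)=-Q(x,y,z)$. It is mirror symmetric with respect to a line through the origin if it is obtained from a form which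 is mirror symmetric with respect to the $x$-axis by pulling back along a linear change of the coordinates $(x,y)$ (with $z$ fixed) given by an element of $\mathrm{SO}(2,\mathbb{C})$. *)

(* Defs.v *)
From HB Require Import structures.
From mathcomp Require Import all_boot all_order all_algebra.
From mathcomp Require Import boolp classical_sets reals.
From mathcomp Require Import complex.
From mathcomp Require Import mpoly.

Set Implicit Arguments.
Unset Strict Implicit.
Unset Printing Implicit Defensive.

Import GRing.Theory.

Local Open Scope ring_scope.
Local Open Scope classical_set_scope.

Section Zariski.
Context {K : fieldType} {V : vectType K}.
Implicit Types A B X Y : set V.

(* Polynomial functions are written in the coordinates of a fixed basis of V;
   the resulting topology does not depend on the basis. *)
Definition poly_fun (p : {mpoly K[\dim {:V}]}) (v : V) : K :=
  p.@[fun i => coord (vbasis {:V}) i v].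

Definition zariski_closed A :=
  exists S : set {mpoly K[\dim {:V}]},
    A = [set v | forall p, S p -> poly_fun p v = 0].

Definition zariski_closure A : set V :=
  \bigcap_(B in [set B | zariski_closed B /\ A `<=` B]) B.

Definition zariski_irreducible A :=
  A !=set0 /\
  forall B1 B2, zariski_closed B1 -> zariski_closed B2 ->
    A `<=` B1 `|` B2 -> A `<=` B1 \/ A `<=` B2.

Definition irreducible_closed A := zariski_closed A /\ zariski_irreducible A.

Definition irreducible_component Y X :=
  [/\ irreducible_closed Y, Y `<=` X &
      forall Z : set V, irreducible_closed Z -> Y `<=` Z -> Z `<=` X -> Z = Y].

(* Y = Z 0 < Z 1 < ... < Z n, all irreducible, closed and contained in X; the
   values of Z beyond n are irrelevant. X is meant to be closed in V, so that
   closed in X is the same as closed in V and contained in X. *)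
Definition irreducible_chain Y X (n : nat) (Z : nat -> set V) :=
  [/\ Z 0%N = Y,
      forall i, (i <= n)%N -> irreducible_closed (Z i) /\ Z i `<=` X &
      forall i, (i < n)%N -> Z i `<` Z i.+1].

Definition has_codim Y X (n : nat) :=
  (exists Z, irreducible_chain Y X n Z) /\
  (forall m Z, irreducible_chain Y X m Z -> (m <= n)%N).

End Zariski.

Section CubicForms.
Context {K : fieldType}.

(* The pair (P, Q) stands for P dx + Q dy; the variables x, y, z have indices
   0, 1, 2. *)
Definition cubic_form : vectType K := (dhomog 3 K 3 * dhomog 3 K 3)%type.

Definition dx_coef (w : cubic_form) : {mpoly K[3]} := mpoly_of_dhomog w.1.
Definition dy_coef (w : cubic_form) : {mpoly K[3]} := mpoly_of_dhomog w.2.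

Definition at_origin (p : {mpoly K[3]}) : K := p.@[tnth [tuple 0; 0; 1]].

Definition poincare : set cubic_form := [set w |
  let P := dx_coef w in let Q := dy_coef w in
  [/\ at_origin P = 0 /\ at_origin Q = 0,
      at_origin P^`M(0) = 1 /\ at_origin Q^`M(1) = 1 &
      at_origin P^`M(1) = 0 /\ at_origin Q^`M(0) = 0]].

(* Formal power series in x, y: f i j is the coefficient of x^i y^j. *)
Definition series2 := nat -> nat -> K.

Definition series2_mul (f g : series2) : series2 := fun i j =>
  \sum_(k < i.+1) \sum_(l < j.+1) f k l * g (i - k)%N (j - l)%N.

Definition series2_dx (f : series2) : series2 := fun i j => f i.+1 j *+ i.+1.
Definition series2_dy (f : series2) : series2 := fun i j => f i j.+1 *+ j.+1.

(* p(x, y, 1) as a series *)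
Definition dehomog (p : {mpoly K[3]}) : series2 := fun i j =>
  (p \mPo [tuple 'X_0; 'X_1; 1 : {mpoly K[2]}])@_[multinom [tuple i; j]].

(* sum_(j >= 1) s_j (x^(2j+2) + y^(2j+2)): the coefficient of x^p y^q only
   receives contributions from indices j < p + q. *)
Definition focal_series (s : nat -> K) : series2 := fun p q =>
  \sum_(1 <= j < p + q)
    s j * (((p == 2 * j + 2)%N && (q == 0)%N)%:R
         + ((p == 0)%N && (q == 2 * j + 2)%N)%:R).

Definition normalized (F : series2) :=
  [/\ [/\ F 0%N 0%N = 0, F 1%N 0%N = 0 & F 0%N 1%N = 0],
      [/\ F 2%N 0%N = 1, F 1%N 1%N = 0 & F 0%N 2%N = 1] &
      forall n, (4 <= n)%N -> ~~ odd n -> F 0%N n = 0].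

Definition is_frommer (w : cubic_form) (F : series2) (s : nat -> K) :=
  normalized F /\
  forall i j,
    series2_mul (series2_dx F) (dehomog (dy_coef w)) i j
      - series2_mul (series2_dy F) (dehomog (dx_coef w)) i j
    = focal_series s i j.

(* For a Poincare form in characteristic 0 there are a unique F and unique s_j,
   j >= 1, with is_frommer w F s; s 0 is not constrained. *)
Definition focal_value (w : cubic_form) (j : nat) : K :=
  xget (fun=> 0) [set s : nat -> K | exists F, is_frommer w F s] j.

Definition center_variety : set cubic_form :=
  [set w | poincare w /\ forall j, (1 <= j)%N -> focal_value w j = 0].

Definition x_axis_symmetric (w : cubic_form) :=
  let flip := [tuple 'X_0; - 'X_1; 'X_2 : {mpoly K[3]}] in
  dx_coef w \mPo flip = dx_coef w /\ dy_coef w \mPo flip = - dy_coef w.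

Definition in_SO2 (g : 'M[K]_2) := g *m g^T = 1%:M /\ \det g = 1.

(* w' is the pullback of w along (x, y, z) |-> (a x + b y, c x + d y, z), where
   g = [a b; c d], so that dx and dy pull back to a dx + b dy and c dx + d dy. *)
Definition is_pullback (g : 'M[K]_2) (w w' : cubic_form) :=
  let phi := [tuple g 0 0 *: 'X_0 + g 0 1 *: 'X_1;
                    g 1 0 *: 'X_0 + g 1 1 *: 'X_1;
                    'X_2 : {mpoly K[3]}] in
  let P := dx_coef w \mPo phi in
  let Q := dy_coef w \mPo phi in
  dx_coef w' = g 0 0 *: P + g 1 0 *: Q /\
  dy_coef w' = g 0 1 *: P + g 1 1 *: Q.

Definition mirror_symmetric (w : cubic_form) :=
  exists (g : 'M[K]_2) (w0 : cubic_form),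
    [/\ in_SO2 g, x_axis_symmetric w0 & is_pullback g w0 w].

Definition symmetric_variety : set cubic_form :=
  zariski_closure [set w | poincare w /\ mirror_symmetric w].

End CubicForms.

Arguments cubic_form K : clear implicits.
Arguments poincare K : clear implicits.
Arguments center_variety K : clear implicits.
Arguments symmetric_variety K : clear implicits.

(* Main.v *)
From Stdlib Require Import ZArith.
Require Import Defs.
From mathcomp Require Import all_boot all_order all_algebra.
From mathcomp Require Import reals complex.
From mathcomp Require Import perm boolp classical_sets mpoly.
From mathcomp Require Import zify ssrZ ring.

(** Put u = x + i y and v = x - i y. Up to the factor i, the vector field that
is tangent to a Poincare form P dx + Q dy is
   u' = u + (sum of al_jk u^j v^k),   v' = - (v + (sum of be_jk u^j v^k)),
with 2 <= j + k <= 3, and the 14 numbers al_jk, be_jk are coordinates on the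
Poincare forms (poincareP, form_exists). Rotations act diagonally on them and
the reflection in the x-axis exchanges al and be. Hence the form is symmetric
with respect to some line exactly when there is s <> 0 with
   be_kj s^(k+1) = s^j al_jk   for all (j, k)
(mirror_symmetricP). So the symmetric forms are parametrized by s and seven of
the coefficients, which gives irreducibility (related_prime).

For the center problem one looks for a formal first integral u v + ... without
further terms (u v)^n. The derivative along the field multiplies u^a v^b by
a - b, up to higher order, so only the diagonal coefficients obstruct, and the
obstructions are polynomials in al and be. Frommer's normal form uses another
normalization, but subtracting powers of one truncated integral from another
shows that the first obstruction does not depend on it (obstruction_unique);
hence the focal values and the obstructions have the same common zeros
(center_varietyP). For a symmetric form the combination of rotation and swap
changes the sign of each obstruction, so all of them vanish
(obstruction_symmetric).

The relation for (2, 0) expresses s, and the other six relations cut out the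
symmetric forms. Dropping these one by one gives a chain of length 6 up to the
Poincare forms (symmetric_chain). There is no longer one: each strict inclusion
of irreducible sets makes room for one more algebraically independent function
(chain_indep), there are 8 of them on the symmetric forms, and at most 14 on
the Poincare forms because there are too few polynomials of bounded degree in
14 variables (indep_monomials_le).

Let Z be irreducible, contained in the center variety and containing the
symmetric forms. To a form w with al_20 and be_02 nonzero belongs the symmetric
form w' with the same al and with s = be_02 / al_20. An obstruction takes at w
and w' values whose difference is a combination of the six deviations
be_kj(w) - be_kj(w'), with coefficients rational in w (jet). On Z these
combinations vanish. For the obstructions number 2 to 7 the matrix of
coefficients has, at one explicit symmetric form, a determinant that is a
nonzero integer up to scaling (jac_inverse). So the deviations vanish on a
nonempty open subset of Z, and Z consists of limits of symmetric forms
(maximal_symmetric). *)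

Set Implicit Arguments.
Unset Strict Implicit.
Unset Printing Implicit Defensive.

Import Order.TTheory GRing.Theory Num.Theory.

Local Open Scope ring_scope.
Local Open Scope classical_set_scope.

(** * Regular functions and irreducible sets *)

Section LinearForms.
Variables (K : numFieldType) (V : lmodType K) (l : V -> K).
Hypothesis llin : linear_for *%R l.

Lemma linear_form0 : l 0 = 0.
Proof. by have := llin (-1) 0 0; rewrite scaler0 addr0 mulN1r addNr. Qed.

Lemma linear_formD v w : l (v + w) = l v + l w.
Proof. by rewrite -[v]scale1r llin mul1r scale1r. Qed.

Lemma linear_formZ c v : l (c *: v) = c * l v.
Proof. by rewrite -[_ *: _]addr0 llin linear_form0 addr0. Qed.

Lemma linear_form_sum (I : Type) (r : seq I) (P : pred I) (F : I -> V) :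
  l (\sum_(i <- r | P i) F i) = \sum_(i <- r | P i) l (F i).
Proof. exact: (big_morph l linear_formD linear_form0). Qed.

End LinearForms.

Section RegularFunctions.
Variables (K : numFieldType) (V : vectType K).
Implicit Types (f g : V -> K) (Z Y : set V).

Definition regular f := exists p, forall v, f v = poly_fun p v.

Lemma regular_ext f g : (forall v, f v = g v) -> regular g -> regular f.
Proof. by move=> fg [p gp]; exists p => v; rewrite fg gp. Qed.

Lemma regular_cst c : regular (fun=> c).
Proof. by exists c%:MP => v; rewrite /poly_fun mevalC. Qed.

Lemma regularD f g : regular f -> regular g -> regular (fun v => f v + g v).
Proof.
by move=> [p fp] [q gq]; exists (p + q) => v; rewrite fp gq /poly_fun mevalD.
Qed.

Lemma regularM f g : regular f -> regular g -> regular (fun v => f v * g v).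
Proof.
by move=> [p fp] [q gq]; exists (p * q) => v; rewrite fp gq /poly_fun mevalM.
Qed.

Lemma regularZ c f : regular f -> regular (fun v => c * f v).
Proof. exact/regularM/regular_cst. Qed.

Lemma regularN f : regular f -> regular (fun v => - f v).
Proof. by move=> /(regularZ (-1)); apply: regular_ext => v; rewrite mulN1r. Qed.

Lemma regularB f g : regular f -> regular g -> regular (fun v => f v - g v).
Proof. by move=> rf rg; apply: regularD => //; apply: regularN. Qed.

Lemma regularX f n : regular f -> regular (fun v => f v ^+ n).
Proof.
move=> rf; elim: n => [|n IHn].
  by apply: regular_ext (regular_cst 1) => v; rewrite expr0.
by apply: regular_ext (regularM rf IHn) => v; rewrite exprS.
Qed.

Lemma regular_sum (I : Type) (r : seq I) (P : pred I) (F : I -> V -> K) :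
  (forall i, P i -> regular (F i)) -> regular (fun v => \sum_(i <- r | P i) F i v).
Proof.
move=> rF; elim: r => [|i r IHr].
  by apply: regular_ext (regular_cst 0) => v; rewrite big_nil.
case Pi: (P i); last by apply: regular_ext IHr => v; rewrite big_cons Pi.
by apply: regular_ext (regularD (rF i Pi) IHr) => v; rewrite big_cons Pi.
Qed.

Lemma regular_coord i : regular (coord (vbasis {:V}) i).
Proof. by exists 'X_i => v; rewrite /poly_fun mevalXU. Qed.

(** A linear form is its own expansion in the chosen basis. *)
Lemma regular_linear f : linear_for *%R f -> regular f.
Proof.
move=> flin.
apply: (@regular_ext _ (fun v => \sum_(i < \dim {:V})
   f (vbasis {:V})`_i * coord (vbasis {:V}) i v)); last first.
  by apply: regular_sum => i _; apply/regularZ/regular_coord.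
move=> v; rewrite {1}(coord_vbasis (memvf v)).
rewrite (linear_form_sum flin).
by apply: eq_bigr => i _; rewrite (linear_formZ flin) mulrC.
Qed.

(** Reduces statements about regular functions to the coordinates of the fixed
basis. *)
Lemma regular_ind (P : (V -> K) -> Prop) :
  (forall f g, (forall v, f v = g v) -> P f -> P g) ->
  (forall c, P (fun=> c)) ->
  (forall f g, P f -> P g -> P (fun v => f v + g v)) ->
  (forall f g, P f -> P g -> P (fun v => f v * g v)) ->
  (forall i, P (coord (vbasis {:V}) i)) ->
  forall f, regular f -> P f.
Proof.
move=> Pext PC PD PM Pcoord f [p fp].
apply: (Pext _ _ (fun v => esym (fp v))); rewrite /poly_fun.
elim/mpolyind: p {f fp} => [|c m p _ _ IHp].
  by apply: (Pext _ _ _ (PC 0)) => v; rewrite meval0.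
have Pexp n i : P (fun v => coord (vbasis {:V}) i v ^+ n).
  elim: n => [|n IHn]; first by apply: (Pext _ _ _ (PC 1)) => v; rewrite expr0.
  by apply: (Pext _ _ _ (PM _ _ (Pcoord i) IHn)) => v; rewrite exprS.
have Pm r : P (fun v => \prod_(i <- r) coord (vbasis {:V}) i v ^+ m i).
  elim: r => [|i r IHr]; first by apply: (Pext _ _ _ (PC 1)) => v; rewrite big_nil.
  by apply: (Pext _ _ _ (PM _ _ (Pexp (m i) i) IHr)) => v; rewrite big_cons.
apply: (Pext _ _ _ (PD _ _ (PM _ _ (PC c) (Pm (index_enum _))) IHp)) => v.
by rewrite mevalD mevalZ mevalX.
Qed.

Lemma closed_zeros f : regular f -> zariski_closed [set v | f v = 0].
Proof.
move=> [p fp]; exists [set p]; apply/seteqP; split=> v /=.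
  by move=> fv0 _ ->; rewrite -fp.
by move=> /(_ p erefl); rewrite -fp.
Qed.

Lemma closed_bigcap (I : Type) (D : set I) (F : I -> set V) :
  (forall i, D i -> zariski_closed (F i)) -> zariski_closed (\bigcap_(i in D) F i).
Proof.
move=> clF; exists [set p | exists2 i, D i & forall v, F i v -> poly_fun p v = 0].
apply/seteqP; split=> v /= Fv.
  by move=> p [i Di]; apply; apply: Fv.
move=> i Di; have [S FS] := clF i Di; rewrite FS => p Sp.
by apply: Fv; exists i => // w; rewrite FS; apply.
Qed.

Lemma closed_closure Y : zariski_closed (zariski_closure Y).
Proof. by apply: closed_bigcap => B []. Qed.

Lemma sub_closure Y : Y `<=` zariski_closure Y.
Proof. by move=> v Yv B [_]; apply. Qed.

Lemma closure_sub Y Z : zariski_closed Z -> Y `<=` Z -> zariski_closure Y `<=` Z.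
Proof. by move=> clZ YZ v; apply; split. Qed.

Lemma closureS Y Z : Y `<=` Z -> zariski_closure Y `<=` zariski_closure Z.
Proof.
by move=> YZ; apply: closure_sub (closed_closure Z) (subset_trans YZ (@sub_closure Z)).
Qed.

Lemma closed_separated Z v : zariski_closed Z -> ~ Z v ->
  exists f, [/\ regular f, forall w, Z w -> f w = 0 & f v <> 0].
Proof.
move=> [S ZS] nZv; apply: contrapT => noF; apply: nZv; rewrite ZS => p Sp.
apply: contrapT => pv; apply: noF; exists (poly_fun p); split=> //.
  by exists p.
by move=> w; rewrite ZS; apply.
Qed.

(** Irreducibility in terms of functions: the vanishing ideal of Y is prime.
In contrast to closed sets, functions pull back along maps from a space of
parameters. *)
Definition prime_set Y := Y !=set0 /\ forall f g, regular f -> regular g ->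
  (forall v, Y v -> f v * g v = 0) ->
  (forall v, Y v -> f v = 0) \/ (forall v, Y v -> g v = 0).

Lemma irreducible_prime Z : zariski_irreducible Z -> prime_set Z.
Proof.
move=> [Z0 irrZ]; split=> // f g rf rg fg0.
apply: irrZ; [exact: closed_zeros|exact: closed_zeros|].
by move=> v /fg0 /eqP; rewrite mulf_eq0 => /orP[] /eqP; [left|right].
Qed.

(** A closed set that does not contain Y is separated from a point of Y by a
regular function; two such sets covering Y would give two functions with
product zero on Y. *)
Lemma prime_irreducible_closure Y :
  prime_set Y -> irreducible_closed (zariski_closure Y).
Proof.
move=> [[y Yy] primeY]; split; first exact: closed_closure.
split; first by exists y; apply: sub_closure.
move=> B1 B2 cl1 cl2 YB.
have sepB B : zariski_closed B -> ~ zariski_closure Y `<=` B ->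
    exists f, [/\ regular f, forall w, B w -> f w = 0 & exists2 v, Y v & f v <> 0].
  move=> clB /(contra_not (closure_sub clB)) /existsNP[v /not_implyP[Yv nBv]].
  by have [f [rf fB fv]] := closed_separated clB nBv; exists f; split=> //; exists v.
have [|/(sepB B1 cl1)[f [rf fB1 [v Yv fv]]]] := pselect (zariski_closure Y `<=` B1).
  by left.
have [|/(sepB B2 cl2)[g [rg gB2 [w Yw gw]]]] := pselect (zariski_closure Y `<=` B2).
  by right.
have [|/(_ v Yv)|/(_ w Yw)] // := primeY f g rf rg _.
by move=> u /(@sub_closure Y)/YB [/fB1|/gB2] ->; rewrite ?mul0r ?mulr0.
Qed.

Lemma regular_line f v w : regular f ->
  exists q : {poly K}, forall t, f (v + t *: (w - v)) = q.[t].
Proof.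
move: f; apply: regular_ind => [f g fg [q fq]|c|f g [p fp] [q gq]|f g [p fp] [q gq]|i].
- by exists q => t; rewrite -fg.
- by exists c%:P => t; rewrite hornerC.
- by exists (p + q) => t; rewrite hornerD fp gq.
- by exists (p * q) => t; rewrite hornerM fp gq.
- exists ((coord (vbasis {:V}) i v)%:P + coord (vbasis {:V}) i (w - v) *: 'X) => t.
  by rewrite hornerD hornerC hornerZ hornerX linearD linearZ /= mulrC.
Qed.

End RegularFunctions.

Lemma poly_nonroot (K : numFieldType) (p : {poly K}) :
  p != 0 -> exists t, p.[t] != 0.
Proof.
move=> p0; apply: contrapT => /forallNP noroot.
pose rs : seq K := [seq n%:R | n <- iota 0 (size p)].
have rs_roots : all (root p) rs.
  by apply/allP => t _; apply: contrapT => nr; apply: (noroot t); apply/negP.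
have rs_uniq : uniq rs by rewrite map_inj_uniq ?iota_uniq //; apply: (mulrIn (oner_neq0 K)).
by have := max_poly_roots p0 rs_roots rs_uniq; rewrite size_map size_iota ltnn.
Qed.

(** A product of two polynomials that are nonzero at two different points is
nonzero somewhere on the line joining these points. *)
Lemma affine_prime (K : numFieldType) (V : vectType K) : prime_set [set: V].
Proof.
split; first by exists 0.
move=> f g rf rg fg0.
have [|/existsNP[v /not_implyP[_ fv]]] := pselect (forall v, [set: V] v -> f v = 0).
  by left.
have [|/existsNP[w /not_implyP[_ gw]]] := pselect (forall v, [set: V] v -> g v = 0).
  by right.
have [p fp] := regular_line v w rf; have [q gq] := regular_line v w rg.
have p0 : p != 0.
  by apply/eqP => p0; apply: fv; rewrite -[v]addr0 -(scale0r (w - v)) fp p0 horner0.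
have q0 : q != 0.
  apply/eqP => q0; apply: gw.
  by rewrite -(subrKC v w) -(scale1r (w - v)) gq q0 horner0.
have [t] := poly_nonroot (mulf_neq0 p0 q0).
by rewrite hornerM -fp -gq fg0 // eqxx.
Qed.

(** Multiplying the pulled back functions by h turns a relation on the image
of h <> 0 into a relation on the whole space of parameters. *)
Lemma image_prime (K : numFieldType) (U V : vectType K) (h : U -> K)
    (phi : U -> V) :
  regular h -> (exists u, h u != 0) ->
  (forall f, regular f -> regular (fun u => f (phi u))) ->
  prime_set [set phi u | u in [set u | h u != 0]].
Proof.
move=> rh [u0 hu0] rphi; split; first by exists (phi u0), u0.
move=> f g rf rg fg0.
have [_ primeU] := affine_prime U.
have [|f0|g0] := primeU _ _ (regularM rh (rphi f rf)) (regularM rh (rphi g rg)) _.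
- move=> u _; have [hu|hu] := eqVneq (h u) 0; first by rewrite hu !mul0r.
  by rewrite mulrACA fg0 ?mulr0 //; exists u.
- left=> _ [u hu <-]; have /eqP := f0 u I.
  by rewrite mulf_eq0 (negbTE hu) => /eqP.
- right=> _ [u hu <-]; have /eqP := g0 u I.
  by rewrite mulf_eq0 (negbTE hu) => /eqP.
Qed.

(** * Algebraic independence along chains of irreducible sets *)

Section Dimension.
Variables (K : numFieldType) (V : vectType K).
Implicit Types (Z X : set V).

(** Exponents are nested pairs, so that a new variable is a new component and
no reindexing is needed when a chain grows. *)
Fixpoint exponents (k n : nat) : finType :=
  if n is n'.+1 then (exponents k n' * 'I_k)%type else unit.

Fixpoint monomial (k n : nat) (xs : nat -> V -> K) : exponents k n -> V -> K :=
  match n with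
  | 0 => fun _ _ => 1
  | n'.+1 => fun e v => monomial xs e.1 v * xs n' v ^+ e.2
  end.

Lemma card_exponents k n : #|exponents k n| = (k ^ n)%N.
Proof. by elim: n => [|n IHn] /=; rewrite ?card_unit // card_prod IHn card_ord expnSr. Qed.

Lemma eq_monomial k n (xs ys : nat -> V -> K) (e : exponents k n) v :
  (forall i, (i < n)%N -> xs i = ys i) -> monomial xs e v = monomial ys e v.
Proof.
elim: n e => [//|n IHn] e xy /=.
by rewrite xy // IHn // => i ltin; rewrite xy // ltnW.
Qed.

Lemma regular_monomial k n xs (e : exponents k n) :
  (forall i, (i < n)%N -> regular (xs i)) -> regular (monomial xs e).
Proof.
elim: n e => [_ _|n IHn e rxs] /=; first exact: regular_cst.
apply: regularM; last by apply: regularX; apply: rxs.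
by apply: IHn => i ltin; apply: rxs; rewrite ltnW.
Qed.

Definition indep_on Z (T : finType) (Phi : T -> V -> K) :=
  forall c : T -> K, (forall v, Z v -> \sum_t c t * Phi t v = 0) -> forall t, c t = 0.

(** A relation between the products Phi t * h ^ i on Z' can be divided by the
smallest power of h that occurs in it, since Z' is irreducible; restricting the
quotient to Z, where h vanishes, leaves a relation between the Phi t. *)
Lemma indep_on_step Z Z' (T : finType) (Phi : T -> V -> K) (h : V -> K) k :
  indep_on Z Phi -> (forall t, regular (Phi t)) -> Z `<=` Z' -> prime_set Z' ->
  regular h -> (forall v, Z v -> h v = 0) -> (exists2 v, Z' v & h v <> 0) ->
  indep_on Z' (fun (e : T * 'I_k) v => Phi e.1 v * h v ^+ e.2).
Proof.
move=> indZ rPhi ZZ' [_ primeZ'] rh hZ [w Zw hw] c relc.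
suff low r : (r <= k)%N -> forall e : T * 'I_k, (e.2 < r)%N -> c e = 0.
  by move=> e; apply: (low k).
elim: r => // r IHr ltrk [t i] /=; rewrite ltnS leq_eqVlt => /predU1P[ir|]; last first.
  by move=> ltir; apply: (IHr (ltnW ltrk)).
pose g v := \sum_(e : T * 'I_k | (r <= e.2)%N) c e * (Phi e.1 v * h v ^+ (e.2 - r)).
have rg : regular g.
  by apply: regular_sum => e _; apply/regularZ/regularM => //; apply: regularX.
have gE v : h v ^+ r * g v = \sum_e c e * (Phi e.1 v * h v ^+ e.2).
  rewrite (bigID (fun e : T * 'I_k => (r <= e.2)%N)) /= [X in _ = _ + X]big1 ?addr0.
    rewrite mulr_sumr; apply: eq_bigr => e ler.
    rewrite -[in RHS](subnK ler) exprD mulrCA; congr (_ * _).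
    by rewrite mulrCA; congr (_ * _); apply: mulrC.
  by move=> e; rewrite -ltnNge => lter; rewrite (IHr (ltnW ltrk)) ?mul0r.
have [v Zv|h0|g0] := primeZ' _ _ (regularX r rh) rg _.
- by rewrite gE relc.
- by have /eqP := h0 w Zw; rewrite expf_eq0 => /andP[_ /eqP].
have ZPhi v : Z v -> \sum_t c (t, i) * Phi t v = 0.
  move=> Zv; rewrite -[RHS](g0 v (ZZ' _ Zv)) /g.
  transitivity (\sum_t \sum_(j < k | (r <= j)%N)
      c (t, j) * (Phi t v * h v ^+ (j - r))); last first.
    by rewrite pair_big; apply: eq_bigr => -[].
  apply: eq_bigr => s _; rewrite (bigD1 i) /= -ir ?subnn ?leqnn // expr0 mulr1 big1 ?addr0 //.
  move=> j /andP[lerj neji]; rewrite hZ // expr0n subn_eq0.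
  case: leqP => [lejr|_]; last by rewrite !mulr0.
  by case/eqP: neji; apply/val_inj/eqP; rewrite /= eqn_leq lejr.
exact: indZ ZPhi t.
Qed.

(** Each strict inclusion provides a function that vanishes on the smaller set
and not on the larger one; it is the next variable. *)
Lemma chain_indep d (xs : nat -> V -> K) m (Z : nat -> set V) :
  (forall i, regular (xs i)) ->
  (forall k, indep_on (Z 0%N) (@monomial k d xs)) ->
  (forall i, (i <= m)%N -> irreducible_closed (Z i)) ->
  (forall i, (i < m)%N -> Z i `<` Z i.+1) ->
  exists2 ys : nat -> V -> K, forall i, regular (ys i) &
    forall k, indep_on (Z m) (@monomial k (m + d) ys).
Proof.
move=> rxs indxs; elim: m => [|m IHm] irrZ ltZ; first by exists xs.
have [||ys rys indys] := IHm.
- by move=> i leim; apply: irrZ; rewrite ltnW.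
- by move=> i ltim; apply: ltZ; rewrite ltnW.
have [clZm _] := irrZ m (leqnSn m); have [_ irrZm1] := irrZ m.+1 (leqnn _).
have [subZ /existsNP[w /not_implyP[Zw nZw]]] := ltZ m (ltnSn m).
have [h [rh hZ hw]] := closed_separated clZm nZw.
exists (fun i => if i == (m + d)%N then h else ys i); first by move=> i; case: eqP.
move=> k c relc e /=.
apply: (@indep_on_step (Z m) (Z m.+1) _ (@monomial k (m + d) ys) h k (indys k)
  _ subZ (irreducible_prime irrZm1) rh hZ _ c).
- by move=> t; apply: regular_monomial.
- by exists w.
move=> v Zv; rewrite -[RHS](relc v Zv); apply: eq_bigr => t _ /=.
rewrite eqxx; congr (_ * (_ * _)); apply: eq_monomial => i ltim.
by rewrite ltn_eqF.
Qed.

(** Otherwise M has more rows than columns, and a row vector that it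
annihilates is a relation between the Phi t. *)
Lemma indep_on_card X (T B : finType) (Phi : T -> V -> K) (psi : B -> V -> K)
    (M : T -> B -> K) :
  indep_on X Phi ->
  (forall t v, X v -> Phi t v = \sum_b M t b * psi b v) -> (#|T| <= #|B|)%N.
Proof.
move=> indX PhiE; rewrite leqNgt; apply/negP => ltBT.
pose A := \matrix_(i < #|T|, j < #|B|) M (enum_val i) (enum_val j).
have : kermx A != 0.
  by rewrite kermx_eq0 /row_free; apply: contraL ltBT => /eqP <-; rewrite -leqNgt rank_leq_col.
case/rowV0Pn => u /sub_kermxP uA /eqP; apply.
apply/rowP => i; rewrite mxE -(enum_valK i).
apply: (indX (fun t => u 0 (enum_rank t))) => v Xv.
under eq_bigr => t _ do rewrite PhiE // mulr_sumr.
rewrite exchange_big big1 //= => b _.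
have /rowP/(_ (enum_rank b)) := uA; rewrite !mxE => uAb.
under eq_bigr do rewrite mulrA.
rewrite -mulr_suml (_ : \sum_t _ = 0) ?mul0r // -[RHS]uAb.
rewrite (reindex (fun j : 'I_#|T| => enum_val j)) /=; last first.
  exact: onW_bij (@enum_val_bij T).
by apply: eq_bigr => j _; rewrite mxE enum_valK enum_rankK.
Qed.

Lemma card_bmultinom N b : (#|{: 'X_{1..N < b}}| <= b ^ N)%N.
Proof.
have ltb (m : 'X_{1..N < b}) i : (m i < b)%N.
  apply: leq_ltn_trans (bmdeg m).
  by rewrite mdegE (bigD1 i) //= leq_addr.
pose f (m : 'X_{1..N < b}) := [ffun i => Ordinal (ltb m i)].
have f_inj : injective f.
  move=> m1 m2 /ffunP f12; apply/val_inj/mnmP => i.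
  by have /(congr1 val) := f12 i; rewrite !ffunE.
by have := leq_card f f_inj; rewrite card_ffun !card_ord.
Qed.

(** A polynomial expression of size at most b in N functions lies in a space
of dimension at most b ^ N, while the monomials with exponents below k in n
functions number k ^ n: letting k grow gives n <= N. *)
Lemma indep_monomials_le N n (X : set V) (x : V -> 'I_N -> K) (ys : nat -> V -> K) :
  (forall f, regular f -> exists p : {mpoly K[N]}, forall v, X v -> f v = p.@[x v]) ->
  (forall i, regular (ys i)) ->
  (forall k, indep_on X (@monomial k n ys)) -> (n <= N)%N.
Proof.
move=> xX rys indys.
have /choice[p pE] i := xX _ (rys i).
(* The summand 3 pays for the additive loss in msizeM_le. *)
pose D := (\max_(i < n) msize (p i) + 3)%N.
have pD i : (i < n)%N -> (msize (p i) + 3 <= D)%N.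
  by move=> ltin; rewrite leq_add2r (leq_bigmax (Ordinal ltin)).
have mon k m (e : exponents k m) : (m <= n)%N -> exists q : {mpoly K[N]},
    (msize q <= m * k * D + 1)%N /\ forall v, X v -> monomial ys e v = q.@[x v].
  elim: m e => [_ _|m IHm e ltmn] /=.
    by exists 1; split=> [|v _]; rewrite ?msize1 ?mevalC ?meval1.
  have [q [szq qE]] := IHm e.1 (ltnW ltmn); exists (q * p m ^+ e.2); split; last first.
    by move=> v Xv; rewrite mevalM rmorphXn /= -pE // -qE.
  have sz j : (msize (p m ^+ j) + 2 * j <= j * D + 1)%N.
    elim: j => [|j IHj]; first by rewrite expr0 msize1.
    by move: (msizeM_le (p m) (p m ^+ j)) (pD m ltmn) IHj; rewrite exprS; lia.
  have : (e.2.+1 * D <= k * D)%N by rewrite leq_mul2r ltn_ord orbT.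
  move: (msizeM_le q (p m ^+ e.2)) (sz e.2) szq (pD m ltmn).
  by rewrite !mulSn !mulnDl; lia.
have bound k : (k ^ n <= (n * k * D + 1) ^ N)%N.
  have /choice[q qP] := fun e => mon k n e (leqnn n).
  rewrite -card_exponents; apply: leq_trans _ (card_bmultinom _ _).
  pose B := 'X_{1..N < n * k * D + 1}.
  apply: (@indep_on_card X _ B (@monomial k n ys)
    (fun m v => ('X_[bmnm m]).@[x v]) (fun e m => (q e)@_(bmnm m)) (indys k)).
  move=> e v Xv; have [szq ->//] := qP e.
  by rewrite {1}(mpolywE szq) raddf_sum /=; apply: eq_bigr => m _; rewrite mevalZ.
rewrite leqNgt; apply/negP => ltNn.
pose k := ((n * D + 1) ^ N).+1.
have leb : (n * k * D + 1 <= (n * D + 1) * k)%N.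
  by rewrite mulnDl mul1n mulnAC leq_add2l.
have : (k ^ N.+1 <= (n * D + 1) ^ N * k ^ N)%N.
  apply: leq_trans (leq_pexp2l _ ltNn) _ => //.
  apply: leq_trans (bound k) _; rewrite -expnMn.
  by case: (N) => // N'; rewrite leq_exp2r.
by rewrite expnS leq_pmul2r ?expn_gt0 // ltnn.
Qed.

End Dimension.

(** * Polynomials in two variables and dehomogenization *)

Section Bivariate.
Variable (K : numFieldType).
Implicit Types (p q : {mpoly K[2]}).

Definition mnm2 (i j : nat) : 'X_{1..2} := [multinom [tuple i; j]].

Lemma mnm2_0 i j : mnm2 i j 0 = i. Proof. by []. Qed.
Lemma mnm2_1 i j : mnm2 i j 1 = j. Proof. by []. Qed.

Lemma ord2_ind (P : 'I_2 -> Prop) : P 0 -> P 1 -> forall i, P i.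
Proof.
move=> P0 P1 [[|[|//]] lti].
  by rewrite (_ : Ordinal lti = 0) //; apply: val_inj.
by rewrite (_ : Ordinal lti = 1) //; apply: val_inj.
Qed.

Lemma mnm2P (m m' : 'X_{1..2}) : m 0 = m' 0 -> m 1 = m' 1 -> m = m'.
Proof. by move=> e0 e1; apply/mnmP; apply: ord2_ind. Qed.

Lemma mnm2K (m : 'X_{1..2}) : mnm2 (m 0) (m 1) = m.
Proof. exact: mnm2P. Qed.

Lemma mdeg2 (m : 'X_{1..2}) : mdeg m = (m 0%R + m 1%R)%N.
Proof.
rewrite mdegE big_ord_recl big_ord1; congr (_ + m _)%N; exact: val_inj.
Qed.

Lemma mdeg_mnm2 i j : mdeg (mnm2 i j) = (i + j)%N.
Proof. exact: mdeg2. Qed.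

Lemma eq_mnm2 i j i' j' : (mnm2 i j == mnm2 i' j') = (i == i') && (j == j').
Proof.
apply/eqP/andP => [e|[/eqP-> /eqP->]//].
by rewrite -(mnm2_0 i j) -{2}(mnm2_1 i j) e.
Qed.

Lemma mnm2D i j i' j' : (mnm2 i j + mnm2 i' j')%MM = mnm2 (i + i') (j + j').
Proof. by apply: mnm2P; rewrite mnmDE. Qed.

Lemma mnm2U0 : U_(0%R)%MM = mnm2 1 0. Proof. by apply: mnm2P; rewrite mnm1E. Qed.
Lemma mnm2U1 : U_(1%R)%MM = mnm2 0 1. Proof. by apply: mnm2P; rewrite mnm1E. Qed.
Lemma mnm2_00 : 0%MM = mnm2 0 0. Proof. by apply: mnm2P; rewrite mnm0E. Qed.

Lemma mpolyX2 i j : 'X_[mnm2 i j] = 'X_0 ^+ i * 'X_1 ^+ j :> {mpoly K[2]}.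
Proof.
rewrite !mpolyXn -mpolyXD; congr 'X_[_].
by apply: mnm2P; rewrite mnmDE !mulmnE !mnm1E ?mul1n ?mul0n ?addn0.
Qed.

Lemma mpoly2P p q : (forall i j, p@_(mnm2 i j) = q@_(mnm2 i j)) <-> p = q.
Proof. by split=> [pq|->//]; apply/mpolyP => m; rewrite -(mnm2K m). Qed.

Definition trunc n (f : nat -> nat -> K) : {mpoly K[2]} :=
  \sum_(j < n.+1) \sum_(k < n.+1) (if (j + k <= n)%N then f j k else 0) *: 'X_[mnm2 j k].

Lemma trunc_coef n f j k :
  (trunc n f)@_(mnm2 j k) = if (j + k <= n)%N then f j k else 0.
Proof.
rewrite /trunc raddf_sum /=.
have [len|ltn] := leqP (j + k) n.
  have ltj : (j < n.+1)%N by lia.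
  have ltk : (k < n.+1)%N by lia.
  rewrite (bigD1 (Ordinal ltj)) //= raddf_sum (bigD1 (Ordinal ltk)) //=.
  rewrite mcoeffZ mcoeffX eqxx len mulr1 !big1 ?addr0 // => [j' nej|k' nek].
    rewrite raddf_sum big1 //= => k' _.
    by rewrite mcoeffZ mcoeffX eq_mnm2 (_ : (j' == j :> nat) = false) ?mulr0 //; apply: negbTE nej.
  by rewrite mcoeffZ mcoeffX eq_mnm2 (_ : (k' == k :> nat) = false) ?andbF ?mulr0 //; apply: negbTE nek.
rewrite big1 // => j' _; rewrite raddf_sum big1 //= => k' _.
rewrite mcoeffZ mcoeffX eq_mnm2; case: ifP => [len|_]; last by rewrite mul0r.
by case: eqP => [ej|]; case: eqP => [ek|]; rewrite ?mulr0 //; lia.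
Qed.

End Bivariate.

Section Substitution.
Variable (K : numFieldType).

(** Composed substitutions are compared on the variables only. *)
Lemma mpoly_morph_ext n (S : comNzRingType) (f g : {rmorphism {mpoly K[n]} -> S}) :
  (forall c, f c%:MP = g c%:MP) -> (forall i, f 'X_i = g 'X_i) -> f =1 g.
Proof.
move=> fgC fgX p; elim/mpolyind: p => [|c m p _ _ IHp]; first by rewrite !rmorph0.
rewrite !rmorphD IHp -mul_mpolyC !rmorphM fgC mpolyXE_id !rmorph_prod.
by congr (_ * _ + _); apply: eq_bigr => i _; rewrite !rmorphXn fgX.
Qed.

Lemma comp_mpolyA n k l (s : n.-tuple {mpoly K[k]}) (t : k.-tuple {mpoly K[l]})
    (r : n.-tuple {mpoly K[l]}) :
  (forall i, tnth s i \mPo t = tnth r i) -> forall p, (p \mPo s) \mPo t = p \mPo r.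
Proof.
move=> str.
apply: (@mpoly_morph_ext _ _ (comp_mpoly t \o comp_mpoly s) (comp_mpoly r)) => [c|i] /=.
  by rewrite !comp_mpolyC.
by rewrite !comp_mpolyXU -!tnth_nth str.
Qed.

Lemma comp_mpoly_Xhomog n k (t : n.-tuple {mpoly K[k]}) (m : 'X_{1..n}) :
  (forall i, tnth t i \is 1.-homog) -> 'X_[m] \mPo t \is (mdeg m).-homog.
Proof.
move=> t1; rewrite comp_mpolyX mdegE.
elim: (index_enum _) => [|i r IHr]; first by rewrite !big_nil dhomog1.
rewrite !big_cons dhomogM //.
by have := dhomogMn (m i) (t1 i); rewrite mul1n.
Qed.

(** A linear substitution acts on each homogeneous component separately. *)
Lemma comp_mpoly_coef_eq0 n k (t : n.-tuple {mpoly K[k]}) (p : {mpoly K[n]}) m :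
  (forall i, tnth t i \is 1.-homog) ->
  (forall m', mdeg m' = mdeg m -> p@_m' = 0) -> (p \mPo t)@_m = 0.
Proof.
move=> t1 pm; rewrite comp_mpolyEX raddf_sum big1 //= => m' _; rewrite mcoeffZ.
have [e|ne] := eqVneq (mdeg m') (mdeg m); first by rewrite pm ?mul0r.
by rewrite (dhomog_nemf_coeff (comp_mpoly_Xhomog m' t1)) ?mulr0 // eq_sym.
Qed.

Lemma comp_mpoly_homog n k (t : n.-tuple {mpoly K[k]}) (p : {mpoly K[n]}) d :
  (forall i, tnth t i \is 1.-homog) -> p \is d.-homog -> p \mPo t \is d.-homog.
Proof.
move=> t1 hp; apply/dhomogP => m; rewrite mcoeff_msupp; apply: contraNeq => nd.
apply/eqP/comp_mpoly_coef_eq0 => // m' e.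
apply: (dhomog_nemf_coeff hp); have {nd}: mdeg m != d by [].
by rewrite -e.
Qed.

Lemma homogX1 n (i : 'I_n) : 'X_i \is [in K[n], 1.-homog].
Proof. by rewrite dhomogX; apply/eqP/mdeg1. Qed.

End Substitution.

Section Dehomogenization.
Variable (K : numFieldType).
Implicit Types (p : {mpoly K[3]}) (q : {mpoly K[2]}).

Definition dehom p : {mpoly K[2]} := p \mPo [tuple 'X_0; 'X_1; 1].

Lemma dehomX (m : 'X_{1..3}) : dehom 'X_[m] = 'X_[mnm2 (m 0) (m 1)].
Proof.
rewrite /dehom comp_mpolyX mpolyX2 !big_ord_recl big_ord0 !tnth0 mulr1.
rewrite (_ : tnth _ (lift ord0 ord0) = 'X_1) // expr1n mulr1.
by congr (_ ^+ m _ * _ ^+ m _); apply: val_inj.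
Qed.

Lemma dehomE p : dehom p = \sum_(m <- msupp p) p@_m *: 'X_[mnm2 (m 0) (m 1)].
Proof. by rewrite /dehom comp_mpolyEX; apply: eq_bigr => m _; rewrite -/(dehom _) dehomX. Qed.

Lemma mdeg3 (m : 'X_{1..3}) : mdeg m = (m 0%R + m 1%R + m 2%R)%N.
Proof.
rewrite mdegE !big_ord_recl big_ord0 addn0 addnA.
by congr (m _ + m _ + m _)%N; apply: val_inj.
Qed.

Lemma mnm3P (m m' : 'X_{1..3}) : m 0 = m' 0 -> m 1 = m' 1 -> m 2%R = m' 2%R -> m = m'.
Proof.
move=> e0 e1 e2; apply/mnmP => -[[|[|[|//]]] lti].
- by rewrite (_ : Ordinal lti = 0) //; apply: val_inj.
- by rewrite (_ : Ordinal lti = 1) //; apply: val_inj.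
- by rewrite (_ : Ordinal lti = 2%R) //; apply: val_inj.
Qed.

(** In a homogeneous polynomial the exponent of z is determined by the other
two, so nothing is lost at z = 1. *)
Lemma dehom_coef d p (m : 'X_{1..3}) : p \is d.-homog -> mdeg m = d ->
  (dehom p)@_(mnm2 (m 0) (m 1)) = p@_m.
Proof.
move=> hp dm; rewrite dehomE {3}[p]mpolyE !raddf_sum; apply: eq_big_seq => m' m'p /=.
rewrite !mcoeffZ !mcoeffX eq_mnm2; congr (_ * _%:R).
have dm' : mdeg m' = d := dhomog_mf hp m'p; congr (nat_of_bool _).
apply/andP/eqP => [[/eqP e0 /eqP e1]|->//]; apply: mnm3P => //.
by move: dm dm'; rewrite !mdeg3 e0 e1 => <- /addnI.
Qed.

Lemma dehom_high d p i j : p \is d.-homog -> (d < i + j)%N -> (dehom p)@_(mnm2 i j) = 0.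
Proof.
move=> hp ltd; rewrite dehomE raddf_sum big_seq big1 //= => m mp.
rewrite mcoeffZ mcoeffX eq_mnm2.
have : mdeg m = d := dhomog_mf hp mp; rewrite mdeg3; case: eqP => [e0|]; case: eqP => [e1|]; rewrite ?mulr0 //.
by move: ltd; rewrite -e0 -e1 => ltd e; move: ltd; rewrite -e ltnNge leq_addr.
Qed.

Lemma dehom_inj d p p' : p \is d.-homog -> p' \is d.-homog -> dehom p = dehom p' -> p = p'.
Proof.
move=> hp hp' e; apply/mpolyP => m.
have [dm|ndm] := eqVneq (mdeg m) d.
  by rewrite -(dehom_coef hp dm) e (dehom_coef hp' dm).
by rewrite !(@dhomog_nemf_coeff _ _ mdeg d).
Qed.

Lemma dehom_surj d q : (forall i j, (d < i + j)%N -> q@_(mnm2 i j) = 0) ->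
  exists2 p, p \is d.-homog & dehom p = q.
Proof.
move=> qd; pose hom (m : 'X_{1..2}) := [multinom [tuple m 0; m 1; (d - m 0%R - m 1%R)%N]].
exists (\sum_(m <- msupp q) q@_m *: 'X_[hom m]); last first.
  rewrite [RHS]mpolyE /dehom raddf_sum; apply: eq_bigr => m _ /=.
  by rewrite comp_mpolyZ -/(dehom _) dehomX (_ : mnm2 _ _ = m) //; apply: mnm2P.
rewrite big_seq; apply: rpred_sum => m mq; apply: dhomogZ; rewrite dhomogX -[X in X == _]/(mdeg (hom m)) mdeg3.
have : (m 0%R + m 1%R <= d)%N.
  by rewrite leqNgt; apply: contraL mq => /qd; rewrite mnm2K mcoeff_msupp => ->; rewrite eqxx.
have [h0 h1 h2] : [/\ hom m 0 = m 0, hom m 1 = m 1 & hom m 2%R = (d - m 0%R - m 1%R)%N].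
  by [].
by rewrite h0 h1 h2 => le; rewrite -subnDA subnKC.
Qed.

Lemma dehom_comp p (s : 3.-tuple {mpoly K[3]}) (t : 2.-tuple {mpoly K[2]}) :
  dehom (tnth s 0) = tnth t 0 -> dehom (tnth s 1) = tnth t 1 -> dehom (tnth s 2%R) = 1 ->
  dehom (p \mPo s) = dehom p \mPo t.
Proof.
move=> e0 e1 e2; apply: (@mpoly_morph_ext _ _ _
  (comp_mpoly [tuple 'X_0; 'X_1; 1] \o comp_mpoly s)
  (comp_mpoly t \o comp_mpoly [tuple 'X_0; 'X_1; 1])) => [c|i] /=.
  by rewrite !comp_mpolyC.
rewrite !comp_mpolyXU -!tnth_nth -/(dehom _).
case: i => -[|[|[|//]]] lti.
- by rewrite (_ : Ordinal lti = 0) ?e0 ?comp_mpolyXU -?tnth_nth //; apply: val_inj.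
- by rewrite (_ : Ordinal lti = 1) ?e1 ?comp_mpolyXU -?tnth_nth //; apply: val_inj.
- by rewrite (_ : Ordinal lti = 2%R) ?e2 ?comp_mpoly1 //; apply: val_inj.
Qed.

Lemma dehom_deriv0 p : dehom p^`M(0) = (dehom p)^`M(0).
Proof.
elim/mpolyind: p => [|c m p _ _ IHp]; first by rewrite mderiv0 /dehom comp_mpoly0 mderiv0.
rewrite mderivD mderivZ /dehom !comp_mpolyD mderivD !comp_mpolyZ -!/(dehom _) IHp dehomX mderivZ.
rewrite !mderivX /dehom comp_mpolyZ -/(dehom _) dehomX.
by congr (_ *: (_ *: 'X_[_]) + _); apply: mnm2P; rewrite !mnmBE !mnm1E.
Qed.

Lemma dehom_deriv1 p : dehom p^`M(1) = (dehom p)^`M(1).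
Proof.
elim/mpolyind: p => [|c m p _ _ IHp]; first by rewrite mderiv0 /dehom comp_mpoly0 mderiv0.
rewrite mderivD mderivZ /dehom !comp_mpolyD mderivD !comp_mpolyZ -!/(dehom _) IHp dehomX mderivZ.
rewrite !mderivX /dehom comp_mpolyZ -/(dehom _) dehomX.
by congr (_ *: (_ *: 'X_[_]) + _); apply: mnm2P; rewrite !mnmBE !mnm1E.
Qed.

Lemma at_originE p : at_origin p = (dehom p)@_(mnm2 0 0).
Proof.
rewrite /at_origin dehomE mevalE raddf_sum; apply: eq_bigr => m _ /=.
rewrite mcoeffZ mcoeffX; congr (_ * _).
rewrite !big_ord_recl big_ord0 eq_mnm2 /= !(tnth_nth 0) /= expr1n !mulr1 !expr0n.
by rewrite -natrM mulnb; congr (_ && _)%:R; congr (m _ == _); apply: val_inj.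
Qed.

Lemma at_origin_deriv0 p : at_origin p^`M(0) = (dehom p)@_(mnm2 1 0).
Proof.
by rewrite at_originE dehom_deriv0 mcoeff_deriv mnm2U0 mnm2D mnm2_0 mulr1n.
Qed.

Lemma at_origin_deriv1 p : at_origin p^`M(1) = (dehom p)@_(mnm2 0 1).
Proof.
by rewrite at_originE dehom_deriv1 mcoeff_deriv mnm2U1 mnm2D mnm2_1 mulr1n.
Qed.

End Dehomogenization.

(** * Complex coordinates on the space of cubic forms *)

Section ComplexCoordinates.
Variable (K : numClosedFieldType).
Implicit Types (p q : {mpoly K[2]}) (w : cubic_form K).
Local Notation i := ('i : K).

Lemma i_neq0 : i != 0. Proof. exact: neq0Ci. Qed.
Lemma ii : i * i = -1. Proof. by rewrite -expr2 sqrCi. Qed.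

Lemma half_i2 : (- i / 2) * (i *+ 2) = 1.
Proof. by transitivity (- (i * i)); [field|rewrite ii opprK]. Qed.

(** The coordinates x, y in terms of u = x + i y and v = x - i y; the inverse
substitution is xy_tuple. *)
Definition uv_tuple : 2.-tuple {mpoly K[2]} :=
  [tuple 2^-1 *: ('X_0 + 'X_1); (- i / 2) *: ('X_0 - 'X_1)].
Definition xy_tuple : 2.-tuple {mpoly K[2]} :=
  [tuple 'X_0 + i *: 'X_1; 'X_0 - i *: 'X_1].

Definition theta p := p \mPo uv_tuple.
Definition theta_inv p := p \mPo xy_tuple.

Lemma thetaD p q : theta (p + q) = theta p + theta q.
Proof. exact: comp_mpolyD. Qed.
Lemma thetaN p : theta (- p) = - theta p.
Proof. exact: comp_mpolyN. Qed.
Lemma thetaZ c p : theta (c *: p) = c *: theta p.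
Proof. exact: comp_mpolyZ. Qed.
Lemma thetaB p q : theta (p - q) = theta p - theta q.
Proof. exact: comp_mpolyB. Qed.
Lemma thetaM p q : theta (p * q) = theta p * theta q.
Proof. exact: rmorphM. Qed.
Lemma thetaXn p n : theta (p ^+ n) = theta p ^+ n.
Proof. exact: rmorphXn. Qed.

Lemma theta_invD p q : theta_inv (p + q) = theta_inv p + theta_inv q.
Proof. exact: comp_mpolyD. Qed.
Lemma theta_invZ c p : theta_inv (c *: p) = c *: theta_inv p.
Proof. exact: comp_mpolyZ. Qed.

Lemma uv_tuple_homog j : tnth uv_tuple j \is 1.-homog.
Proof.
move: j; apply: ord2_ind; rewrite (tnth_nth 0) /=; apply: dhomogZ.
  by apply: rpredD; apply: homogX1.
by apply: rpredB; apply: homogX1.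
Qed.

Lemma xy_tuple_homog j : tnth xy_tuple j \is 1.-homog.
Proof.
move: j; apply: ord2_ind; rewrite (tnth_nth 0) /=.
  by apply: rpredD; [|apply: dhomogZ]; apply: homogX1.
by apply: rpredB; [|apply: dhomogZ]; apply: homogX1.
Qed.

Lemma thetaX0 : theta 'X_0 = 2^-1 *: ('X_0 + 'X_1).
Proof. by rewrite /theta comp_mpolyXU. Qed.
Lemma thetaX1 : theta 'X_1 = (- i / 2) *: ('X_0 - 'X_1).
Proof. by rewrite /theta comp_mpolyXU. Qed.
Lemma theta_invX0 : theta_inv 'X_0 = 'X_0 + i *: 'X_1.
Proof. by rewrite /theta_inv comp_mpolyXU. Qed.
Lemma theta_invX1 : theta_inv 'X_1 = 'X_0 - i *: 'X_1.
Proof. by rewrite /theta_inv comp_mpolyXU. Qed.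

Lemma thetaK : cancel theta theta_inv.
Proof.
move=> p; rewrite /theta /theta_inv (@comp_mpolyA _ _ _ _ _ _ [tuple 'X_j | j < 2]).
  exact: comp_mpoly_id.
apply: ord2_ind; rewrite tnth_mktuple (tnth_nth 0) /= comp_mpolyZ.
  rewrite comp_mpolyD -!/(theta_inv _) theta_invX0 theta_invX1.
  by rewrite addrACA subrr addr0 -mulr2n -scaler_nat scalerA mulVf ?scale1r ?pnatr_eq0.
rewrite comp_mpolyB -!/(theta_inv _) theta_invX0 theta_invX1 opprB addrC addrA subrK.
by rewrite -scalerDl scalerA -mulr2n half_i2 scale1r.
Qed.

Lemma theta_invK : cancel theta_inv theta.
Proof.
move=> p; rewrite /theta /theta_inv (@comp_mpolyA _ _ _ _ _ _ [tuple 'X_j | j < 2]).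
  exact: comp_mpoly_id.
have h : i * (- i / 2) = 2^-1 by rewrite mulrA mulrN ii opprK mul1r.
apply: ord2_ind; rewrite tnth_mktuple (tnth_nth 0) /=.
  rewrite comp_mpolyD comp_mpolyZ -!/(theta _) thetaX0 thetaX1 scalerA h -scalerDr.
  by rewrite addrACA subrr addr0 -mulr2n -scaler_nat scalerA mulVf ?scale1r ?pnatr_eq0.
rewrite comp_mpolyB comp_mpolyZ -!/(theta _) thetaX0 thetaX1 scalerA h -scalerBr.
by rewrite opprB addrC addrA subrK -mulr2n -scaler_nat scalerA mulVf ?scale1r ?pnatr_eq0.
Qed.

Definition xcoef w := dehom (dx_coef w).
Definition ycoef w := dehom (dy_coef w).

(** In the coordinates u = x + i y, v = x - i y the vector field dual to the
form is, up to the factor i, u' = ucoef, v' = - vcoef. *)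
Definition ucoef w := theta (xcoef w + i *: ycoef w).
Definition vcoef w := theta (xcoef w - i *: ycoef w).

Definition acoef w j k := (ucoef w)@_(mnm2 j k).
Definition bcoef w j k := (vcoef w)@_(mnm2 j k).

Lemma xcoefE w : theta (xcoef w) = 2^-1 *: (ucoef w + vcoef w).
Proof.
rewrite /ucoef /vcoef /theta comp_mpolyD comp_mpolyB addrACA subrr addr0.
by rewrite -mulr2n -scaler_nat scalerA mulVf ?scale1r ?pnatr_eq0.
Qed.

Lemma ycoefE w : theta (ycoef w) = (- i / 2) *: (ucoef w - vcoef w).
Proof.
rewrite /ucoef /vcoef /theta comp_mpolyD comp_mpolyB opprB addrC addrA subrK.
by rewrite comp_mpolyZ -mulr2n scalerMnl scalerA half_i2 scale1r.
Qed.

Lemma dx_homog w : dx_coef w \is 3.-homog.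
Proof. exact: dhomog_is_dhomog. Qed.
Lemma dy_homog w : dy_coef w \is 3.-homog.
Proof. exact: dhomog_is_dhomog. Qed.

Lemma xcoef_is_linear : linear xcoef.
Proof. by move=> c w w'; rewrite /xcoef /dehom -linearP /dx_coef /= linearP. Qed.
Lemma ycoef_is_linear : linear ycoef.
Proof. by move=> c w w'; rewrite /ycoef /dehom -linearP /dy_coef /= linearP. Qed.

Lemma ucoef_is_linear : linear ucoef.
Proof.
move=> c w w'; rewrite /ucoef xcoef_is_linear ycoef_is_linear /theta -[RHS]linearP; congr (_ \mPo _).
by rewrite !scalerDr !scalerA ![i * c]mulrC addrACA.
Qed.
Lemma vcoef_is_linear : linear vcoef.
Proof.
move=> c w w'; rewrite /vcoef xcoef_is_linear ycoef_is_linear /theta -[RHS]linearP; congr (_ \mPo _).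
by rewrite !scalerDr !scalerN !scalerA ![i * c]mulrC opprD addrACA.
Qed.

Lemma acoef_linear j k : linear_for *%R (acoef ^~ j ^~ k).
Proof. by move=> c w w'; rewrite /acoef ucoef_is_linear mcoeffD mcoeffZ. Qed.
Lemma bcoef_linear j k : linear_for *%R (bcoef ^~ j ^~ k).
Proof. by move=> c w w'; rewrite /bcoef vcoef_is_linear mcoeffD mcoeffZ. Qed.

Lemma regular_acoef j k : regular (acoef ^~ j ^~ k).
Proof. exact/regular_linear/acoef_linear. Qed.
Lemma regular_bcoef j k : regular (bcoef ^~ j ^~ k).
Proof. exact/regular_linear/bcoef_linear. Qed.

Lemma theta_high p d : (forall j k, (d < j + k)%N -> p@_(mnm2 j k) = 0) ->
  forall j k, (d < j + k)%N -> (theta p)@_(mnm2 j k) = 0.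
Proof.
move=> pd j k ltd; apply: comp_mpoly_coef_eq0 => [|m]; first exact: uv_tuple_homog.
by rewrite mdeg_mnm2 mdeg2 -(mnm2K m) !mnm2_0 !mnm2_1 => e; apply: pd; rewrite e.
Qed.

Lemma theta_inv_high p d : (forall j k, (d < j + k)%N -> p@_(mnm2 j k) = 0) ->
  forall j k, (d < j + k)%N -> (theta_inv p)@_(mnm2 j k) = 0.
Proof.
move=> pd j k ltd; apply: comp_mpoly_coef_eq0 => [|m]; first exact: xy_tuple_homog.
by rewrite mdeg_mnm2 mdeg2 -(mnm2K m) !mnm2_0 !mnm2_1 => e; apply: pd; rewrite e.
Qed.

Lemma acoef_high w j k : (3 < j + k)%N -> acoef w j k = 0.
Proof.
move: j k; apply: theta_high => j k ltjk.
by rewrite mcoeffD mcoeffZ !(dehom_high _ ltjk) ?mulr0 ?addr0 ?dx_homog ?dy_homog.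
Qed.
Lemma bcoef_high w j k : (3 < j + k)%N -> bcoef w j k = 0.
Proof.
move: j k; apply: theta_high => j k ltjk.
by rewrite mcoeffB mcoeffZ !(dehom_high _ ltjk) ?mulr0 ?subr0 ?dx_homog ?dy_homog.
Qed.

Lemma form_surj (P Q : {mpoly K[2]}) :
  (forall j k, (3 < j + k)%N -> P@_(mnm2 j k) = 0) ->
  (forall j k, (3 < j + k)%N -> Q@_(mnm2 j k) = 0) ->
  exists w, xcoef w = P /\ ycoef w = Q.
Proof.
move=> /dehom_surj[p hp <-] /dehom_surj[q hq <-].
by exists (DHomog hp, DHomog hq).
Qed.

Lemma form_inj w w' : xcoef w = xcoef w' -> ycoef w = ycoef w' -> w = w'.
Proof.
case: w w' => [p q] [p' q'] ex ey; congr pair; apply/val_inj.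
  exact: dehom_inj (dx_homog (p, q)) (dx_homog (p', q')) ex.
exact: dehom_inj (dy_homog (p, q)) (dy_homog (p', q')) ey.
Qed.

Lemma form_ext w w' :
  (forall j k, acoef w j k = acoef w' j k /\ bcoef w j k = bcoef w' j k) -> w = w'.
Proof.
move=> ab; have eu : ucoef w = ucoef w' by apply/mpoly2P => j k; have [] := ab j k.
have ev : vcoef w = vcoef w' by apply/mpoly2P => j k; have [] := ab j k.
by apply: form_inj; apply: (can_inj thetaK); rewrite ?xcoefE ?ycoefE eu ev.
Qed.

Lemma form_exists (al be : nat -> nat -> K) : exists w, forall j k, (j + k <= 3)%N ->
  acoef w j k = al j k /\ bcoef w j k = be j k.
Proof.
have truncH f j k : (3 < j + k)%N -> (trunc 3 f : {mpoly K[2]})@_(mnm2 j k) = 0.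
  by move=> lt3; rewrite trunc_coef leqNgt lt3.
have [|| w [ex ey]] := @form_surj (theta_inv (2^-1 *: (trunc 3 al + trunc 3 be)))
    (theta_inv ((- i / 2) *: (trunc 3 al - trunc 3 be))).
- by apply: theta_inv_high => j k lt3; rewrite mcoeffZ mcoeffD !truncH ?addr0 ?mulr0.
- by apply: theta_inv_high => j k lt3; rewrite mcoeffZ mcoeffB !truncH ?subr0 ?mulr0.
have h : i * (- i / 2) = 2^-1 by rewrite mulrA mulrN ii opprK mul1r.
exists w => j k le3; rewrite /acoef /bcoef /ucoef /vcoef ex ey /theta comp_mpolyD comp_mpolyB.
rewrite comp_mpolyZ -!/(theta _) !theta_invK scalerA h.
rewrite mcoeffD mcoeffB !mcoeffZ mcoeffD mcoeffB !trunc_coef le3; split.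
  by field.
by field.
Qed.

Lemma theta_coef0 p : (theta p)@_(mnm2 0 0) = p@_(mnm2 0 0).
Proof.
have C00 c : (c%:MP : {mpoly K[2]})@_(mnm2 0 0) = c.
  by rewrite mcoeffC -mnm2_00 eqxx mulr1.
have : (theta (p - (p@_(mnm2 0 0))%:MP))@_(mnm2 0 0) = 0.
  apply: comp_mpoly_coef_eq0 => [|m]; first exact: uv_tuple_homog.
  rewrite mdeg_mnm2 => /eqP; rewrite mdeg_eq0 mnm2_00 => /eqP ->.
  by rewrite mcoeffB C00 subrr.
by rewrite /theta comp_mpolyB comp_mpolyC mcoeffB C00 => /eqP; rewrite subr_eq0 => /eqP.
Qed.

Lemma theta_coef1 p :
  (theta p)@_(mnm2 1 0) = 2^-1 * (p@_(mnm2 1 0) - i * p@_(mnm2 0 1)) /\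
  (theta p)@_(mnm2 0 1) = 2^-1 * (p@_(mnm2 1 0) + i * p@_(mnm2 0 1)).
Proof.
pose l : {mpoly K[2]} := p@_(mnm2 1 0) *: 'X_0 + p@_(mnm2 0 1) *: 'X_1.
have [X00 X01 X10 X11] : [/\ ('X_0 : {mpoly K[2]})@_(mnm2 1 0) = 1, ('X_0 : {mpoly K[2]})@_(mnm2 0 1) = 0,
   ('X_1 : {mpoly K[2]})@_(mnm2 1 0) = 0 & ('X_1 : {mpoly K[2]})@_(mnm2 0 1) = 1].
  by rewrite !mcoeffX mnm2U0 mnm2U1.
have q0 m : mdeg m = 1 -> (p - l)@_m = 0.
  rewrite -(mnm2K m) mdeg_mnm2; case: (m 0) (m 1) => [|[|//]] [|[|//]] // _.
    by rewrite mcoeffB mcoeffD !mcoeffZ X01 X11 mulr0 mulr1 add0r subrr.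
  by rewrite mcoeffB mcoeffD !mcoeffZ X00 X10 mulr0 mulr1 addr0 subrr.
have thl m : mdeg m = 1 -> (theta p)@_m = (theta l)@_m.
  move=> m1; rewrite -[p in LHS](subrK l) /theta comp_mpolyD mcoeffD.
  rewrite comp_mpoly_coef_eq0 ?add0r // => [|m' e]; first exact: uv_tuple_homog.
  by rewrite q0 ?e.
rewrite !thl ?mdeg_mnm2 // /theta comp_mpolyD !comp_mpolyZ -!/(theta _) thetaX0 thetaX1.
rewrite !mcoeffD !mcoeffZ !mcoeffD !mcoeffN X00 X01 X10 X11; by split; field.
Qed.

Lemma complex_pair_eq (a b c d : K) :
  (a + i * b = c + i * d /\ a - i * b = c - i * d) <-> (a = c /\ b = d).
Proof.
split=> [[eD eB]|[-> ->]//].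
have ea : a = c.
  transitivity (2^-1 * ((a + i * b) + (a - i * b))); first by field.
  by rewrite eD eB; field.
by split=> //; move: eD; rewrite ea => /addrI /(mulfI i_neq0).
Qed.

(** The conditions at the origin say that the vector field has the linear part
u' = u, v' = - v. *)
Lemma poincareP w : poincare K w <->
  [/\ acoef w 0 0 = 0 /\ bcoef w 0 0 = 0, acoef w 1 0 = 1 /\ bcoef w 0 1 = 1 &
      acoef w 0 1 = 0 /\ bcoef w 1 0 = 0].
Proof.
rewrite /poincare /= !at_origin_deriv0 !at_origin_deriv1 !at_originE.
rewrite -/(xcoef w) -/(ycoef w) /acoef /bcoef /ucoef /vcoef !theta_coef0.
have [-> ->] := theta_coef1 (xcoef w + i *: ycoef w).
have [-> ->] := theta_coef1 (xcoef w - i *: ycoef w).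
rewrite !mcoeffB !mcoeffD !mcoeffZ.
move: (xcoef w)@_(mnm2 0 0) (xcoef w)@_(mnm2 1 0) (xcoef w)@_(mnm2 0 1).
move: (ycoef w)@_(mnm2 0 0) (ycoef w)@_(mnm2 1 0) (ycoef w)@_(mnm2 0 1).
move=> q00 q10 q01 p00 p10 p01.
have e00 : (p00 + i * q00 = 0 /\ p00 - i * q00 = 0) <-> (p00 = 0 /\ q00 = 0).
  by have := complex_pair_eq p00 q00 0 0; rewrite mulr0 addr0 subr0.
set a := p10 + i * q10; set b := i * (p01 + i * q01).
set c := p10 - i * q10; set d := i * (p01 - i * q01).
split=> [[/e00 h0 [p1 q1] [p0 q0]]|[/e00 h0 [e1 e2] [e3 e4]]].
  have -> : a = 1 by rewrite /a p1 q0 mulr0 addr0.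
  have -> : c = 1 by rewrite /c p1 q0 mulr0 subr0.
  have -> : b = -1 by rewrite /b p0 q1 add0r mulr1 ii.
  have -> : d = 1 by rewrite /d p0 q1 mulr1 sub0r mulrN ii opprK.
  by split=> //; split; field.
have ea : a = 1.
  by transitivity (2^-1 * (a - b) + 2^-1 * (a + b)); [field|rewrite e1 e3 addr0].
have eb : b = -1.
  by transitivity (2^-1 * (a + b) - 2^-1 * (a - b)); [field|rewrite e1 e3 sub0r].
have ec : c = 1.
  by transitivity (2^-1 * (c - d) + 2^-1 * (c + d)); [field|rewrite e2 e4 add0r].
have ed : d = 1.
  by transitivity (2^-1 * (c + d) - 2^-1 * (c - d)); [field|rewrite e2 e4 subr0].
have [|p1 q0] := (complex_pair_eq p10 q10 1 0).1.
- by rewrite mulr0 addr0 subr0.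
have [|p0 q1] := (complex_pair_eq p01 q01 0 1).1.
- rewrite mulr1 add0r sub0r; split; apply: (mulfI i_neq0); first by rewrite -/b eb ii.
  by rewrite -/d ed mulrN ii opprK.
by [].
Qed.

End ComplexCoordinates.

(** * Mirror symmetry in complex coordinates *)

Section MirrorSymmetry.
Variable (K : numClosedFieldType).
Implicit Types (p q : {mpoly K[2]}) (w : cubic_form K).
Local Notation i := ('i : K).

Definition swap_tuple : 2.-tuple {mpoly K[2]} := [tuple 'X_1; 'X_0].
Definition flip_tuple : 2.-tuple {mpoly K[2]} := [tuple 'X_0; - 'X_1].
Definition scale_tuple (t : K) : 2.-tuple {mpoly K[2]} := [tuple t^-1 *: 'X_0; t *: 'X_1].
Definition rotation_tuple (a b : K) : 2.-tuple {mpoly K[2]} :=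
  [tuple a *: 'X_0 + b *: 'X_1; - b *: 'X_0 + a *: 'X_1].

Lemma swap_coef p j k : (p \mPo swap_tuple)@_(mnm2 j k) = p@_(mnm2 k j).
Proof.
rewrite comp_mpolyEX {3}[p]mpolyE !raddf_sum; apply: eq_bigr => m _ /=.
rewrite !mcoeffZ; congr (_ * _).
rewrite -(mnm2K m) [in LHS]mpolyX2 rmorphM !rmorphXn /= !comp_mpolyXU /= mulrC -[in LHS]mpolyX2.
by rewrite !mcoeffX !eq_mnm2 andbC.
Qed.

Lemma scale_coef t p j k :
  (p \mPo scale_tuple t)@_(mnm2 j k) = t^-1 ^+ j * t ^+ k * p@_(mnm2 j k).
Proof.
rewrite comp_mpolyEX {3}[p]mpolyE !raddf_sum mulr_sumr; apply: eq_bigr => m _ /=.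
rewrite !mcoeffZ mulrCA; congr (_ * _).
rewrite -(mnm2K m) [in LHS]mpolyX2 rmorphM !rmorphXn /= !comp_mpolyXU /= !exprZn.
rewrite -scalerAl -scalerAr scalerA -mpolyX2 mcoeffZ !mcoeffX eq_mnm2.
by case: eqP => [->|]; case: eqP => [->|]; rewrite ?mulr0.
Qed.

(** The reflection y -> - y exchanges u and v. *)
Lemma theta_swap p : theta (p \mPo flip_tuple) = theta p \mPo swap_tuple.
Proof.
pose r := [tuple 2^-1 *: ('X_0 + 'X_1); - ((- i / 2) *: ('X_0 - 'X_1))] : 2.-tuple {mpoly K[2]}.
rewrite /theta !(@comp_mpolyA _ _ _ _ _ _ r) //; apply: ord2_ind; rewrite !(tnth_nth 0) /=.
- by rewrite comp_mpolyZ comp_mpolyD !comp_mpolyXU addrC.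
- by rewrite comp_mpolyZ comp_mpolyB !comp_mpolyXU -scalerN opprB.
- by rewrite comp_mpolyXU.
- by rewrite comp_mpolyN comp_mpolyXU.
Qed.

(** Rotations are diagonal in the coordinates u and v. *)
Lemma theta_rotation (t : K) p : t != 0 ->
  theta (p \mPo rotation_tuple (2^-1 * (t + t^-1)) ((- i / 2) * (t - t^-1))) =
  theta p \mPo scale_tuple t.
Proof.
move=> t0; pose r := [tuple 2^-1 *: (t^-1 *: 'X_0 + t *: 'X_1);
  (- i / 2) *: (t^-1 *: 'X_0 - t *: 'X_1)] : 2.-tuple {mpoly K[2]}.
have qq : (- i / 2) * (- i / 2) = - (2^-1 * 2^-1).
  by transitivity (i * i / 2 / 2); [field|rewrite ii; field].
rewrite /theta !(@comp_mpolyA _ _ _ _ _ _ r) //; apply: ord2_ind; rewrite !(tnth_nth 0) /=.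
- by rewrite comp_mpolyZ comp_mpolyD !comp_mpolyXU.
- by rewrite comp_mpolyZ comp_mpolyB !comp_mpolyXU.
- rewrite comp_mpolyD !comp_mpolyZ -!/(theta _) thetaX0 thetaX1 !scalerA
    [- i / 2 * _ * _]mulrAC qq.
  by apply/mpoly2P => j k; rewrite !(mcoeffZ, mcoeffD, mcoeffN); field.
- rewrite comp_mpolyD !comp_mpolyZ -!/(theta _) thetaX0 thetaX1 !scalerA.
  by apply/mpoly2P => j k; rewrite !(mcoeffZ, mcoeffD, mcoeffN); field.
Qed.

Lemma flip_theta p c : p \mPo flip_tuple = c *: p <->
  theta p \mPo swap_tuple = c *: theta p.
Proof.
rewrite -theta_swap -thetaZ; split=> [->//|e]; exact: can_inj (@thetaK K) _ _ e.
Qed.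

Lemma swap_sym p q : (p \mPo swap_tuple = 1 *: p /\ q \mPo swap_tuple = -1 *: q) <->
  forall j k, (p - i *: q)@_(mnm2 k j) = (p + i *: q)@_(mnm2 j k).
Proof.
split=> [[ep eq] j k|pq].
  have : (p \mPo swap_tuple)@_(mnm2 j k) = p@_(mnm2 j k) by rewrite ep scale1r.
  have : (q \mPo swap_tuple)@_(mnm2 j k) = - q@_(mnm2 j k).
    by rewrite eq mcoeffZ mulN1r.
  rewrite !swap_coef mcoeffB mcoeffD !mcoeffZ => -> ->.
  by rewrite mulrN opprK.
have e j k : p@_(mnm2 k j) - p@_(mnm2 j k) = i * (q@_(mnm2 j k) + q@_(mnm2 k j)).
  have := pq j k; rewrite mcoeffB mcoeffD !mcoeffZ => /(canRL (subrK _)) ->.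
  by ring.
have q0 j k : q@_(mnm2 j k) + q@_(mnm2 k j) = 0.
  have : 2 * i * (q@_(mnm2 j k) + q@_(mnm2 k j)) = 0.
    transitivity (i * (q@_(mnm2 j k) + q@_(mnm2 k j)) +
                  i * (q@_(mnm2 k j) + q@_(mnm2 j k))); first by ring.
    by rewrite -!e; ring.
  by move/eqP; rewrite !mulf_eq0 pnatr_eq0 (negbTE (i_neq0 K)) => /eqP.
split; apply/mpoly2P => j k; rewrite swap_coef mcoeffZ.
  by apply/eqP; rewrite mul1r -subr_eq0 e q0 mulr0.
by apply/eqP; rewrite mulN1r -subr_eq0 opprK addrC q0.
Qed.

Lemma symmetricP w : x_axis_symmetric w <-> forall j k, bcoef w k j = acoef w j k.
Proof.
have dehom_flip (p : {mpoly K[3]}) : dehom (p \mPo [tuple 'X_0; - 'X_1; 'X_2]) = dehom p \mPo flip_tuple.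
  by apply: dehom_comp; rewrite /dehom !(tnth_nth 0) /= ?comp_mpolyN comp_mpolyXU.
have hflip j : tnth [tuple 'X_0; - 'X_1; 'X_2 : {mpoly K[3]}] j \is 1.-homog.
  by case: j => -[|[|[|//]]] ltj; rewrite (tnth_nth 0) /= ?dhomogN homogX1.
have dehomZ c (p : {mpoly K[3]}) : dehom (c *: p) = c *: dehom p by exact: comp_mpolyZ.
have flipP c (p : {mpoly K[3]}) : p \is 3.-homog ->
    (p \mPo [tuple 'X_0; - 'X_1; 'X_2] = c *: p <->
     theta (dehom p) \mPo swap_tuple = c *: theta (dehom p)).
  move=> hp; rewrite -flip_theta -dehom_flip -dehomZ; split=> [->//|].
  exact: (@dehom_inj _ 3 _ _ (comp_mpoly_homog hflip hp) (dhomogZ c hp)).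
have hx : dx_coef w \mPo [tuple 'X_0; - 'X_1; 'X_2] = 1 *: dx_coef w <->
    theta (xcoef w) \mPo swap_tuple = 1 *: theta (xcoef w) := flipP 1 _ (dx_homog w).
have hy : dy_coef w \mPo [tuple 'X_0; - 'X_1; 'X_2] = -1 *: dy_coef w <->
    theta (ycoef w) \mPo swap_tuple = -1 *: theta (ycoef w) := flipP (-1) _ (dy_homog w).
rewrite /acoef /bcoef /ucoef /vcoef thetaB thetaD thetaZ; split=> [[ex ey]|ab].
  by apply/swap_sym; split; [apply/hx; rewrite scale1r|apply/hy; rewrite scaleN1r].
by move/swap_sym: ab => [/hx ex /hy ey]; rewrite scale1r in ex; rewrite scaleN1r in ey.
Qed.

(** A rotation is determined by its eigenvalue t = a + i b, whose inverse is a
- i b because a ^ 2 + b ^ 2 = 1. *)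
Lemma so2P (g : 'M[K]_2) : in_SO2 g <-> exists2 t : K, t != 0 &
  [/\ g 0 0 = 2^-1 * (t + t^-1), g 1 1 = 2^-1 * (t + t^-1),
      g 0 1 = (- i / 2) * (t - t^-1) & g 1 0 = - ((- i / 2) * (t - t^-1))].
Proof.
have e a b : (g *m g^T) a b = g a 0 * g b 0 + g a 1 * g b 1.
  by rewrite !mxE big_ord_recl big_ord1 !mxE (_ : lift ord0 ord0 = 1) //; exact: val_inj.
have detE : \det g = g 0 0 * g 1 1 - g 0 1 * g 1 0.
  rewrite (expand_det_row _ 0) big_ord_recl big_ord1 /cofactor !det_mx11 !mxE /=.
  rewrite expr0 expr1 mul1r mulN1r mulrN.
  by congr (g _ _ * g _ _ - g _ _ * g _ _); apply: val_inj.
split=> [[gg dg]|[t t0 [g00 g11 g01 g10]]].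
  have e00 := e 0 0; have e01 := e 0 1; have e11 := e 1 1.
  rewrite gg !mxE /= ?mulr1n ?mulr0n in e00 e01 e11.
  rewrite detE in dg.
  set a := g 0 0 in e00 e01 dg *; set b := g 0 1 in e00 e01 dg *.
  set c := g 1 0 in e01 e11 dg *; set d := g 1 1 in e01 e11 dg *.
  have ad : d = a.
    transitivity (a * (a * d - b * c) + b * (a * c + b * d) + d * (1 - (a * a + b * b))).
      by ring.
    by rewrite dg -e01 -e00 subrr !mulr0 mulr1 !addr0.
  have bc : c = - b.
    transitivity (a * (a * c + b * d) - b * (a * d - b * c) + c * (1 - (a * a + b * b))).
      by ring.
    by rewrite dg -e01 -e00 subrr !mulr0 mulr1 add0r addr0.
  have tt : (a + i * b) * (a - i * b) = 1.
    by transitivity (a * a - (i * i) * (b * b)); [ring|rewrite ii mulN1r opprK].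
  have t0 : a + i * b != 0.
    by apply: contra_eq_neq tt => ->; rewrite mul0r eq_sym oner_neq0.
  have tV : (a + i * b)^-1 = a - i * b by apply: (mulfI t0); rewrite tt divff.
  exists (a + i * b) => //; rewrite tV ad bc.
  have ha : a = 2^-1 * (a + i * b + (a - i * b)) by field.
  have hb : b = - i / 2 * (a + i * b - (a - i * b)).
    by transitivity (- (i * i) * b); [rewrite ii opprK mul1r|field].
  by split=> //; rewrite -hb.
have iq : (- i / 2 * (t - t^-1)) * (- i / 2 * (t - t^-1)) =
    - (2^-1 * (t - t^-1)) * (2^-1 * (t - t^-1)).
  by transitivity ((i * i) * ((2^-1 * (t - t^-1)) * (2^-1 * (t - t^-1))));
    [field|rewrite ii; ring].
have sum1 : 2^-1 * (t + t^-1) * (2^-1 * (t + t^-1)) +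
    - i / 2 * (t - t^-1) * (- i / 2 * (t - t^-1)) = 1 by rewrite iq; field.
split; last first.
  by rewrite detE g00 g11 g01 g10 mulrN opprK.
apply/matrixP; apply: ord2_ind; apply: ord2_ind; rewrite e !mxE /= ?mulr1n ?mulr0n ?(g00, g11, g01, g10) //.
- by ring.
- by ring.
- by rewrite mulrNN addrC.
Qed.

Lemma complex_mpoly_eq p q p' q' : p + i *: q = p' + i *: q' ->
  p - i *: q = p' - i *: q' -> p = p' /\ q = q'.
Proof.
move=> eD eB; split; apply/mpoly2P => j k.
  have [] := (complex_pair_eq p@_(mnm2 j k) q@_(mnm2 j k) p'@_(mnm2 j k) q'@_(mnm2 j k)).1 => //.
  by rewrite -!mcoeffZ -!mcoeffD -!mcoeffB eD eB.
have [] := (complex_pair_eq p@_(mnm2 j k) q@_(mnm2 j k) p'@_(mnm2 j k) q'@_(mnm2 j k)).1 => //.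
by rewrite -!mcoeffZ -!mcoeffD -!mcoeffB eD eB.
Qed.

Lemma pullback_poly (a b : K) p q :
  (a *: p + (- b) *: q) + i *: (b *: p + a *: q) = (a + i * b) *: (p + i *: q) /\
  (a *: p + (- b) *: q) - i *: (b *: p + a *: q) = (a - i * b) *: (p - i *: q).
Proof.
have e (x y : K) : (a + i * b) * (x + i * y) = a * x - b * y + i * (b * x + a * y).
  by transitivity (a * x + (i * i) * (b * y) + i * (b * x + a * y)); [ring|rewrite ii; ring].
have e' (x y : K) : (a - i * b) * (x - i * y) = a * x - b * y - i * (b * x + a * y).
  by transitivity (a * x + (i * i) * (b * y) - i * (b * x + a * y)); [ring|rewrite ii; ring].
split; apply/mpoly2P => j k; rewrite !(mcoeffZ, mcoeffD, mcoeffN) ?e ?e'; ring.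
Qed.

Lemma rotation_scalars (t : K) : t != 0 ->
  2^-1 * (t + t^-1) + i * ((- i / 2) * (t - t^-1)) = t /\
  2^-1 * (t + t^-1) - i * ((- i / 2) * (t - t^-1)) = t^-1.
Proof.
move=> t0; split.
  transitivity (2^-1 * (t + t^-1) - (i * i) * (2^-1 * (t - t^-1))); first by field.
  by rewrite ii; field.
transitivity (2^-1 * (t + t^-1) + (i * i) * (2^-1 * (t - t^-1))); first by field.
by rewrite ii; field.
Qed.

Definition pullback_dx (a b : K) p q :=
  a *: (p \mPo rotation_tuple a b) + (- b) *: (q \mPo rotation_tuple a b).
Definition pullback_dy (a b : K) p q :=
  b *: (p \mPo rotation_tuple a b) + a *: (q \mPo rotation_tuple a b).

Lemma theta_pullback (t : K) p q : t != 0 ->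
  let a := 2^-1 * (t + t^-1) in let b := (- i / 2) * (t - t^-1) in
  theta (pullback_dx a b p q + i *: pullback_dy a b p q) =
    t *: (theta (p + i *: q) \mPo scale_tuple t) /\
  theta (pullback_dx a b p q - i *: pullback_dy a b p q) =
    t^-1 *: (theta (p - i *: q) \mPo scale_tuple t).
Proof.
move=> t0 a b; have [abD abB] := rotation_scalars t0.
rewrite /pullback_dx /pullback_dy.
have [-> ->] := pullback_poly a b (p \mPo rotation_tuple a b) (q \mPo rotation_tuple a b).
rewrite /a /b abD abB !thetaZ -(theta_rotation (p + i *: q) t0).
by rewrite -(theta_rotation (p - i *: q) t0) comp_mpolyD comp_mpolyB !comp_mpolyZ.
Qed.

Lemma pullback_coefP (t : K) p q p' q' : t != 0 ->
  let a := 2^-1 * (t + t^-1) in let b := (- i / 2) * (t - t^-1) in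
  (p' = pullback_dx a b p q /\ q' = pullback_dy a b p q) <-> forall j k,
    (theta (p' + i *: q'))@_(mnm2 j k) =
      t * (t^-1 ^+ j * t ^+ k * (theta (p + i *: q))@_(mnm2 j k)) /\
    (theta (p' - i *: q'))@_(mnm2 j k) =
      t^-1 * (t^-1 ^+ j * t ^+ k * (theta (p - i *: q))@_(mnm2 j k)).
Proof.
move=> t0 a b; have [uE vE] := theta_pullback p q t0.
split=> [[-> ->] j k|coefs]; first by rewrite -!scale_coef -!mcoeffZ uE vE.
apply: complex_mpoly_eq; apply: (can_inj (@thetaK K)); apply/mpoly2P => j k.
  have := congr1 (mcoeff (mnm2 j k)) uE; rewrite mcoeffZ scale_coef => e.
  exact: etrans (coefs j k).1 (esym e).
have := congr1 (mcoeff (mnm2 j k)) vE; rewrite mcoeffZ scale_coef => e.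
exact: etrans (coefs j k).2 (esym e).
Qed.

Lemma pullbackP (g : 'M[K]_2) (t : K) w0 w : t != 0 ->
  g 0 0 = 2^-1 * (t + t^-1) -> g 1 1 = 2^-1 * (t + t^-1) ->
  g 0 1 = (- i / 2) * (t - t^-1) -> g 1 0 = - ((- i / 2) * (t - t^-1)) ->
  is_pullback g w0 w <-> forall j k,
    acoef w j k = t * (t^-1 ^+ j * t ^+ k * acoef w0 j k) /\
    bcoef w j k = t^-1 * (t^-1 ^+ j * t ^+ k * bcoef w0 j k).
Proof.
move=> t0 g00 g11 g01 g10.
rewrite -[X in _ <-> X]/(forall j k,
    (theta (xcoef w + i *: ycoef w))@_(mnm2 j k) =
      t * (t^-1 ^+ j * t ^+ k * (theta (xcoef w0 + i *: ycoef w0))@_(mnm2 j k)) /\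
    (theta (xcoef w - i *: ycoef w))@_(mnm2 j k) =
      t^-1 * (t^-1 ^+ j * t ^+ k * (theta (xcoef w0 - i *: ycoef w0))@_(mnm2 j k))).
apply: iff_trans (pullback_coefP (xcoef w0) (ycoef w0) (xcoef w) (ycoef w) t0).
set a := 2^-1 * (t + t^-1) in g00 g11 *; set b := - i / 2 * (t - t^-1) in g01 g10 *.
pose phi := [tuple g 0 0 *: 'X_0 + g 0 1 *: 'X_1; g 1 0 *: 'X_0 + g 1 1 *: 'X_1;
  'X_2 : {mpoly K[3]}].
have dehom_phi (p : {mpoly K[3]}) : dehom (p \mPo phi) = dehom p \mPo rotation_tuple a b.
  apply: dehom_comp; rewrite /phi /dehom !(tnth_nth 0) /= ?g00 ?g01 ?g10 ?g11.
  - by rewrite comp_mpolyD !comp_mpolyZ !comp_mpolyXU.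
  - by rewrite comp_mpolyD !comp_mpolyZ !comp_mpolyXU.
  - by rewrite comp_mpolyXU.
have hphi j : tnth phi j \is 1.-homog.
  by case: j => -[|[|[|//]]] ltj; rewrite (tnth_nth 0) /= ?homogX1 //;
    apply: rpredD; apply: dhomogZ; apply: homogX1.
have hom c d : c *: (dx_coef w0 \mPo phi) + d *: (dy_coef w0 \mPo phi) \is 3.-homog.
  by apply: rpredD; apply: dhomogZ; apply: comp_mpoly_homog hphi _;
    [apply: dx_homog|apply: dy_homog].
have dh c d : dehom (c *: (dx_coef w0 \mPo phi) + d *: (dy_coef w0 \mPo phi)) =
    c *: (xcoef w0 \mPo rotation_tuple a b) + d *: (ycoef w0 \mPo rotation_tuple a b).
  by rewrite -!dehom_phi [LHS]comp_mpolyD !comp_mpolyZ.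
rewrite /is_pullback /= -/phi g00 g01 g10 g11 /pullback_dx /pullback_dy -!dh.
split=> [[ex ey]|[ex ey]]; first by rewrite /xcoef /ycoef ex ey.
split; first exact: dehom_inj (dx_homog w) (hom _ _) ex.
exact: dehom_inj (dy_homog w) (hom _ _) ey.
Qed.

(** The rotation with eigenvalues t, t^-1 multiplies the coefficients by powers
of t, while the reflection exchanges u and v: the forms symmetric in some line
are those with vcoef obtained from ucoef by a swap and a rescaling by s = t ^ 2. *)
Lemma mirror_symmetricP w : mirror_symmetric w <-> exists2 s : K, s != 0 &
  forall j k, bcoef w k j * s ^+ k.+1 = s ^+ j * acoef w j k.
Proof.
split=> [[g [w0 [/so2P[t t0 [g00 g11 g01 g10]] /symmetricP sym /(pullbackP _ _ t0 g00 g11 g01 g10) pb]]]|].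
  exists (t ^+ 2) => [|j k]; first by rewrite expf_eq0.
  have [_ ->] := pb k j; have [-> _] := pb j k; rewrite sym -!exprM.
  move: (acoef w0 j k) => x; rewrite !exprVn !mul2n -!addnn !exprD !exprS.
  have tj : t ^+ j != 0 by rewrite expf_neq0.
  have tk : t ^+ k != 0 by rewrite expf_neq0.
  by field; rewrite ?t0 ?tj ?tk.
move=> [s s0 sE]; pose t := sqrtC s.
have t0 : t != 0 by rewrite sqrtC_eq0.
have ts : t ^+ 2 = s by rewrite sqrtCK.
pose c j k := t^-1 * (t ^+ j * t^-1 ^+ k * acoef w j k).
have [w0 w0E] := form_exists c (fun k j => c j k).
have w0A j k : acoef w0 j k = c j k.
  have [/w0E[]//|lt3] := leqP (j + k) 3.
  by rewrite /c !acoef_high ?mulr0.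
have w0B j k : bcoef w0 k j = c j k.
  have [|lt3] := leqP (k + j) 3; first by case/w0E.
  by rewrite /c bcoef_high // acoef_high ?mulr0 // addnC.
pose g : 'M[K]_2 := \matrix_(x, y) if x == y then 2^-1 * (t + t^-1) else
  if x == 0 then (- i / 2) * (t - t^-1) else - ((- i / 2) * (t - t^-1)).
have gE : [/\ g 0 0 = 2^-1 * (t + t^-1), g 1 1 = 2^-1 * (t + t^-1),
      g 0 1 = (- i / 2) * (t - t^-1) & g 1 0 = - ((- i / 2) * (t - t^-1))].
  by rewrite !mxE.
exists g, w0; split.
- by apply/so2P; exists t.
- by apply/symmetricP => j k; rewrite w0A w0B.
case: gE => g00 g11 g01 g10; apply/(pullbackP _ _ t0 g00 g11 g01 g10) => j k.
rewrite w0A w0B /c !exprVn.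
have tj : t ^+ j != 0 by rewrite expf_neq0.
have tk : t ^+ k != 0 by rewrite expf_neq0.
split; first by field; rewrite ?t0 ?tj ?tk.
have := sE k j; rewrite -ts -!exprM !mul2n -!addnn !exprD !exprS => e.
have {e} -> : bcoef w j k = t ^+ k * t ^+ k * acoef w k j / (t * t ^+ j * (t * t ^+ j)).
  by rewrite -e mulfK // !mulf_neq0.
by field; rewrite ?t0 ?tj ?tk.
Qed.

End MirrorSymmetry.

(** * Derivations with a linear center *)

Section OrderFiltration.
Variable (K : numFieldType).
Implicit Types (p q : {mpoly K[2]}).

(** Computing modulo terms of degree at least d replaces formal power series
by polynomials. *)
Definition ord_ge d p := forall m, (mdeg m < d)%N -> p@_m = 0.

Lemma ord_ge_le d e p : (d <= e)%N -> ord_ge e p -> ord_ge d p.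
Proof. by move=> led op m ltd; apply: op; apply: leq_trans led. Qed.

Lemma ord_ge0 d : ord_ge d 0. Proof. by move=> m _; rewrite mcoeff0. Qed.

Lemma ord_geD d p q : ord_ge d p -> ord_ge d q -> ord_ge d (p + q).
Proof. by move=> op oq m ltd; rewrite mcoeffD op ?oq ?addr0. Qed.

Lemma ord_geZ d c p : ord_ge d p -> ord_ge d (c *: p).
Proof. by move=> op m ltd; rewrite mcoeffZ op ?mulr0. Qed.

Lemma ord_geB d p q : ord_ge d p -> ord_ge d q -> ord_ge d (p - q).
Proof. by move=> op oq m ltd; rewrite mcoeffB op ?oq ?subr0. Qed.

Lemma ord_geM d e p q : ord_ge d p -> ord_ge e q -> ord_ge (d + e)%N (p * q).
Proof.
move=> op oq m ltde; rewrite mcoeffM big1 // => -[m1 m2] /= /eqP e12.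
have [ltd|led] := ltnP (mdeg m1) d; first by rewrite op ?mul0r.
rewrite oq ?mulr0 //; have := congr1 (@mdeg 2) e12; rewrite mdegD; move: ltde led; lia.
Qed.

Lemma ord_geX d p n : ord_ge d p -> ord_ge (d * n)%N (p ^+ n).
Proof.
move=> op; elim: n => [|n IHn]; first by rewrite muln0.
by rewrite exprS mulnS; apply: ord_geM.
Qed.

Lemma ord_ge_var (j : 'I_2) : ord_ge 1 ('X_j : {mpoly K[2]}).
Proof.
move=> m; rewrite ltnS leqn0 mdeg_eq0 => /eqP ->; rewrite mcoeffX.
by rewrite mnm1_eq0.
Qed.

Lemma ord_ge_deriv d p j : ord_ge d.+1 p -> ord_ge d p^`M(j).
Proof. by move=> op m ltd; rewrite mcoeff_deriv op ?mul0rn // mdegD mdeg1 addn1. Qed.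

Lemma ord_ge_comp d (t : 2.-tuple {mpoly K[2]}) p :
  (forall j, tnth t j \is 1.-homog) -> ord_ge d p -> ord_ge d (p \mPo t).
Proof.
by move=> t1 op m ltd; apply: comp_mpoly_coef_eq0 => // m' e; apply: op; rewrite e.
Qed.

Lemma mcoeffMX2 p j k a b : (p * 'X_[mnm2 j k])@_(mnm2 a b) =
  if (j <= a)%N && (k <= b)%N then p@_(mnm2 (a - j) (b - k)) else 0.
Proof.
case: ifP => [/andP[lea leb]|nle].
  by rewrite -{1}(subnKC lea) -{1}(subnKC leb) -mnm2D; exact: mcoeffMX.
apply/eqP; rewrite mcoeff_eq0; apply: contraFN nle => /msuppM_le.
rewrite msuppX => /allpairsP[[m1 m2] /= [_]]; rewrite inE => /eqP -> e.
by rewrite -(mnm2_0 a b) -{2}(mnm2_1 a b) e !mnmDE !leq_addl.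
Qed.

(** This is the formula by which products of formal series are defined. *)
Lemma mcoeffM2 p q a b : (p * q)@_(mnm2 a b) =
  \sum_(k < a.+1) \sum_(l < b.+1) p@_(mnm2 k l) * q@_(mnm2 (a - k) (b - l)).
Proof.
rewrite {1}[p]mpolyE mulr_suml raddf_sum /=.
transitivity (\sum_(m <- msupp p) p@_m *
  (if (m 0%R <= a)%N && (m 1%R <= b)%N then q@_(mnm2 (a - m 0%R) (b - m 1%R)) else 0)).
  apply: eq_bigr => m _; rewrite -scalerAl mcoeffZ; congr (_ * _); rewrite mulrC.
  by rewrite -{1}(mnm2K m) mcoeffMX2.
transitivity (\sum_(k < a.+1) \sum_(l < b.+1) \sum_(m <- msupp p)
  p@_m * ((m == mnm2 k l)%:R * q@_(mnm2 (a - k) (b - l)))); last first.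
  apply: eq_bigr => k _; apply: eq_bigr => l _.
  rewrite {3}[p]mpolyE raddf_sum mulr_suml; apply: eq_bigr => m _ /=.
  by rewrite mcoeffZ mcoeffX mulrA.
under [RHS]eq_bigr do rewrite exchange_big.
rewrite exchange_big /=; apply: eq_bigr => m _.
under [RHS]eq_bigr do rewrite -mulr_sumr.
rewrite -mulr_sumr; congr (_ * _).
case: ifP => [/andP[lea leb]|nle].
  have lta : (m 0%R < a.+1)%N by []. have ltb : (m 1%R < b.+1)%N by [].
  rewrite (bigD1 (Ordinal lta)) //= (bigD1 (Ordinal ltb)) //= mnm2K eqxx mul1r.
  rewrite !big1 ?addr0 // => [k nek|l nel].
    rewrite big1 // => l _; rewrite -{1}(mnm2K m) eq_mnm2.
    by rewrite (_ : (m 0%R == k) = false) ?mul0r //; apply: contraNF nek => /eqP e; apply/eqP/val_inj.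
  rewrite -{1}(mnm2K m) eq_mnm2.
  by rewrite (_ : (m 1%R == l) = false) ?andbF ?mul0r //; apply: contraNF nel => /eqP e; apply/eqP/val_inj.
rewrite big1 // => k _; rewrite big1 // => l _.
rewrite -{1}(mnm2K m) eq_mnm2; case: eqP => [e0|]; case: eqP => [e1|]; rewrite ?mul0r //.
by move: nle; rewrite e0 e1 !leq_ord.
Qed.

Lemma mpoly_ring_ind n (P : {mpoly K[n]} -> Prop) :
  (forall c, P c%:MP) -> (forall i, P 'X_i) ->
  (forall f g, P f -> P g -> P (f + g)) -> (forall f g, P f -> P g -> P (f * g)) ->
  forall f, P f.
Proof.
move=> PC PX PD PM; elim/mpolyind => [|c m f _ _ IHf]; first by rewrite -mpolyC0.
apply: PD IHf; rewrite -mul_mpolyC; apply: (PM _ _ (PC c)); rewrite mpolyXE_id.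
elim/big_ind: _ => [|f1 f2|i _]; [by rewrite -mpolyC1|exact: PM|].
elim: (m i) => [|k IHk]; first by rewrite expr0 -mpolyC1.
by rewrite exprS; apply: PM.
Qed.

End OrderFiltration.

Section LinearCenter.
Variables (K : numFieldType) (U V : {mpoly K[2]}).
Hypotheses (U1 : ord_ge 2 (U - 'X_0)) (V1 : ord_ge 2 (V - 'X_1)).
Implicit Types (f g h : {mpoly K[2]}).

(** The derivative of f along the vector field u' = U, v' = - V. *)
Definition lie f := f^`M(0) * U - f^`M(1) * V.

Lemma lieD f g : lie (f + g) = lie f + lie g.
Proof. by rewrite /lie !mderivD; ring. Qed.
Lemma lieN f : lie (- f) = - lie f.
Proof. by rewrite /lie !mderivN; ring. Qed.
Lemma lieB f g : lie (f - g) = lie f - lie g.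
Proof. by rewrite lieD lieN. Qed.
Lemma lieZ c f : lie (c *: f) = c *: lie f.
Proof. by rewrite /lie !mderivZ -!scalerAl scalerBr. Qed.
Lemma lieM f g : lie (f * g) = lie f * g + f * lie g.
Proof. by rewrite /lie !mderivM; ring. Qed.
Lemma lieX f n : lie (f ^+ n.+1) = (f ^+ n * lie f) *+ n.+1.
Proof.
elim: n => [|n IHn]; first by rewrite expr1 expr0 mul1r.
rewrite [in LHS]exprS lieM IHn -!mulrnAr mulrA -exprS [lie f * _]mulrC.
by rewrite -mulrDr -mulrS.
Qed.

Lemma ord_ge_lie d f : ord_ge d f -> ord_ge d (lie f).
Proof.
case: d => // d of_; apply: ord_geB; rewrite -addn1; apply: ord_geM.
- exact: ord_ge_deriv.
- rewrite -[U](subrK 'X_0); apply: ord_geD; last exact: ord_ge_var.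
  exact: ord_ge_le U1.
- exact: ord_ge_deriv.
- rewrite -[V](subrK 'X_1); apply: ord_geD; last exact: ord_ge_var.
  exact: ord_ge_le V1.
Qed.

Lemma euler0 f a b : (f^`M(0) * 'X_0)@_(mnm2 a b) = a%:R * f@_(mnm2 a b).
Proof.
case: a => [|a].
  rewrite mul0r; apply/eqP; rewrite mcoeff_eq0; apply/negP => /msuppM_le.
  rewrite msuppX => /allpairsP[[m1 m2] /= [_]]; rewrite inE => /eqP -> /(congr1 (fun m => fun_of_multinom m 0)).
  by rewrite mnmDE mnm1E addn1.
have -> : mnm2 a.+1 b = (U_(0%R) + mnm2 a b)%MM by rewrite mnm2U0 mnm2D.
by rewrite mcoeffMX mcoeff_deriv addmC mnm2_0 mulr_natl.
Qed.

Lemma euler1 f a b : (f^`M(1) * 'X_1)@_(mnm2 a b) = b%:R * f@_(mnm2 a b).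
Proof.
case: b => [|b].
  rewrite mul0r; apply/eqP; rewrite mcoeff_eq0; apply/negP => /msuppM_le.
  rewrite msuppX => /allpairsP[[m1 m2] /= [_]]; rewrite inE => /eqP -> /(congr1 (fun m => fun_of_multinom m 1)).
  by rewrite mnmDE mnm1E addn1.
have -> : mnm2 a b.+1 = (U_(1%R) + mnm2 a b)%MM by rewrite mnm2U1 mnm2D.
by rewrite mcoeffMX mcoeff_deriv addmC mnm2_1 mulr_natl.
Qed.

(** On the leading form of f the derivation acts diagonally: u ^ a * v ^ b is
multiplied by a - b. *)
Lemma lie_low d f a b : ord_ge d f -> (a + b <= d)%N ->
  (lie f)@_(mnm2 a b) = (a%:R - b%:R) * f@_(mnm2 a b).
Proof.
move=> of_ led.
have -> : lie f = f^`M(0) * 'X_0 - f^`M(1) * 'X_1 +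
    (f^`M(0) * (U - 'X_0) - f^`M(1) * (V - 'X_1)) by rewrite /lie; ring.
rewrite mcoeffD mcoeffB euler0 euler1 -mulrBl.
suff high : ord_ge d.+1 (f^`M(0) * (U - 'X_0) - f^`M(1) * (V - 'X_1)).
  by rewrite high ?addr0 // mdeg_mnm2.
have od j : ord_ge d.-1 f^`M(j).
  by case: d of_ {led} => [|d] of_; [move=> m|apply: ord_ge_deriv].
have led1 : (d.+1 <= d.-1 + 2)%N by lia.
by apply: ord_geB; apply: (ord_ge_le led1); apply: ord_geM.
Qed.

Lemma ord_ge_X01 : ord_ge 2 ('X_0 * 'X_1 : {mpoly K[2]}).
Proof. exact: ord_geM (ord_ge_var _ _) (ord_ge_var _ _). Qed.

Lemma ord_ge_powB f e : ord_ge 3 (f - 'X_0 * 'X_1) ->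
  ord_ge (2 * e).+1%N (f ^+ e - ('X_0 * 'X_1) ^+ e).
Proof.
move=> f3; have f2 : ord_ge 2 f.
  by rewrite -(subrK ('X_0 * 'X_1) f); apply: ord_geD ord_ge_X01; apply: (ord_ge_le _ f3).
elim: e => [|e IHe]; first by rewrite !expr0 subrr; apply: ord_ge0.
have -> : f ^+ e.+1 - ('X_0 * 'X_1) ^+ e.+1 =
   f * (f ^+ e - ('X_0 * 'X_1) ^+ e) + (f - 'X_0 * 'X_1) * ('X_0 * 'X_1) ^+ e.
  by rewrite !exprS; ring.
apply: ord_geD.
  by apply: (ord_ge_le _ (ord_geM f2 IHe)); lia.
by apply: (ord_ge_le _ (ord_geM f3 (ord_geX (n := e) ord_ge_X01))); lia.
Qed.

(** Two truncated first integrals of a perturbed linear center have the same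
first obstruction: powers of one can be subtracted from the other until the
difference is of order 2N, where the derivation has no (N, N) component. *)
Lemma obstruction_unique f h N : (2 <= N)%N ->
  ord_ge 3 (f - 'X_0 * 'X_1) -> ord_ge 3 (h - 'X_0 * 'X_1) ->
  ord_ge (2 * N)%N (lie f) -> ord_ge (2 * N)%N (lie h) ->
  (lie h)@_(mnm2 N N) = (lie f)@_(mnm2 N N).
Proof.
move=> N2 f3 h3 ef eh.
suff: forall d, (d + 3 <= 2 * N)%N -> exists2 r,
    ord_ge (2 * N).+1%N (lie r) & ord_ge (d + 3)%N (h - f - r).
  move=> /(_ (2 * N - 3)%N) []; first by lia.
  rewrite subnK; last by lia.
  move=> r er or; have : (lie (h - f - r))@_(mnm2 N N) = 0.
    by rewrite (lie_low or) ?subrr ?mul0r //; lia.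
  rewrite !lieB 2!mcoeffB (er (mnm2 N N)) ?mdeg_mnm2 ?subr0; last by lia.
  by move/eqP; rewrite subr_eq0 => /eqP.
elim=> [|d IHd] led.
  exists 0; first by rewrite /lie !mderiv0 !mul0r subrr; apply: ord_ge0.
  rewrite subr0 (_ : h - f = h - 'X_0 * 'X_1 - (f - 'X_0 * 'X_1)); last by ring.
  exact: ord_geB.
have [|r er or] := IHd; first by lia.
set g := h - f - r in or; pose D := (d + 3)%N.
have eg : ord_ge (2 * N)%N (lie g).
  by rewrite !lieB; apply: ord_geB; [apply: ord_geB|apply: (ord_ge_le _ er)].
have g0 a b : (a + b = D)%N -> a != b -> g@_(mnm2 a b) = 0.
  move=> abD neab; have := lie_low or (eq_leq abD).
  rewrite eg ?mdeg_mnm2; last by rewrite abD /D; lia.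
  by move/esym/eqP; rewrite mulf_eq0 subr_eq0 eqr_nat (negbTE neab) => /eqP.
have [oddD|evenD] := boolP (odd D); last first.
  pose c := g@_(mnm2 D./2 D./2).
  have DE : D = (2 * D./2)%N by rewrite mul2n; rewrite -[LHS]odd_double_half (negbTE evenD).
  (* f ^+ (D / 2) starts with (u v) ^+ (D / 2), and its derivative is a multiple
  of f ^+ (D / 2 - 1) * lie f, of order above 2N. *)
  exists (r + c *: f ^+ D./2).
    rewrite lieD lieZ; apply: ord_geD => //; apply: ord_geZ.
    have := DE; case: D./2 => [|e De]; first by rewrite /D; lia.
    rewrite lieX -mulr_natl -mpolyC_nat mul_mpolyC; apply: ord_geZ.
    have f2 : ord_ge 2 f.
      by rewrite -(subrK ('X_0 * 'X_1) f); apply: ord_geD ord_ge_X01; apply: (ord_ge_le _ f3).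
    by apply: (ord_ge_le _ (ord_geM (ord_geX (n := e) f2) ef)); move: De; rewrite /D; lia.
  move=> m ltm; rewrite opprD addrA -/g -(mnm2K m) mcoeffB mcoeffZ.
  have [ltD|leD] := ltnP (mdeg m) D.
    rewrite mnm2K or // (ord_geX (n := D./2) (_ : ord_ge 2 f)) ?mulr0 ?subrr -?DE //.
    by rewrite -(subrK ('X_0 * 'X_1) f); apply: ord_geD ord_ge_X01; apply: (ord_ge_le _ f3).
  have mD : (m 0%R + m 1%R = D)%N by rewrite -mdeg2; move: ltm leD; rewrite /D; lia.
  have -> : (f ^+ D./2)@_(mnm2 (m 0) (m 1)) = (('X_0 * 'X_1) ^+ D./2)@_(mnm2 (m 0) (m 1)).
    apply/eqP; rewrite -subr_eq0 -mcoeffB (ord_ge_powB (e := D./2) f3) //.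
    by rewrite mdeg_mnm2 mD -DE.
  rewrite exprMn -mpolyX2 mcoeffX eq_mnm2.
  have [eqm|neqm] := eqVneq (m 0%R) (m 1%R).
    have e0 : m 1%R = D./2 by move: mD; rewrite eqm addnn => <-; rewrite doubleK.
    by rewrite eqm e0 eqxx mulr1 subrr.
  rewrite g0 //; case: eqP => [e0|]; case: eqP => [e1|]; rewrite ?mulr0 ?subr0 //.
  by case/eqP: neqm; rewrite -e0 -e1.
exists r => // m ltm; rewrite -/g -(mnm2K m).
have [ltD|leD] := ltnP (mdeg m) D; first by rewrite mnm2K or.
have mD : (m 0%R + m 1%R = D)%N by rewrite -mdeg2; move: ltm leD; rewrite /D; lia.
by apply: g0 => //; apply: contraTneq oddD => e; rewrite -mD e addnn odd_double.
Qed.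

End LinearCenter.

(** * Frommer series and the first obstruction *)

Section FrommerSeries.
Variables (K : numClosedFieldType) (w : cubic_form K).
Implicit Types (f g h : {mpoly K[2]}).
Local Notation i := ('i : K).
Local Notation lie_uv := (lie (ucoef w) (vcoef w)).
Local Notation lie_xy := (lie (ycoef w) (xcoef w)).

(** Both sides are derivations with respect to theta, so they are compared on
x and y. *)
Lemma theta_lie f : lie_uv (theta f) = i *: theta (lie_xy f).
Proof.
have Xd (j k : 'I_2) : ('X_j : {mpoly K[2]})^`M(k) = (j == k)%:R.
  rewrite mderivX mnm1E; case: eqP => [->|_]; last by rewrite scale0r.
  rewrite scale1r (_ : (U_(k) - U_(k))%MM = 0%MM) ?mpolyX0 //.
  by apply/mnmP => l; rewrite mnmBE mnm0E subnn.
elim/mpoly_ring_ind: f => [c|j|p q Hp Hq|p q Hp Hq].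
- by rewrite /theta comp_mpolyC /lie !mderivC !mul0r subrr comp_mpoly0 scaler0.
- move: j; apply: ord2_ind.
    rewrite thetaX0 lieZ lieD /lie !Xd /= !mul1r !mul0r subr0 sub0r subr0 ycoefE scalerA.
    by rewrite mulrA mulrN ii opprK mul1r.
  rewrite thetaX1 lieZ lieB /lie !Xd /= !mul1r !mul0r subr0 !sub0r opprK thetaN xcoefE.
  by rewrite scalerN scalerA -scaleNr mulNr.
- by rewrite thetaD !lieD thetaD Hp Hq scalerDr.
- rewrite thetaM !lieM thetaD !thetaM Hp Hq scalerDr.
  by rewrite -!scalerAl -!scalerAr.
Qed.

Hypothesis pw : poincare K w.

Lemma ucoef_order : ord_ge 2 (ucoef w - 'X_0).
Proof.
have [[a00 _] [a10 _] [a01 _]] := (poincareP w).1 pw.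
move=> m; rewrite -(mnm2K m) mdeg_mnm2 mcoeffB mcoeffX mnm2U0 eq_mnm2 -/(acoef _ _ _).
by case: (m 0) (m 1) => [|[|//]] [|[|//]] // _; rewrite ?a00 ?a10 ?a01 subrr.
Qed.

Lemma vcoef_order : ord_ge 2 (vcoef w - 'X_1).
Proof.
have [[_ b00] [_ b01] [_ b10]] := (poincareP w).1 pw.
move=> m; rewrite -(mnm2K m) mdeg_mnm2 mcoeffB mcoeffX mnm2U1 eq_mnm2 -/(bcoef _ _ _).
by case: (m 0) (m 1) => [|[|//]] [|[|//]] // _; rewrite ?b00 ?b10 ?b01 subrr.
Qed.

Let ord_uv := ord_ge_lie ucoef_order vcoef_order.

Lemma ord_ge_theta d f : ord_ge d f -> ord_ge d (theta f).
Proof. by apply: ord_ge_comp => j; apply: uv_tuple_homog. Qed.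

Lemma ord_ge_theta_inv d f : ord_ge d f -> ord_ge d (theta_inv f).
Proof. by apply: ord_ge_comp => j; apply: xy_tuple_homog. Qed.

Lemma theta_inv_lie f : theta_inv (lie_uv f) = i *: lie_xy (theta_inv f).
Proof. by rewrite -{1}(theta_invK f) theta_lie -thetaZ thetaK. Qed.

Lemma ord_ge_lie_xy d f : ord_ge d f -> ord_ge d (lie_xy f).
Proof.
move=> of_; have -> : lie_xy f = i^-1 *: theta_inv (lie_uv (theta f)).
  by rewrite theta_inv_lie thetaK scalerA mulVf ?scale1r ?i_neq0.
by apply/ord_geZ/ord_ge_theta_inv/ord_uv/ord_ge_theta.
Qed.

Lemma theta_circle : theta ('X_0 ^+ 2 + 'X_1 ^+ 2) = 'X_0 * 'X_1 :> {mpoly K[2]}.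
Proof.
rewrite thetaD !thetaXn thetaX0 thetaX1 !exprZn.
have -> : (- i / 2) ^+ 2 = - (2^-1 ^+ 2).
  by transitivity ((i * i) * 2^-1 ^+ 2); [field|rewrite ii mulN1r].
rewrite scaleNr -scalerBr (_ : _ - _ = 4 *: ('X_0 * 'X_1)); last first.
  by rewrite scaler_nat; ring.
by rewrite scalerA (_ : 2^-1 ^+ 2 * 4 = 1) ?scale1r //; field.
Qed.

Definition power_sum n : {mpoly K[2]} := 'X_0 ^+ n + 'X_1 ^+ n.

Lemma power_sum_coef n a b : (0 < n)%N ->
  (power_sum n)@_(mnm2 a b) =
    ((a == n) && (b == 0%N))%:R + ((a == 0%N) && (b == n))%:R.
Proof.
move=> n0.
have -> : power_sum n = 'X_[mnm2 n 0] + 'X_[mnm2 0 n].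
  by rewrite !mpolyX2 !expr0 mulr1 mul1r.
by rewrite mcoeffD !mcoeffX !eq_mnm2 !(eq_sym n) !(eq_sym 0%N).
Qed.

Lemma power_sum_coef_eq0 n a b : (0 < n)%N -> (a + b)%N != n -> (power_sum n)@_(mnm2 a b) = 0.
Proof.
move=> n0 ne; rewrite power_sum_coef //.
have -> : (a == n) && (b == 0)%N = false.
  by apply: contraNF ne => /andP[/eqP -> /eqP ->]; rewrite addn0.
have -> : (a == 0)%N && (b == n) = false.
  by apply: contraNF ne => /andP[/eqP -> /eqP ->].
exact: addr0.
Qed.

Lemma ord_ge_power_sum n : ord_ge n (power_sum n).
Proof.
by apply: ord_geD; rewrite -{1}[n]mul1n; apply/ord_geX/ord_ge_var.
Qed.

Lemma theta_power_sum N : (theta (power_sum (2 * N)))@_(mnm2 N N) =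
  2 * 'C(2 * N, N)%:R / 4 ^+ N.
Proof.
have binom (c : K) : (('X_0 + c *: 'X_1) ^+ (2 * N) : {mpoly K[2]})@_(mnm2 N N) =
    'C(2 * N, N)%:R * c ^+ N.
  rewrite exprDn raddf_sum /=.
  have ltN : (N < (2 * N).+1)%N by lia.
  rewrite (bigD1 (Ordinal ltN)) //= big1 ?addr0 => [|k nek].
    rewrite (_ : 2 * N - N = N)%N; last by lia.
    by rewrite exprZn -scalerAr -mpolyX2 mcoeffMn mcoeffZ mcoeffX eqxx mulr1 mulr_natl.
  rewrite exprZn -scalerAr -mpolyX2 mcoeffMn mcoeffZ mcoeffX eq_mnm2.
  rewrite (_ : (k == N :> nat) = false) ?andbF ?mulr0 ?mul0rn //.
  by apply: contraNF nek => /eqP e; apply/eqP/val_inj.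
rewrite /power_sum thetaD !thetaXn thetaX0 thetaX1 mcoeffD !exprZn !mcoeffZ.
have := binom 1; rewrite scale1r => ->; have := binom (-1); rewrite scaleN1r => ->.
rewrite expr1n mulr1 !exprM.
have -> : (- i / 2) ^+ 2 = - 4^-1.
  by transitivity ((i * i) * 4^-1); [field|rewrite ii mulN1r].
have -> : 2^-1 ^+ 2 = 4^-1 :> K by field.
have s : (-1) ^+ N * (-1) ^+ N = 1 :> K by rewrite -expr2 sqrr_sign.
rewrite exprNn exprVn; move: (4 ^+ N)^-1 'C(2 * N, N)%:R => q c.
by transitivity (q * c + q * c * ((-1) ^+ N * (-1) ^+ N)); [ring|rewrite s; ring].
Qed.

(** The image of the derivation has no diagonal terms in u and v, so x ^ 2N +
y ^ 2N spans a complement of it. *)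
Lemma theta_power_sum_neq0 N : (theta (power_sum (2 * N)))@_(mnm2 N N) != 0.
Proof.
rewrite theta_power_sum !mulf_neq0 ?invr_eq0 ?expf_neq0 ?pnatr_eq0 //.
by rewrite -lt0n bin_gt0; lia.
Qed.

Lemma focal_seriesE (s : nat -> K) p q : focal_series s p q =
  (if (3 < p + q)%N && ~~ odd (p + q) then s (p + q)./2.-1 else 0) *
  (power_sum (p + q))@_(mnm2 p q).
Proof.
rewrite /focal_series; pose n := (p + q)%N; rewrite -/n.
have F0 j : (2 * j + 2 != n)%N -> s j * (((p == 2 * j + 2)%N && (q == 0)%N)%:R +
    ((p == 0)%N && (q == 2 * j + 2)%N)%:R) = 0.
  move=> ne; case: andP => [[/eqP ep /eqP eq]|_].
    by case/eqP: ne; rewrite /n ep eq addn0.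
  case: andP => [[/eqP ep /eqP eq]|_]; last by rewrite addr0 mulr0.
  by case/eqP: ne; rewrite /n ep eq.
case: ifP => [/andP[n3 /negbTE evn]|nn]; last first.
  rewrite mul0r big_nat_cond big1 // => j; rewrite andbT => /andP[j1 ltj].
  apply: F0; apply: contraFN nn => /eqP <-; lia.
have ne : n = (2 * n./2)%N by rewrite mul2n -[LHS]odd_double_half evn.
have jin : n./2.-1 \in index_iota 1 n by rewrite mem_index_iota; lia.
rewrite (bigD1_seq _ jin (iota_uniq _ _)) /= big1 ?addr0 => [|j nej]; last first.
  by apply: F0; apply: contraNneq nej => ej; apply/eqP; lia.
have -> : (2 * n./2.-1 + 2 = n)%N by lia.
by rewrite power_sum_coef //; lia.
Qed.

Lemma lie_trunc (F : series2) M a b : (a + b < M)%N ->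
  (lie_xy (trunc M F))@_(mnm2 a b) =
  series2_mul (series2_dx F) (dehomog (dy_coef w)) a b
      - series2_mul (series2_dy F) (dehomog (dx_coef w)) a b.
Proof.
move=> ltM; rewrite /lie mcoeffB !mcoeffM2 /series2_mul.
congr (_ - _); apply: eq_bigr => k _; apply: eq_bigr => l _; congr (_ * _).
  rewrite mcoeff_deriv mnm2U0 mnm2D trunc_coef addn0 addn1 mnm2_0 /series2_dx.
  rewrite ifT //; have := leq_ord k; have := leq_ord l; lia.
rewrite mcoeff_deriv mnm2U1 mnm2D trunc_coef addn0 addn1 mnm2_1 /series2_dy.
rewrite ifT //; have := leq_ord k; have := leq_ord l; lia.
Qed.

Lemma circle_coef a b : (power_sum 2)@_(mnm2 a b) =
  if ((a == 2) && (b == 0))%N || ((a == 0) && (b == 2))%N then 1 else 0.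
Proof.
by rewrite power_sum_coef //; case: a b => [|[|[|a]]] [|[|[|b]]] //=; rewrite ?addr0 ?add0r.
Qed.

Lemma trunc_normalized (F : series2) M : (2 <= M)%N -> normalized F ->
  ord_ge 3 (trunc M F - power_sum 2).
Proof.
move=> M2 [[F00 F10 F01] [F20 F11 F02] _] m.
rewrite -(mnm2K m) mdeg_mnm2 mcoeffB circle_coef trunc_coef.
case: (m 0) (m 1) => [|[|[|//]]] [|[|[|//]]] // _ /=;
  rewrite ?M2 ?(ltnW M2) ?(leq_trans _ M2) //= ?F00 ?F10 ?F01 ?F20 ?F11 ?F02 subrr //.
Qed.

(** At the first index where either of them is nonzero, the focal value and the
diagonal obstruction computed in the coordinates u, v agree up to a nonzero
factor. *)
Lemma focal_obstruction (F : series2) (s : nat -> K) N h : (2 <= N)%N ->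
  is_frommer w F s -> (forall j, (1 <= j)%N -> (j.+1 < N)%N -> s j = 0) ->
  ord_ge 3 (h - 'X_0 * 'X_1) -> ord_ge (2 * N)%N (lie_uv h) ->
  (lie_uv h)@_(mnm2 N N) = i * s N.-1 * (theta (power_sum (2 * N)))@_(mnm2 N N).
Proof.
move=> N2 [nF eF] s0 h3 hN.
pose M := (2 * N).+1; pose f := trunc M F.
have M2 : (2 <= M)%N by rewrite /M; lia.
have f3 : ord_ge 3 (theta f - 'X_0 * 'X_1).
  by rewrite -theta_circle -thetaB; apply/ord_ge_theta/trunc_normalized.
have fE : ord_ge M (lie_xy f - s N.-1 *: power_sum (2 * N)).
  move=> m; rewrite -(mnm2K m) mdeg_mnm2; move: (m 0) (m 1) => a b ltM.
  rewrite mcoeffB mcoeffZ lie_trunc // eF focal_seriesE.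
  have [e|ne] := eqVneq (a + b)%N (2 * N)%N.
    rewrite e (_ : (2 * N)./2 = N) ?subrr; last by lia.
    by rewrite (_ : _ && _ = true) ?subrr //; lia.
  rewrite (@ord_ge_power_sum _ (mnm2 a b)) ?mulr0 ?subr0; last by rewrite mdeg_mnm2; lia.
  case: ifP => [/andP[ab3 evab]|_]; last by rewrite mul0r.
  by rewrite s0 ?mul0r //; lia.
have f2N : ord_ge (2 * N)%N (lie_uv (theta f)).
  rewrite theta_lie; apply/ord_geZ/ord_ge_theta.
  rewrite -[lie_xy f](subrK (s N.-1 *: power_sum (2 * N))); apply: ord_geD.
    by apply: ord_ge_le fE.
  by apply: ord_geZ; apply: ord_ge_power_sum.
rewrite (obstruction_unique ucoef_order vcoef_order N2 f3 h3 f2N hN) theta_lie mcoeffZ.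
have /ord_ge_theta/(_ (mnm2 N N)) := fE; rewrite mdeg_mnm2 thetaB thetaZ mcoeffB mcoeffZ.
move=> e; rewrite -mulrA; congr (_ * _); apply/eqP; rewrite -subr_eq0 e // /M; lia.
Qed.

End FrommerSeries.

(** * The recursion for the obstructions *)

Section Obstructions.
Variable (K : numFieldType).
Implicit Types (al be c : nat -> nat -> K).

Definition quad_cubic : seq (nat * nat) :=
  [:: (2, 0); (1, 1); (0, 2); (3, 0); (2, 1); (1, 2); (0, 3)]%N.

Lemma mem_quad_cubic j k : ((j, k) \in quad_cubic) = (2 <= j + k <= 3)%N.
Proof. by case: j k => [|[|[|[|j]]]] [|[|[|[|k]]]] //; rewrite !addnS !addSn. Qed.

(** The (a, b) coefficient of al f_u - be f_v, for f with coefficients c. *)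
Definition defect al be c a b : K :=
  \sum_(m <- quad_cubic | (m.1 <= a)%N && (m.2 <= b)%N)
    (al m.1 m.2 * ((a - m.1).+1%:R * c (a - m.1).+1 (b - m.2)%N)
     - be m.1 m.2 * ((b - m.2).+1%:R * c (a - m.1)%N (b - m.2).+1)).

(** Stage n fixes the coefficients of degree at most n; they are not changed
later. *)
Fixpoint formal_integral_stage al be n : nat -> nat -> K :=
  match n with
  | 0 => fun a b => ((a == 1) && (b == 1))%N%:R
  | n'.+1 => fun a b =>
      let c := formal_integral_stage al be n' in
      if (2 < n'.+1)%N && (a + b == n'.+1)%N then
        if a == b then 0 else defect al be c a b / (b%:R - a%:R)
      else c a b
  end.

(** The formal series u v + ... without further diagonal terms whose derivative
along u' = u + al, v' = - (v + be) is a series in u v. *)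
Definition formal_integral al be a b := formal_integral_stage al be (a + b) a b.

(** The coefficient of (u v) ^ n in the derivative of the formal integral. *)
Definition obstruction al be n := defect al be (formal_integral al be) n n.

Lemma formal_integral_stageE al be n a b : (a + b <= n)%N ->
  formal_integral_stage al be n a b = formal_integral al be a b.
Proof.
rewrite /formal_integral; elim: n => [|n IHn]; first by rewrite leqn0 => /eqP ->.
rewrite leq_eqVlt => /predU1P[->//|ltn].
by rewrite [LHS]/= (ltn_eqF ltn) andbF IHn.
Qed.

Lemma eq_defect al be c c' a b :
  (forall a' b', (a' + b' < a + b)%N -> c a' b' = c' a' b') ->
  defect al be c a b = defect al be c' a b.
Proof.
move=> cc'; rewrite /defect big_seq_cond [RHS]big_seq_cond; apply: eq_bigr => -[j k] /=.
rewrite mem_quad_cubic => /andP[/andP[jk2 _] /andP[lea leb]].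
by congr (_ * (_ * _) - _ * (_ * _)); apply: cc'; lia.
Qed.

Lemma integral_low al be a b : (a + b <= 2)%N ->
  formal_integral al be a b = ((a == 1) && (b == 1))%N%:R.
Proof. by move=> ab; rewrite -(@formal_integral_stageE _ _ 2) //= . Qed.

Lemma integral_diag al be a : (2 <= a)%N -> formal_integral al be a a = 0.
Proof.
move=> a2; rewrite /formal_integral; have : (2 < a + a)%N by lia.
by case e: (a + a)%N => [//|n] lt2; rewrite /= lt2 e !eqxx.
Qed.

Lemma defect_low al be a b : (a + b <= 2)%N -> defect al be (formal_integral al be) a b = 0.
Proof.
move=> ab; rewrite /defect big_seq_cond big1 // => -[j k] /=.
rewrite mem_quad_cubic => /andP[/andP[jk2 _] /andP[lea leb]].
have c0 a' b' : (a' + b' <= 1)%N -> formal_integral al be a' b' = 0.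
  move=> ab1; rewrite integral_low; last by lia.
  by case: a' b' ab1 => [|[|a']] [|[|b']].
by rewrite !c0 ?mulr0 ?subrr //; lia.
Qed.

Lemma integral_eq al be a b : a != b ->
  (b%:R - a%:R) * formal_integral al be a b = defect al be (formal_integral al be) a b.
Proof.
move=> neab; have [le2|gt2] := leqP (a + b) 2.
  rewrite defect_low // integral_low //; case: andP => [[/eqP ea /eqP eb]|_]; rewrite ?mulr0 //.
  by rewrite ea eb eqxx in neab.
have ba : b%:R - a%:R != 0 :> K by rewrite subr_eq0 eqr_nat eq_sym.
rewrite {1}/formal_integral; case e: (a + b)%N => [|n]; first by rewrite e in gt2.
rewrite /= -e gt2 eqxx (negbTE neab) mulrC divfK //; apply: eq_defect => a' b' ltab.
by apply: formal_integral_stageE; move: ltab; rewrite e.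
Qed.

(** A rotation and a swap of u and v exchange al and be, so the obstructions
change sign under this symmetry and vanish for symmetric fields. *)
Lemma obstruction_symmetric al be s : s != 0 ->
  (forall j k, (j, k) \in quad_cubic -> be k j * s ^+ k.+1 = s ^+ j * al j k) ->
  forall n, obstruction al be n = 0.
Proof.
move=> s0 albe; pose c := formal_integral al be.
have defect_sym a b : (forall a' b', (a' + b' < a + b)%N -> c a' b' * s ^+ a' = c b' a' * s ^+ b') ->
    defect al be c a b * s ^+ a = - (defect al be c b a * s ^+ b).
  move=> csym.
  have swap (G : nat -> nat -> K) a' b' :
      \sum_(m <- quad_cubic | (m.1 <= a')%N && (m.2 <= b')%N) G m.1 m.2 =
      \sum_(m <- quad_cubic | (m.1 <= b')%N && (m.2 <= a')%N) G m.2 m.1.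
    pose sw (m : nat * nat) := (m.2, m.1).
    have e : perm_eq quad_cubic (map sw quad_cubic) by [].
    rewrite (perm_big _ e) big_map; apply: eq_bigl => m.
    by rewrite andbC.
  rewrite /defect !sumrB mulrBl mulrBl opprB.
  have term a' b' : (forall x y, (x + y < a' + b')%N -> c x y * s ^+ x = c y x * s ^+ y) ->
    (\sum_(m <- quad_cubic | (m.1 <= a')%N && (m.2 <= b')%N)
        al m.1 m.2 * ((a' - m.1).+1%:R * c (a' - m.1).+1 (b' - m.2)%N)) * s ^+ a' =
    (\sum_(m <- quad_cubic | (m.1 <= b')%N && (m.2 <= a')%N)
        be m.1 m.2 * ((a' - m.2).+1%:R * c (b' - m.1)%N (a' - m.2).+1)) * s ^+ b'.
    move=> cs; rewrite [in RHS](swap (fun j k =>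
      be j k * ((a' - k).+1%:R * c (b' - j)%N (a' - k).+1))) !mulr_suml.
    rewrite big_seq_cond [RHS]big_seq_cond; apply: eq_bigr => -[j k] /andP[jk /andP[/= lea leb]].
    have bs := albe _ _ jk; rewrite mem_quad_cubic in jk.
    have cjk := cs (a' - j).+1 (b' - k)%N.
    have {}cjk : c (a' - j).+1 (b' - k)%N * s ^+ (a' - j).+1 =
      c (b' - k)%N (a' - j).+1 * s ^+ (b' - k) by apply: cjk; lia.
    rewrite -{3}(subnK leb) exprD.
    transitivity ((a' - j).+1%:R * (be k j * s ^+ k) * (c (b' - k)%N (a' - j).+1 * s ^+ (b' - k)));
      last by ring.
    rewrite -cjk exprS.
    transitivity ((a' - j).+1%:R * (be k j * s ^+ k.+1) * s ^+ (a' - j) * c (a' - j).+1 (b' - k)%N);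
      last by rewrite exprS; ring.
    rewrite bs -{3}(subnKC lea) exprD; ring.
  rewrite (term a b csym); congr (_ - _); apply/esym; apply: term => x y.
  by rewrite (addnC b); exact: csym.
have csym n : forall a b, (a + b < n)%N -> c a b * s ^+ a = c b a * s ^+ b.
  elim: n => // n IHn a b; rewrite ltnS => len.
  have [->//|neab] := eqVneq a b.
  have ba : b%:R - a%:R != 0 :> K by rewrite subr_eq0 eqr_nat eq_sym.
  apply: (mulfI ba); rewrite mulrA (integral_eq _ _ neab).
  rewrite defect_sym => [|a' b' ltab]; last by apply: IHn; apply: leq_trans len.
  by rewrite -(integral_eq _ _ (_ : b != a)) 1?eq_sym // -!mulNr opprB mulrA.
move=> n; apply/eqP; have := defect_sym n n (fun a b _ => csym (a + b).+1 a b (ltnSn _)).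
move/eqP; rewrite -addr_eq0 -mulr2n mulrn_eq0 /= mulf_eq0 expf_eq0 (negbTE s0) andbF orbF.
by [].
Qed.

Section IntegralPolynomial.
Variables (U V : {mpoly K[2]}) (al be : nat -> nat -> K).
Hypotheses (UE : forall j k, (U - 'X_0)@_(mnm2 j k) =
              if (j, k) \in quad_cubic then al j k else 0)
           (VE : forall j k, (V - 'X_1)@_(mnm2 j k) =
              if (j, k) \in quad_cubic then be j k else 0).

Lemma mcoeffM_quad_cubic (f q : {mpoly K[2]}) (ga : nat -> nat -> K) a b :
  (forall j k, q@_(mnm2 j k) = if (j, k) \in quad_cubic then ga j k else 0) ->
  (f * q)@_(mnm2 a b) = \sum_(m <- quad_cubic | (m.1 <= a)%N && (m.2 <= b)%N)
     ga m.1 m.2 * f@_(mnm2 (a - m.1) (b - m.2)).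
Proof.
move=> qE; have -> : q = \sum_(m <- quad_cubic) ga m.1 m.2 *: 'X_[mnm2 m.1 m.2].
  apply/mpoly2P => j k; rewrite qE raddf_sum /=; have [jk|njk] := boolP ((j, k) \in _).
    rewrite (bigD1_seq (j, k)) //= mcoeffZ mcoeffX eqxx mulr1 big1 ?addr0 // => -[j' k'] ne.
    by rewrite mcoeffZ mcoeffX eq_mnm2 -xpair_eqE (negbTE ne) mulr0.
  rewrite big_seq big1 // => -[j' k'] jk'; rewrite mcoeffZ mcoeffX eq_mnm2 -xpair_eqE.
  by rewrite (_ : (_ == _) = false) ?mulr0 //; apply: contraNF njk => /eqP <-.
rewrite mulr_sumr raddf_sum [RHS]big_mkcond /=; apply: eq_bigr => m _.
by rewrite -scalerAr mcoeffZ mcoeffMX2; case: ifP; rewrite ?mulr0.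
Qed.

Lemma lie_trunc_formal_integral M a b : (a + b <= M)%N ->
  (lie U V (trunc M (formal_integral al be)))@_(mnm2 a b) =
  if a == b then obstruction al be a else 0.
Proof.
move=> leM; set f := trunc M _.
have -> : lie U V f = f^`M(0) * 'X_0 - f^`M(1) * 'X_1 +
    (f^`M(0) * (U - 'X_0) - f^`M(1) * (V - 'X_1)) by rewrite /lie; ring.
rewrite mcoeffD !mcoeffB euler0 euler1 (mcoeffM_quad_cubic _ _ _ UE).
rewrite (mcoeffM_quad_cubic _ _ _ VE) -sumrB -mulrBl.
have fE j k : (j + k <= M)%N -> f@_(mnm2 j k) = formal_integral al be j k.
  by move=> le; rewrite trunc_coef le.
rewrite fE // (_ : \sum_(_ <- _ | _) _ = defect al be (formal_integral al be) a b); last first.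
  rewrite /defect big_seq_cond [RHS]big_seq_cond; apply: eq_bigr => -[j k] /=.
  rewrite mem_quad_cubic => /andP[/andP[jk2 _] /andP[lea leb]].
  rewrite !mcoeff_deriv mnm2U0 mnm2U1 !mnm2D !addn0 !addn1 mnm2_0 mnm2_1.
  by rewrite !fE ?mulr_natl //; lia.
have [->|neab] := eqVneq a b; first by rewrite subrr mul0r add0r.
by rewrite -integral_eq // -mulrDl addrA subrK subrr mul0r.
Qed.

Lemma trunc_formal_integral_order M : (2 <= M)%N ->
  ord_ge 3 (trunc M (formal_integral al be) - 'X_0 * 'X_1).
Proof.
move=> M2 m; rewrite -(mnm2K m) mdeg_mnm2 => lt3.
rewrite mcoeffB trunc_coef (_ : 'X_0 * 'X_1 = 'X_[mnm2 1 1]); last first.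
  by rewrite mpolyX2 !expr1.
rewrite mcoeffX eq_mnm2 integral_low; last by lia.
by rewrite ifT ?(eq_sym 1%N) ?subrr //; lia.
Qed.

End IntegralPolynomial.

End Obstructions.

(** * Focal values and obstructions have the same zeros *)

Section CenterVariety.
Variables (K : numClosedFieldType) (w : cubic_form K).
Hypothesis pw : poincare K w.
Implicit Types (f g h : {mpoly K[2]}).
Local Notation i := ('i : K).
Local Notation lie_uv := (lie (ucoef w) (vcoef w)).
Local Notation lie_xy := (lie (ycoef w) (xcoef w)).
Local Notation circle := (power_sum K 2).

Lemma ord_ge_circle N : ord_ge (2 * N)%N (circle ^+ N).
Proof. by apply: ord_geX; apply: ord_ge_power_sum. Qed.

Lemma circle_pow_coef N : (circle ^+ N)@_(mnm2 0 (2 * N)) = 1.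
Proof.
elim: N => [|N IHN]; first by rewrite expr0 muln0 -mpolyC1 mcoeffC mnm2_00 eqxx mulr1.
have -> : circle ^+ N.+1 = circle ^+ N * 'X_[mnm2 0 2] + circle ^+ N * 'X_[mnm2 2 0].
  by rewrite exprSr /power_sum mulrDr addrC !mpolyX2 !expr0 mulr1 mul1r.
have -> : mnm2 0 (2 * N.+1) = (mnm2 0 2 + mnm2 0 (2 * N))%MM.
  by rewrite mnm2D; congr mnm2; lia.
by rewrite mcoeffD mcoeffMX IHN mnm2D mcoeffMX2 addr0.
Qed.

Lemma lie_circle_pow N : ord_ge (2 * N).+1%N (lie_xy (circle ^+ N)).
Proof.
have -> : lie_xy (circle ^+ N) = i^-1 *: theta_inv (lie_uv (theta (circle ^+ N))).
  by rewrite theta_inv_lie thetaK scalerA mulVf ?scale1r ?i_neq0.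
apply/ord_geZ/ord_ge_theta_inv => m; rewrite -(mnm2K m) mdeg_mnm2 ltnS => le2N.
rewrite (lie_low (ucoef_order pw) (vcoef_order pw) (ord_ge_theta (@ord_ge_circle N)) le2N).
rewrite thetaXn theta_circle exprMn -mpolyX2 mcoeffX eq_mnm2.
by case: eqP => [<-|]; case: eqP => [<-|]; rewrite ?mulr0 // subrr mul0r.
Qed.

(** Extends a truncated normal form by one degree: off the diagonal the leading
part of the derivation is invertible, the diagonal defect is absorbed by sigma,
and the freedom of adding a power of the circle fixes the normalization. *)
Lemma frommer_step n f g : (3 <= n)%N -> ord_ge n (lie_xy f - g) ->
  exists hs : {mpoly K[2]} * K, [/\ ord_ge n hs.1, odd n -> hs.2 = 0,
    ord_ge n.+1 (lie_xy (f + hs.1) - (g + hs.2 *: power_sum K n)) &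
    ~~ odd n -> (f + hs.1)@_(mnm2 0 n) = 0].
Proof.
move=> n3 fg; pose N := n./2.
have nE : ~~ odd n -> n = (2 * N)%N.
  by move=> /negbTE ev; rewrite mul2n -[LHS]odd_double_half ev.
pose r := theta (lie_xy f - g).
pose sigma := if odd n then 0 else r@_(mnm2 N N) / (theta (power_sum K (2 * N)))@_(mnm2 N N).
pose r' := r - sigma *: theta (power_sum K n).
have or' : ord_ge n r'.
  apply: ord_geB; first exact: ord_ge_theta.
  by apply/ord_geZ/ord_ge_theta/ord_ge_power_sum.
have diag a : (a + a = n)%N -> r'@_(mnm2 a a) = 0.
  move=> aan; have ev : ~~ odd n by rewrite -aan addnn odd_double.
  have -> : a = N by rewrite /N -aan addnn doubleK.
  rewrite mcoeffB mcoeffZ /sigma (negbTE ev) {1}(nE ev) divfK ?subrr //.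
  exact: theta_power_sum_neq0.
pose h' := trunc n (fun a b => if (a + b == n)%N then - (i * r'@_(mnm2 a b)) / (a%:R - b%:R) else 0).
have oh' : ord_ge n h'.
  move=> m; rewrite -(mnm2K m) mdeg_mnm2 trunc_coef => ltn.
  by rewrite (ltn_eqF ltn) if_same.
have lieh' : ord_ge n.+1 (lie_uv h' + i *: r').
  move=> m; rewrite -(mnm2K m) mdeg_mnm2 ltnS; move: (m 0) (m 1) => a b len.
  rewrite mcoeffD mcoeffZ (lie_low (ucoef_order pw) (vcoef_order pw) oh' len).
  rewrite trunc_coef len; have [abn|neab] := eqVneq (a + b)%N n; last first.
    rewrite mulr0 add0r or' ?mulr0 // mdeg_mnm2 ltn_neqAle neab //.
  have [eab|neab] := eqVneq a b.
    by rewrite -eab in abn *; rewrite subrr mul0r diag ?mulr0 ?addr0.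
  have ab0 : a%:R - b%:R != 0 :> K by rewrite subr_eq0 eqr_nat.
  by rewrite mulrC divfK // addNr.
pose h0 := theta_inv h'.
have oh0 : ord_ge n h0 by apply: ord_ge_theta_inv.
pose c := if odd n then 0 else - (f + h0)@_(mnm2 0 n).
exists (h0 + c *: circle ^+ N, sigma); split=> /=.
- apply: ord_geD => //; rewrite /c; case: ifPn => [_|ev]; first by rewrite scale0r; apply: ord_ge0.
  by apply: ord_geZ; rewrite (nE ev); apply: ord_ge_circle.
- by rewrite /sigma => ->.
- rewrite !lieD lieZ (_ : _ - _ = theta_inv r' + lie_xy h0 + c *: lie_xy (circle ^+ N)); last first.
    rewrite /r' /r -(thetaZ sigma) -thetaB thetaK; ring.
  apply: ord_geD.
    have -> : theta_inv r' + lie_xy h0 = i^-1 *: theta_inv (lie_uv h' + i *: r').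
      rewrite (theta_invD (lie_uv h')) theta_inv_lie theta_invZ scalerDr.
      by rewrite !scalerA mulVf ?i_neq0 // !scale1r addrC.
    by apply/ord_geZ/ord_ge_theta_inv.
  rewrite /c; case: ifPn => [_|ev]; first by rewrite scale0r; apply: ord_ge0.
  by apply: ord_geZ; rewrite {1}(nE ev); apply: lie_circle_pow.
- move=> ev; have circ1 : (circle ^+ N)@_(mnm2 0 n) = 1 by rewrite (nE ev) circle_pow_coef.
  rewrite addrA mcoeffD mcoeffZ /c (negbTE ev) circ1.
  by rewrite mulr1 subrr.
Qed.

(** Focal values are read off from some Frommer series and default to 0, so
their vanishing carries information only because such a series exists. *)
Lemma frommer_exists : exists F s, is_frommer w F s.
Proof.
have /choice[G GP] : forall x : nat * ({mpoly K[2]} * {mpoly K[2]}), exists hs : {mpoly K[2]} * K,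
    (3 <= x.1)%N -> ord_ge x.1 (lie_xy x.2.1 - x.2.2) ->
    [/\ ord_ge x.1 hs.1, odd x.1 -> hs.2 = 0,
      ord_ge x.1.+1 (lie_xy (x.2.1 + hs.1) - (x.2.2 + hs.2 *: power_sum K x.1)) &
      ~~ odd x.1 -> (x.2.1 + hs.1)@_(mnm2 0 x.1) = 0].
  move=> [n [f g]] /=; have [n3|/negP nn3] := boolP (3 <= n)%N; last by exists (0, 0).
  have [o|no] := pselect (ord_ge n (lie_xy f - g)); last by exists (0, 0).
  by have [hs hsP] := frommer_step n3 o; exists hs.
pose st := fix st n := if n is n'.+1 then
    if (3 <= n')%N then
      ((st n').1 + (G (n', st n')).1, (st n').2 + (G (n', st n')).2 *: power_sum K n')
    else st n'
  else (circle, 0).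
have stS n : st n.+1 = if (3 <= n)%N then
      ((st n).1 + (G (n, st n)).1, (st n).2 + (G (n, st n)).2 *: power_sum K n)
    else st n by [].
have inv n : ord_ge n (lie_xy (st n).1 - (st n).2).
  elim: n => [|n IHn]; first by move=> m.
  rewrite stS; case: ifPn => [n3|]; first by have [] := GP (n, st n) n3 IHn.
  rewrite -leqNgt => n2; have -> : st n = (circle, 0).
    by case: n n2 {IHn} => [|[|[|n]]].
  rewrite subr0; apply: ord_ge_le (@lie_circle_pow 1); lia.
pose sigma n := (G (n, st n)).2.
have stable n m : (n <= m)%N -> ord_ge n ((st m).1 - (st n).1).
  elim: m => [|m IHm]; first by rewrite leqn0 => /eqP ->; rewrite subrr; apply: ord_ge0.
  rewrite leq_eqVlt => /predU1P[->|ltnm]; first by rewrite subrr; apply: ord_ge0.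
  rewrite stS; case: ifPn => [m3|_]; last exact: IHm.
  rewrite /= addrAC; apply: ord_geD; first exact: IHm.
  by have [o _ _ _] := GP (m, st m) m3 (inv m); apply: ord_ge_le o.
have gE n a b : (st n).2@_(mnm2 a b) = (if (3 <= a + b < n)%N then sigma (a + b)%N else 0) *
    (power_sum K (a + b))@_(mnm2 a b).
  elim: n => [|n IHn]; first by rewrite mcoeff0 ltn0 andbF mul0r.
  rewrite stS ltnS; case: ifPn => [n3|n3]; last first.
    rewrite IHn; congr (_ * _); rewrite (_ : (3 <= a + b < n)%N = (3 <= a + b <= n)%N) //; lia.
  rewrite mcoeffD mcoeffZ IHn /=; have [e|ne] := eqVneq (a + b)%N n.
    by rewrite e ltnn andbF mul0r add0r leqnn n3.
  have n0 : (0 < n)%N by apply: leq_trans n3.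
  rewrite (power_sum_coef_eq0 _ n0 ne) mulr0 addr0.
  by rewrite (leq_eqVlt (a + b)) (negbTE ne).
pose F a b := (st (a + b).+1).1@_(mnm2 a b).
pose s j := sigma (2 * j + 2)%N.
have FE m a b : (a + b < m)%N -> F a b = (st m).1@_(mnm2 a b).
  move=> ltm; apply/eqP; rewrite eq_sym -subr_eq0 -mcoeffB (stable _ _ ltm) //.
  by rewrite mdeg_mnm2.
have st3 : (st 3).1 = circle by [].
exists F, s; split.
  split; first by split; rewrite (@FE 3) // st3 circle_coef.
    by split; rewrite (@FE 3) // st3 circle_coef.
  move=> n n4 ev; rewrite /F add0n stS ifT; last by lia.
  by have [_ _ _ ->] := GP (n, st n) (ltnW n4) (inv n).
move=> a b; rewrite -(@lie_trunc _ w F (a + b).+1) ?ltnSn //.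
have -> : (lie_xy (trunc (a + b).+1 F))@_(mnm2 a b) = (lie_xy (st (a + b).+2).1)@_(mnm2 a b).
  apply/eqP; rewrite -subr_eq0 -mcoeffB -lieB.
  rewrite (ord_ge_lie_xy pw (_ : ord_ge (a + b).+1 _)) ?mdeg_mnm2 // => m.
  rewrite -(mnm2K m) mdeg_mnm2 => ltm; rewrite mcoeffB trunc_coef ifT; last by lia.
  by rewrite (@FE (a + b).+2) ?subrr //; lia.
have := inv (a + b).+2 (mnm2 a b); rewrite mdeg_mnm2 mcoeffB ltnW // => /(_ isT)/eqP.
rewrite subr_eq0 => /eqP ->.
rewrite gE focal_seriesE ltnS leqnSn andbT; congr (_ * _).
have [evab|] := boolP (~~ odd (a + b)); last first.
  rewrite negbK andbF => od; case: ifP => // ab3; rewrite /sigma.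
  by have [_ ->] := GP ((a + b)%N, st (a + b)%N) ab3 (inv _).
rewrite andbT /s (_ : (3 <= a + b)%N = (3 < a + b)%N); last by lia.
by case: ifP => // ab3; congr sigma; lia.
Qed.

(** Since a Frommer series exists, the focal values are the s of one of them;
the first nonzero one is proportional to the first nonzero obstruction. *)
Lemma focal_values_obstructions :
  (forall j, (1 <= j)%N -> focal_value w j = 0) <->
  (forall n, (2 <= n)%N -> obstruction (acoef w) (bcoef w) n = 0).
Proof.
have [F FF] : exists F, is_frommer w F (focal_value w).
  have [F0 [s0 fr]] := frommer_exists.
  exact: (@xgetPex _ (fun=> 0) [set s : nat -> K | exists F, is_frommer w F s]
            (ex_intro _ s0 (ex_intro _ F0 fr))).
have UE j k : (ucoef w - 'X_0)@_(mnm2 j k) = if (j, k) \in quad_cubic then acoef w j k else 0.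
  rewrite mem_quad_cubic; have [lt2|le2] := ltnP (j + k) 2.
    by rewrite (ucoef_order pw) // mdeg_mnm2.
  rewrite mcoeffB mcoeffX mnm2U0 eq_mnm2 /=; case: leqP => [_|gt3]; last first.
    by rewrite -/(acoef _ _ _) acoef_high // sub0r; case: j k le2 gt3 => [|[|j]] [|k] //; rewrite oppr0.
  by case: j k le2 => [|[|j]] [|k] // _; rewrite subr0.
have VE j k : (vcoef w - 'X_1)@_(mnm2 j k) = if (j, k) \in quad_cubic then bcoef w j k else 0.
  rewrite mem_quad_cubic; have [lt2|le2] := ltnP (j + k) 2.
    by rewrite (vcoef_order pw) // mdeg_mnm2.
  rewrite mcoeffB mcoeffX mnm2U1 eq_mnm2 /=; case: leqP => [_|gt3]; last first.
    by rewrite -/(bcoef _ _ _) bcoef_high // sub0r; case: j k le2 gt3 => [|j] [|[|k]] //; rewrite oppr0.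
  by case: j k le2 => [|j] [|[|k]] // _; rewrite subr0.
have hE := lie_trunc_formal_integral UE VE.
have step N : (2 <= N)%N -> (forall j, (1 <= j)%N -> (j.+1 < N)%N -> focal_value w j = 0) ->
    (forall n, (2 <= n < N)%N -> obstruction (acoef w) (bcoef w) n = 0) ->
    obstruction (acoef w) (bcoef w) N =
      i * focal_value w N.-1 * (theta (power_sum K (2 * N)))@_(mnm2 N N).
  move=> N2 s0 L0; have leNN : (N + N <= 2 * N)%N by lia.
  have := hE _ _ _ leNN; rewrite eqxx => <-.
  apply: (focal_obstruction pw N2 FF s0); first by apply: trunc_formal_integral_order; lia.
  move=> m; rewrite -(mnm2K m) mdeg_mnm2; move: (m 0) (m 1) => a b lt2N.
  rewrite hE ?(ltnW lt2N) //; case: eqP => // eab.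
  have [lt1|le2] := ltnP a 2; last by rewrite L0 //; lia.
  by rewrite /obstruction defect_low //; lia.
split=> zero.
  elim/ltn_ind => N IHN N2; rewrite step //; first by rewrite zero ?mulr0 ?mul0r //; lia.
    by move=> j j1 _; apply: zero.
  by move=> n /andP[n2 ltn]; apply: IHN.
elim/ltn_ind => j IHj j1.
have L0 n : (2 <= n < j.+1)%N -> obstruction (acoef w) (bcoef w) n = 0.
  by move=> /andP[n2 _]; apply: zero.
have := step j.+1 j1 (fun k k1 ltk => IHj k ltk k1) L0.
rewrite zero // => /esym/eqP; rewrite !mulf_eq0 (negbTE (i_neq0 K)) /=.
by rewrite (negbTE (theta_power_sum_neq0 K _)) orbF => /eqP.
Qed.

Lemma center_varietyP : center_variety K w <->
  (forall n, (2 <= n)%N -> obstruction (acoef w) (bcoef w) n = 0).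
Proof. by rewrite -focal_values_obstructions /center_variety /=; split=> [[]|]. Qed.

End CenterVariety.

(** * First-order data of rational functions *)

Section IntegerValues.
Variable (K : numFieldType).

Definition zval (z : Z) : K := (int_of_Z z)%:~R.

Lemma zvalD x y : zval (x + y) = zval x + zval y.
Proof. by rewrite /zval -intrD -rmorphD. Qed.
Lemma zvalB x y : zval (x - y) = zval x - zval y.
Proof. by rewrite /zval -intrB -rmorphB. Qed.
Lemma zvalM x y : zval (x * y) = zval x * zval y.
Proof. by rewrite /zval -intrM -rmorphM. Qed.
Lemma zval_nat n : zval (Z.of_nat n) = n%:R.
Proof. by rewrite /zval; have -> : int_of_Z (Z.of_nat n) = n by lia. Qed.
Lemma zval_eq0 z : (zval z == 0) = (z == 0).
Proof. by rewrite /zval intr_eq0; apply/eqP/eqP; lia. Qed.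

End IntegerValues.

(** First-order data along the directions of a finite family: index 0 holds a
value and index t.+1 the derivative in direction t. *)
Definition jet_mul (x y : nat -> Z) (t : nat) : Z :=
  if t is t'.+1 then (x 0%N * y t + x t * y 0%N) else (x 0%N * y 0%N).

Section Jets.
Variables (K : numFieldType) (V : vectType K) (D : V -> K) (p : V).
Hypothesis rD : regular D.
Variables (n : nat) (e : 'I_n -> V -> K).
Implicit Types (f g h : V -> K) (x y : nat -> Z).

(** Rational functions whose poles lie on D = 0. *)
Definition ratfun f :=
  exists N q, regular q /\ forall w, D w != 0 -> f w * D w ^+ N = q w.

Lemma regular_ratfun f : regular f -> ratfun f.
Proof. by exists 0%N, f; split=> // w _; rewrite expr0 mulr1. Qed.

Lemma ratfun_cst c : ratfun (fun=> c).
Proof. apply: regular_ratfun; exact: regular_cst. Qed.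

Lemma ratfunD f g : ratfun f -> ratfun g -> ratfun (fun w => f w + g w).
Proof.
move=> [N [q [rq fq]]] [M [r [rr gr]]].
exists (N + M)%N, (fun w => q w * D w ^+ M + r w * D w ^+ N); split.
  by apply: regularD; apply: regularM => //; apply: regularX.
by move=> w Dw; rewrite mulrDl exprD -fq // -gr //; ring.
Qed.

Lemma ratfunM f g : ratfun f -> ratfun g -> ratfun (fun w => f w * g w).
Proof.
move=> [N [q [rq fq]]] [M [r [rr gr]]].
exists (N + M)%N, (fun w => q w * r w); split; first exact: regularM.
by move=> w Dw; rewrite exprD -fq // -gr //; ring.
Qed.

Lemma ratfun_ext f g : (forall w, f w = g w) -> ratfun g -> ratfun f.
Proof. by move=> fg [N [q [rq gq]]]; exists N, q; split=> // w; rewrite fg; apply: gq. Qed.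

Lemma ratfunX f m : ratfun f -> ratfun (fun w => f w ^+ m).
Proof.
move=> rf; elim: m => [|m IHm]; first by apply: ratfun_ext (ratfun_cst 1) => w; rewrite expr0.
by apply: ratfun_ext (ratfunM rf IHm) => w; rewrite exprS.
Qed.

Lemma ratfun_sum (I : Type) (r : seq I) (P : pred I) (F : I -> V -> K) :
  (forall i, ratfun (F i)) -> ratfun (fun w => \sum_(i <- r | P i) F i w).
Proof.
move=> rF; elim: r => [|i r IHr].
  by apply: ratfun_ext (ratfun_cst 0) => w; rewrite big_nil.
case Pi: (P i); last by apply: ratfun_ext IHr => w; rewrite big_cons Pi.
by apply: ratfun_ext (ratfunD (rF i) IHr) => w; rewrite big_cons Pi.
Qed.

Lemma ratfun_prod (I : Type) (r : seq I) (F : I -> V -> K) :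
  (forall i, ratfun (F i)) -> ratfun (fun w => \prod_(i <- r) F i w).
Proof.
move=> rF; elim: r => [|i r IHr].
  by apply: ratfun_ext (ratfun_cst 1) => w; rewrite big_nil.
by apply: ratfun_ext (ratfunM (rF i) IHr) => w; rewrite big_cons.
Qed.

Lemma ratfun_det m (H : 'I_m -> 'I_m -> V -> K) :
  (forall i j, ratfun (H i j)) -> ratfun (fun w => \det (\matrix_(i, j) H i j w)).
Proof.
move=> rH; apply: (@ratfun_ext _
  (fun w => \sum_(s : 'S_m) (-1) ^+ s * \prod_i H i (s i) w)) => [w|].
  by apply: eq_bigr => s _; congr (_ * _); apply: eq_bigr => i _; rewrite mxE.
apply: ratfun_sum => s; apply: ratfunM; first exact: ratfun_cst.
by apply: ratfun_prod => i; apply: rH.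
Qed.

(** f - g is a combination of the functions e t with ratfun coefficients; x
records the common value of f and g at p and the values there of the
coefficients, which for e vanishing at p are partial derivatives of f - g. *)
Definition jet f g x :=
  [/\ ratfun f /\ ratfun g, f p = zval K (x 0%N), g p = zval K (x 0%N) &
    exists H : 'I_n -> V -> K,
      (forall t : 'I_n, ratfun (H t) /\ H t p = zval K (x t.+1)) /\
      forall w, D w != 0 -> f w - g w = \sum_t H t w * e t w].

Lemma jet_ext f f' g g' x x' : (forall w, f' w = f w) -> (forall w, g' w = g w) ->
  (forall t, (t <= n)%N -> x' t = x t) -> jet f g x -> jet f' g' x'.
Proof.
move=> ff gg xx [[rf rg] fp gp [H [HP fgH]]]; split.
- by split; [apply: ratfun_ext rf|apply: ratfun_ext rg].
- by rewrite ff xx.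
- by rewrite gg xx.
exists H; split=> [t|w Dw]; last by rewrite ff gg fgH.
by rewrite xx //; apply: HP.
Qed.

Lemma jet_same f z : ratfun f -> f p = zval K z ->
  jet f f (fun t => if t is _.+1 then 0 else z).
Proof.
move=> rf fp; split=> //; exists (fun _ _ => 0); split=> [t|w _]; last first.
  by rewrite subrr big1 // => t _; rewrite mul0r.
by split; first exact: ratfun_cst.
Qed.

Lemma jetD f g x f' g' x' : jet f g x -> jet f' g' x' ->
  jet (fun w => f w + f' w) (fun w => g w + g' w) (fun t => (x t + x' t)).
Proof.
move=> [[rf rg] fp gp [H [HP fgH]]] [[rf' rg'] fp' gp' [H' [HP' fgH']]]; split.
- by split; apply: ratfunD.
- by rewrite fp fp' zvalD.
- by rewrite gp gp' zvalD.
exists (fun t w => H t w + H' t w); split=> [t|w Dw].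
  have [rH Hp] := HP t; have [rH' Hp'] := HP' t.
  by split; [apply: ratfunD|rewrite Hp Hp' zvalD].
rewrite opprD addrACA fgH // fgH' // -big_split; apply: eq_bigr => t _ /=.
by rewrite mulrDl.
Qed.

(** The product rule at two points: f f' - g g' = f (f' - g') + (f - g) g'. *)
Lemma jetM f g x f' g' x' : jet f g x -> jet f' g' x' ->
  jet (fun w => f w * f' w) (fun w => g w * g' w) (jet_mul x x').
Proof.
move=> [[rf rg] fp gp [H [HP fgH]]] [[rf' rg'] fp' gp' [H' [HP' fgH']]]; split.
- by split; apply: ratfunM.
- by rewrite fp fp' zvalM.
- by rewrite gp gp' zvalM.
exists (fun t w => f w * H' t w + H t w * g' w); split=> [t|w Dw].
  have [rH Hp] := HP t; have [rH' Hp'] := HP' t; split.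
    by apply: ratfunD; apply: ratfunM.
  by rewrite Hp Hp' fp gp' /= zvalD !zvalM.
transitivity (f w * (f' w - g' w) + (f w - g w) * g' w); first by ring.
rewrite fgH // fgH' // mulr_sumr mulr_suml -big_split; apply: eq_bigr => t _ /=.
by ring.
Qed.

Lemma jetZ f g x z : jet f g x ->
  jet (fun w => zval K z * f w) (fun w => zval K z * g w) (fun t => (z * x t)).
Proof.
move=> jf; apply: jet_ext (jetM (jet_same (ratfun_cst (zval K z)) erefl) jf) => //.
by case=> [|t] _ /=; lia.
Qed.

Lemma jetB f g x f' g' x' : jet f g x -> jet f' g' x' ->
  jet (fun w => f w - f' w) (fun w => g w - g' w) (fun t => (x t - x' t)).
Proof.
move=> jf /(jetZ (-1 : Z)) jf'; have zN1 : zval K (-1 : Z) = -1 by [].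
apply: jet_ext (jetD jf jf') => [w|w|t _]; last by lia.
  by rewrite zN1 mulN1r.
by rewrite zN1 mulN1r.
Qed.

Lemma jet_div f g x y (z : Z) : z != 0 ->
  (forall t, (t <= n)%N -> z * y t = x t) ->
  jet (fun w => zval K z * f w) (fun w => zval K z * g w) x -> jet f g y.
Proof.
move=> z0 zy [[rf rg] fp gp [H [HP fgH]]].
have zK : zval K z != 0 by rewrite zval_eq0.
have rdiv h : ratfun (fun w => zval K z * h w) -> ratfun h.
  move=> /(ratfunM (ratfun_cst (zval K z)^-1)); apply: ratfun_ext => w.
  by rewrite mulKf.
split.
- by split; apply: rdiv.
- by apply: (mulfI zK); rewrite fp -zy // zvalM.
- by apply: (mulfI zK); rewrite gp -zy // zvalM.
exists (fun t w => (zval K z)^-1 * H t w); split=> [t|w Dw].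
  have [rH Hp] := HP t; split; first by apply: ratfunM => //; apply: ratfun_cst.
  by rewrite Hp -zy // zvalM mulKf.
apply: (mulfI zK); rewrite mulrBr fgH // mulr_sumr; apply: eq_bigr => t _.
by rewrite -mulrA mulVKf.
Qed.

Lemma jet_sum (I : Type) (r : seq I) (P : pred I) (F G : I -> V -> K) (X : I -> nat -> Z) :
  (forall i, P i -> jet (F i) (G i) (X i)) ->
  jet (fun w => \sum_(i <- r | P i) F i w) (fun w => \sum_(i <- r | P i) G i w)
    (fun t => foldr (fun i z => if P i then (X i t + z) else z) 0 r).
Proof.
move=> jF; elim: r => [|i r IHr].
  apply: jet_ext (jet_same (ratfun_cst 0) (z := 0) _) => // [w|w|[]//]; by rewrite big_nil.
case Pi: (P i).
  by apply: jet_ext (jetD (jF i Pi) IHr) => [w|w|t _]; rewrite /= ?big_cons Pi.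
by apply: jet_ext IHr => [w|w|t _]; rewrite /= ?big_cons Pi.
Qed.

End Jets.

(** * Jets of the obstructions *)

(** The jet of the defect, computed from the jets of its arguments. *)
Definition defect_jet (xa xb T : nat -> nat -> nat -> Z) (a b t : nat) : Z :=
  foldr (fun m z => if (m.1 <= a)%N && (m.2 <= b)%N then
      jet_mul (xa m.1 m.2) (fun t => Z.of_nat (a - m.1).+1 * T (a - m.1).+1 (b - m.2)%N t) t
    - jet_mul (xb m.1 m.2) (fun t => Z.of_nat (b - m.2).+1 * T (a - m.1)%N (b - m.2).+1 t) t
    + z else z) 0 quad_cubic.

(** The recursion is linear in the coefficients of the formal integral, so
after scaling by a common denominator L all entries are integers. *)
Definition table_step (L : Z) xa xb T a b t : bool :=
  if (a + b <= 2)%N then T a b t == (if [&& a == 1, b == 1 & t == 0]%N then L else 0)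
  else if a == b then T a b t == 0
  else (Z.of_nat b - Z.of_nat a) * T a b t == defect_jet xa xb T a b t.

Definition table_ok M n L xa xb T : bool :=
  all (fun a => all (fun b => (a + b <= M)%N ==> all (table_step L xa xb T a b) (iota 0 n.+1))
    (iota 0 M.+1)) (iota 0 M.+1).

Section ObstructionJets.
Variables (K : numFieldType) (V : vectType K) (D : V -> K) (p : V).
Hypothesis rD : regular D.
Variables (n : nat) (e : 'I_n -> V -> K).
Variables (al be be' : V -> nat -> nat -> K) (xa xb T : nat -> nat -> nat -> Z).
Variables (M : nat) (L : Z).
Hypothesis al_jet : forall j k, (j, k) \in quad_cubic ->
  jet D p e (fun w => al w j k) (fun w => al w j k) (xa j k).
Hypothesis be_jet : forall j k, (j, k) \in quad_cubic ->
  jet D p e (fun w => be w j k) (fun w => be' w j k) (xb j k).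
Hypothesis T_ok : table_ok M n L xa xb T.

Lemma defectZ (x : K) f g c a b :
  defect f g (fun j k => x * c j k) a b = x * defect f g c a b.
Proof. by rewrite /defect mulr_sumr; apply: eq_bigr => m _; ring. Qed.

Lemma table_stepP a b t : (a + b <= M)%N -> (t <= n)%N -> table_step L xa xb T a b t.
Proof.
move=> abM tn; have in_iota m k : (m <= k)%N -> m \in iota 0 k.+1 by rewrite mem_iota.
have /allP ha := T_ok; have /allP hb := ha a (in_iota _ _ (leq_trans (leq_addr _ _) abM)).
have := hb b (in_iota _ _ (leq_trans (leq_addl _ _) abM)); rewrite abM => /allP.
by apply; apply: in_iota.
Qed.

Lemma defect_jetP (c c' : V -> nat -> nat -> K) a b :
  (forall a' b', (a' + b' < a + b)%N ->
    jet D p e (fun w => c w a' b') (fun w => c' w a' b') (T a' b')) ->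
  jet D p e (fun w => defect (al w) (be w) (c w) a b)
    (fun w => defect (al w) (be' w) (c' w) a b) (defect_jet xa xb T a b).
Proof.
move=> cjet; rewrite /defect /defect_jet.
pose ok (m : nat * nat) := [&& m \in quad_cubic, (m.1 <= a)%N & (m.2 <= b)%N].
pose F (f g : V -> nat -> nat -> K) (h : V -> nat -> nat -> K) (m : nat * nat) w :=
  f w m.1 m.2 * ((a - m.1).+1%:R * h w (a - m.1).+1 (b - m.2)%N)
     - g w m.1 m.2 * ((b - m.2).+1%:R * h w (a - m.1)%N (b - m.2).+1).
pose X (m : nat * nat) t :=
  jet_mul (xa m.1 m.2) (fun t => Z.of_nat (a - m.1).+1 * T (a - m.1).+1 (b - m.2)%N t) t
    - jet_mul (xb m.1 m.2) (fun t => Z.of_nat (b - m.2).+1 * T (a - m.1)%N (b - m.2).+1 t) t.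
have okE (G : nat * nat -> K) : \sum_(m <- quad_cubic | (m.1 <= a)%N && (m.2 <= b)%N) G m =
    \sum_(m <- quad_cubic | ok m) G m by rewrite big_seq_cond.
have Xfold t : foldr (fun m z => if (m.1 <= a)%N && (m.2 <= b)%N then X m t + z else z) 0 quad_cubic =
    foldr (fun m z => if ok m then X m t + z else z) 0 quad_cubic.
  by rewrite /= /ok !mem_quad_cubic.
suff J m : ok m -> jet D p e (F al be c m) (F al be' c' m) (X m).
  apply: jet_ext (jet_sum rD quad_cubic J) => [w|w|t _].
  - by rewrite okE.
  - by rewrite okE.
  - by rewrite -Xfold.
case: m => [j k] /and3P[jk /= lea leb].

have jk2 : (2 <= j + k <= 3)%N by rewrite -mem_quad_cubic.
have j1 : jet D p e (fun w => c w (a - j).+1 (b - k)%N) (fun w => c' w (a - j).+1 (b - k)%N)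
    (T (a - j).+1 (b - k)%N) by apply: cjet; lia.
have j2 : jet D p e (fun w => c w (a - j)%N (b - k).+1) (fun w => c' w (a - j)%N (b - k).+1)
    (T (a - j)%N (b - k).+1) by apply: cjet; lia.
have t1 := jetM rD (al_jet jk) (jetZ rD (Z.of_nat (a - j).+1) j1).
have t2 := jetM rD (be_jet jk) (jetZ rD (Z.of_nat (b - k).+1) j2).
by apply: jet_ext (jetB rD t1 t2) => [w|w|//]; rewrite !zval_nat.
Qed.

Lemma integral_jet a b : (a + b <= M)%N ->
  jet D p e (fun w => zval K L * formal_integral (al w) (be w) a b)
    (fun w => zval K L * formal_integral (al w) (be' w) a b) (T a b).
Proof.
elim/ltn_ind: {a b}(a + b)%N {-2}a {-2}b (erefl (a + b)%N) => m IHm a b eab abM.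
have [ab2|ab3] := leqP (a + b) 2.
  have Tab t : (t <= n)%N -> T a b t = if [&& a == 1, b == 1 & t == 0]%N then L else 0.
    by move=> tn; have := table_stepP abM tn; rewrite /table_step ab2 => /eqP.
  pose z := if (a == 1)%N && (b == 1)%N then L else 0.
  apply: jet_ext (jet_same (z := z) e (ratfun_cst D (zval K z)) erefl) => [w|w|t tn].
  - by rewrite integral_low // /z; case: ifP; rewrite ?mulr1 ?mulr0.
  - by rewrite integral_low // /z; case: ifP; rewrite ?mulr1 ?mulr0.
  - by rewrite Tab // /z; case: (a == 1)%N; case: (b == 1)%N; case: t {tn}.
have [eqab|neab] := eqVneq a b.
  apply: jet_ext (jet_same (z := 0) e (ratfun_cst D 0) erefl) => [w|w|t tn].
  - by rewrite -eqab integral_diag ?mulr0 //; lia.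
  - by rewrite -eqab integral_diag ?mulr0 //; lia.
  have := table_stepP abM tn; rewrite /table_step leqNgt ab3 eqab eqxx => /eqP ->.
  by case: t {tn}.
have ne0 : Z.of_nat b - Z.of_nat a != 0.
  by apply: contraNneq neab => e0; apply/eqP; lia.
apply: (jet_div (x := defect_jet xa xb T a b) ne0) => [t tn|].
  have := table_stepP abM tn; rewrite /table_step leqNgt ab3 (negbTE neab) => /eqP; exact.
have IH a' b' : (a' + b' < a + b)%N ->
    jet D p e (fun w => zval K L * formal_integral (al w) (be w) a' b')
      (fun w => zval K L * formal_integral (al w) (be' w) a' b') (T a' b').
  by rewrite eab => ltab; apply: IHm erefl _ => //; apply: leq_trans (ltnW ltab) _; rewrite -eab.
apply: jet_ext (defect_jetP (c := fun w j k => zval K L * formal_integral (al w) (be w) j k)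
  (c' := fun w j k => zval K L * formal_integral (al w) (be' w) j k) IH) => // w.
  by rewrite (defectZ _ _ _ (formal_integral (al w) (be w))) zvalB !zval_nat -integral_eq //; ring.
by rewrite (defectZ _ _ _ (formal_integral (al w) (be' w))) zvalB !zval_nat -integral_eq //; ring.
Qed.

Lemma obstruction_jet m : (2 <= m)%N -> (m + m <= M.+1)%N ->
  jet D p e (fun w => zval K L * obstruction (al w) (be w) m)
    (fun w => zval K L * obstruction (al w) (be' w) m) (defect_jet xa xb T m m).
Proof.
move=> m2 mM; have cjet a b : (a + b < m + m)%N ->
    jet D p e (fun w => zval K L * formal_integral (al w) (be w) a b)
      (fun w => zval K L * formal_integral (al w) (be' w) a b) (T a b).
  by move=> ltab; apply: integral_jet; rewrite -ltnS (leq_trans ltab).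
apply: jet_ext (defect_jetP (c := fun w j k => zval K L * formal_integral (al w) (be w) j k)
  (c' := fun w j k => zval K L * formal_integral (al w) (be' w) j k) cjet) => // w; rewrite /obstruction.
  by rewrite (defectZ _ _ _ (formal_integral (al w) (be w))).
by rewrite (defectZ _ _ _ (formal_integral (al w) (be' w))).
Qed.

End ObstructionJets.

Definition sum_upto (n : nat) (F : nat -> Z) : Z := foldr (fun j z => F j + z) 0 (iota 0 n).

Lemma sum_uptoE n F : sum_upto n F = \sum_(j < n) F j.
Proof.
rewrite /sum_upto -(big_mkord xpredT F) /index_iota subn0.
by elim: (iota 0 n) => [|j r IHr] /=; rewrite ?big_nil // big_cons IHr.
Qed.

Definition inverse_upto (n : nat) (N M : nat -> nat -> Z) (d : Z) : bool :=
  (d != 0) && all (fun i => all (fun k =>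
    sum_upto n (fun j => N i j * M j k) == if i == k then d else 0) (iota 0 n)) (iota 0 n).

(** N is an inverse of M up to the nonzero factor d. *)
Lemma det_zval_neq0 (K : numFieldType) n (N M : nat -> nat -> Z) d :
  inverse_upto n N M d -> \det (\matrix_(i < n, j < n) zval K (M i j)) != 0.
Proof.
move=> /andP[d0 /allP NM]; apply/eqP => detM.
have NME : (\matrix_(i < n, j < n) zval K (N i j)) *m (\matrix_(i < n, j < n) zval K (M i j)) =
    (zval K d)%:M.
  apply/matrixP => i k; rewrite !mxE.
  have io (m : 'I_n) : (m : nat) \in iota 0 n by rewrite mem_iota ltn_ord.
  have /allP/(_ k (io k))/eqP := NM i (io i); rewrite sum_uptoE => e.
  transitivity (zval K (\sum_(j < n) N i j * M j k)).
    rewrite /zval !rmorph_sum; apply: eq_bigr => j _.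
    by rewrite !mxE -zvalM.
  by rewrite e -val_eqE; case: (_ == _); rewrite ?mulr1n ?mulr0n.
have := congr1 determinant NME; rewrite det_mulmx detM mulr0 det_scalar => /esym/eqP.
by rewrite expf_eq0 zval_eq0 (negbTE d0) andbF.
Qed.

(** * The Jacobian at one symmetric form *)

(** The pair (2, 0) serves to eliminate s, and the other pairs give the six
equations of the symmetric forms. *)
Definition sym_relations : seq (nat * nat) := behead quad_cubic.

(** The symmetric field u' = u + u ^ 2 + u v ^ 2, v' = - (v + v ^ 2 + u ^ 2
v), at which the first six obstructions have independent derivatives in the
directions transversal to the symmetric forms. *)
Definition base_point (j k : nat) : Z :=
  if (j, k) \in [:: (2, 0); (1, 2)]%N then 1 else 0.

Definition ucoef_jet (j k t : nat) : Z := if t is _.+1 then 0 else base_point j k.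
Definition vcoef_jet (j k t : nat) : Z :=
  if t is t'.+1 then (if nth (0, 0)%N sym_relations t' == (k, j) then 1 else 0)
  else base_point k j.

Definition row_lookup (rows : seq (seq (seq Z))) (a b t : nat) : Z :=
  nth 0 (nth [::] (nth [::] rows (a + b)) a) t.

(** The division is exact for the scale chosen below; table_ok checks this. *)
Fixpoint integral_rows (L : Z) (n : nat) : seq (seq (seq Z)) :=
  if n is n'.+1 then
    let rows := integral_rows L n' in
    rcons rows [seq [seq
      (if (n <= 2)%N then (if [&& a == 1, n == 2 & t == 0]%N then L else 0)
       else if (a + a == n)%N then 0
       else Z.div (defect_jet ucoef_jet vcoef_jet (row_lookup rows) a (n - a) t)
              (Z.of_nat (n - a) - Z.of_nat a))
      | t <- iota 0 7] | a <- iota 0 n.+1]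
  else [:: [:: nseq 7 0]].

(** A common denominator of the coefficients of degree at most 14 and of their
derivatives. *)
Definition table_scale : Z := 130767436800.
Definition integral_table := Eval vm_compute in integral_rows table_scale 14.

Lemma integral_table_ok :
  table_ok 14 6 table_scale ucoef_jet vcoef_jet (row_lookup integral_table).
Proof. by vm_compute. Qed.

Definition jacobian (i t : nat) : Z :=
  defect_jet ucoef_jet vcoef_jet (row_lookup integral_table) i.+2 i.+2 t.+1.

Definition jacobian_rows := Eval vm_compute in
  [seq [seq jacobian i t | t <- iota 0 6] | i <- iota 0 6].

(** Unlike the determinant of a matrix this one evaluates; it produces the
candidate for the inverse, which is then checked by multiplication. *)
Fixpoint laplace (n : nat) (M : nat -> nat -> Z) : Z :=
  if n is n'.+1 then
    foldr (fun j z => (if odd j then - M 0%N j else M 0%N j) *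
      laplace n' (fun i k => M i.+1 (bump j k)) + z) 0 (iota 0 n)
  else 1.
Definition jac i t := nth 0 (nth [::] jacobian_rows i) t.
Definition jac_adj i j : Z :=
  (if odd (i + j) then -1 else 1) * laplace 5 (fun k l => jac (bump j k) (bump i l)).

Definition adj_rows := Eval vm_compute in
  [seq [seq jac_adj i t | t <- iota 0 6] | i <- iota 0 6].
Definition jac_det := Eval vm_compute in laplace 6 jac.

Lemma jac_inverse : inverse_upto 6 (fun i j => nth 0 (nth [::] adj_rows i) j) jacobian jac_det.
Proof. by vm_compute. Qed.

(** * Coefficients and regular functions on cubic forms *)

Section FormCoordinates.
Variable (K : numClosedFieldType).
Implicit Types (w v : cubic_form K) (al be : nat -> nat -> K).

Lemma form_choice : exists mk : (nat -> nat -> K) -> (nat -> nat -> K) -> cubic_form K,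
  forall al be j k, (j + k <= 3)%N -> acoef (mk al be) j k = al j k /\ bcoef (mk al be) j k = be j k.
Proof.
have /choice[f fP] : forall ab : (nat -> nat -> K) * (nat -> nat -> K), exists w,
    forall j k, (j + k <= 3)%N -> acoef w j k = ab.1 j k /\ bcoef w j k = ab.2 j k.
  by move=> [al be]; apply: form_exists.
by exists (fun al be => f (al, be)) => al be; apply: fP.
Qed.

Definition coef_form al be : cubic_form K := projT1 (cid form_choice) al be.

Lemma acoef_form al be j k : (j + k <= 3)%N -> acoef (coef_form al be) j k = al j k.
Proof. by move=> le3; have [] := projT2 (cid form_choice) al be j k le3. Qed.
Lemma bcoef_form al be j k : (j + k <= 3)%N -> bcoef (coef_form al be) j k = be j k.
Proof. by move=> le3; have [] := projT2 (cid form_choice) al be j k le3. Qed.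

Lemma form_ext_low w w' :
  (forall j k, (j + k <= 3)%N -> acoef w j k = acoef w' j k /\ bcoef w j k = bcoef w' j k) ->
  w = w'.
Proof.
move=> ww'; apply: form_ext => j k; have [|gt3] := leqP (j + k) 3; first exact: ww'.
by rewrite !acoef_high ?bcoef_high.
Qed.

Lemma sum_delta (F : nat -> nat -> K) j k : (j + k <= 3)%N ->
  \sum_(j' < 4) \sum_(k' < 4) F j' k' * ((j == j') && (k == k'))%N%:R = F j k.
Proof.
move=> le3; have ltj : (j < 4)%N by lia. have ltk : (k < 4)%N by lia.
rewrite (bigD1 (Ordinal ltj)) //= (bigD1 (Ordinal ltk)) //= !eqxx mulr1.
rewrite !big1 ?addr0 // => [j' nej|k' nek].
  rewrite big1 // => k' _; rewrite (_ : (j == j') = false) ?mulr0 //.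
  by apply: contraNF nej => /eqP e; apply/eqP/val_inj.
rewrite (_ : (k == k') = false) ?mulr0 //.
by apply: contraNF nek => /eqP e; apply/eqP/val_inj.
Qed.

(** A form is the sum of its coefficients times the forms with a single
coefficient. *)
Lemma linear_form_coef (l : cubic_form K -> K) : linear_for *%R l ->
  exists x y : nat -> nat -> K, forall w,
    l w = \sum_(j < 4) \sum_(k < 4) (x j k * acoef w j k + y j k * bcoef w j k).
Proof.
move=> llin; pose de (j k j' k' : nat) : K := ((j' == j) && (k' == k))%N%:R.
pose e1 j k := coef_form (de j k) (fun _ _ => 0); pose e2 j k := coef_form (fun _ _ => 0) (de j k).
exists (fun j k => l (e1 j k)), (fun j k => l (e2 j k)) => w.
have {1}-> : w = \sum_(j < 4) \sum_(k < 4) (acoef w j k *: e1 j k + bcoef w j k *: e2 j k).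
  apply: form_ext_low => j k le3.
  rewrite (linear_form_sum (acoef_linear j k)) (linear_form_sum (bcoef_linear j k)); split.
    rewrite -[LHS](sum_delta (acoef w) le3); apply: eq_bigr => j' _.
    rewrite (linear_form_sum (acoef_linear j k)); apply: eq_bigr => k' _.
    rewrite (linear_formD (acoef_linear j k)) !(linear_formZ (acoef_linear j k)).
    by rewrite !acoef_form // mulr0 addr0.
  rewrite -[LHS](sum_delta (bcoef w) le3); apply: eq_bigr => j' _.
  rewrite (linear_form_sum (bcoef_linear j k)); apply: eq_bigr => k' _.
  rewrite (linear_formD (bcoef_linear j k)) !(linear_formZ (bcoef_linear j k)).
  by rewrite !bcoef_form // mulr0 add0r.
rewrite (linear_form_sum llin); apply: eq_bigr => j _; rewrite (linear_form_sum llin).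
apply: eq_bigr => k _; rewrite (linear_formD llin) !(linear_formZ llin).
by rewrite ![acoef _ _ _ * _]mulrC ![bcoef _ _ _ * _]mulrC.
Qed.

(** Regularity of a map into the space of forms is tested on the coefficients,
whatever basis underlies the notion of regular function. *)
Lemma regular_comp (U : vectType K) (phi : U -> cubic_form K) :
  (forall j k, (j + k <= 3)%N -> regular (fun u => acoef (phi u) j k)) ->
  (forall j k, (j + k <= 3)%N -> regular (fun u => bcoef (phi u) j k)) ->
  forall f, regular f -> regular (fun u => f (phi u)).
Proof.
move=> ra rb; have ra' j k : regular (fun u => acoef (phi u) j k).
  have [/ra//|gt3] := leqP (j + k) 3.
  by apply: regular_ext (regular_cst _ 0) => u; rewrite acoef_high.
have rb' j k : regular (fun u => bcoef (phi u) j k).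
  have [/rb//|gt3] := leqP (j + k) 3.
  by apply: regular_ext (regular_cst _ 0) => u; rewrite bcoef_high.
apply: regular_ind => [f g fg|c|f g rf rg|f g rf rg|i].
- by apply: regular_ext => u; rewrite fg.
- exact: regular_cst.
- exact: regularD.
- exact: regularM.
have [|x [y xyE]] := linear_form_coef (l := coord (vbasis {:cubic_form K}) i).
  by move=> c v w; rewrite linearP.
apply: (regular_ext (fun u => xyE (phi u))); clear xyE.
by apply: regular_sum => j _; apply: regular_sum => k _; apply: regularD; apply: regularZ.
Qed.

Lemma regular_obstruction n :
  regular (fun w : cubic_form K => obstruction (acoef w) (bcoef w) n).
Proof.
have rdefect (c : cubic_form K -> nat -> nat -> K) a b :
    (forall a' b', regular (fun w => c w a' b')) ->
    regular (fun w => defect (acoef w) (bcoef w) (c w) a b).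
  move=> rc; apply: regular_sum => m _; apply: regularB; apply: regularM.
  - exact: regular_acoef.
  - exact: regularZ.
  - exact: regular_bcoef.
  - exact: regularZ.
apply: (rdefect (fun w => formal_integral (acoef w) (bcoef w))) => a b; rewrite /formal_integral; move: (a + b)%N => N.
elim: N a b => [|N IHN] a b; first exact: regular_cst.
case cond: ((2 < N.+1)%N && (a + b == N.+1)%N); last first.
  by apply: regular_ext (IHN a b) => w /=; rewrite cond.
have [eab|neab] := eqVneq a b.
  by apply: regular_ext (regular_cst _ 0) => w /=; rewrite cond eab eqxx.
have r := rdefect (fun w => formal_integral_stage (acoef w) (bcoef w) N) a b IHN.
apply: regular_ext (regularZ (b%:R - a%:R)^-1 r) => w /=.
by rewrite cond (negbTE neab) mulrC.
Qed.

Lemma closedI (Y Z : set (cubic_form K)) :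
  zariski_closed Y -> zariski_closed Z -> zariski_closed (Y `&` Z).
Proof.
move=> cY cZ; have -> : Y `&` Z = \bigcap_(b in [set: bool]) (if b then Y else Z).
  apply/seteqP; split=> v; first by move=> [Yv Zv] [].
  by move=> h; split; [apply: (h true)|apply: (h false)].
by apply: closed_bigcap => -[].
Qed.

Lemma closed_poincare : zariski_closed (poincare K).
Proof.
pose za (j k : nat) (c : K) := [set w : cubic_form K | acoef w j k - c = 0].
pose zb (j k : nat) (c : K) := [set w : cubic_form K | bcoef w j k - c = 0].
have -> : poincare K = (za 0%N 0%N 0 `&` zb 0%N 0%N 0) `&` (za 1%N 0%N 1 `&` zb 0%N 1%N 1) `&`
    (za 0%N 1%N 0 `&` zb 1%N 0%N 0).
  have e (x y : K) : (x - y = 0) <-> x = y by rewrite (rwP eqP) subr_eq0 -(rwP eqP).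
  apply/seteqP; split=> w.
    move=> /poincareP[[a b] [c d] [f g]].
    by rewrite /za /zb /=; do !split; apply/e.
  move=> [[[/e a /e b] [/e c /e d]] [/e f /e g]]; exact/poincareP.
have ra j k c : zariski_closed (za j k c).
  by apply: closed_zeros; apply: regularB; [apply: regular_acoef|apply: regular_cst].
have rb j k c : zariski_closed (zb j k c).
  by apply: closed_zeros; apply: regularB; [apply: regular_bcoef|apply: regular_cst].
by do !apply: closedI.
Qed.

End FormCoordinates.

(** * The symmetric forms and a chain above them *)

Section SymmetricForms.
Variable (K : numClosedFieldType).
Implicit Types (w v : cubic_form K) (r : seq (nat * nat)).

(** The forms satisfying, for a common s, the symmetry relations indexed by r
and by the pivot (2, 0), which expresses s in terms of the coefficients. *)
Definition related r : set (cubic_form K) := [set w | poincare K w /\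
  exists2 s : K, s != 0 & forall j k, (j, k) \in (2, 0)%N :: r ->
    bcoef w k j * s ^+ k.+1 = s ^+ j * acoef w j k].

Definition symmetric_forms : set (cubic_form K) :=
  [set w | poincare K w /\ mirror_symmetric w].

(** The coefficients of degree at most 1 of a Poincare form satisfy the
relations for every s. *)
Lemma symmetric_related : symmetric_forms = related sym_relations.
Proof.
apply/seteqP; split=> w [pw]; last first.
  move=> [s s0 sE]; split=> //; apply/mirror_symmetricP; exists s => // j k.
  have [[a00 b00] [a10 b01] [a01 b10]] := (poincareP w).1 pw.
  have [jk2|jk2] := leqP 2 (j + k); last first.
    case: j k jk2 => [|[|j]] [|[|k]] // _; rewrite ?(a00, b00, a10, b01, a01, b10).
    - by rewrite mul0r mulr0.
    - by rewrite mul0r mulr0.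
    - by rewrite mulrC.
  have [jk3|jk3] := leqP (j + k) 3; last by rewrite bcoef_high 1?addnC // acoef_high // mulr0 mul0r.
  by apply: sE; rewrite mem_quad_cubic jk2 jk3.
by move=> /mirror_symmetricP[s s0 sE]; split=> //; exists s.
Qed.

(** The obstructions are regular functions, so they vanish on the closure. *)
Lemma center_symmetric : symmetric_variety K `<=` center_variety K.
Proof.
have pw w : symmetric_variety K w -> poincare K w.
  by apply: closure_sub (@closed_poincare K) _ w => v [].
move=> w sw; apply/(center_varietyP (pw w sw)) => n n2.
apply: (closure_sub (closed_zeros (regular_obstruction K n)) _ sw) => v hv.
have : related sym_relations v by rewrite -symmetric_related.
by move=> [_ [s s0 sE]]; apply: obstruction_symmetric s0 sE n.
Qed.

Section Parametrization.
Variable r : seq (nat * nat).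
Hypothesis r_sub : {subset r <= quad_cubic}.

Local Notation rel j k := ((j, k) \in (2, 0)%N :: r).

(** In each relation one of the two coefficients is a free parameter, chosen
so that the other is its product with a nonnegative power of s. The value of s
is stored in the constant coefficient of v, where a Poincare form vanishes. *)
Definition param v : cubic_form K :=
  let s := acoef v 0 0 in
  coef_form
    (fun j k => if (j + k < 2)%N then ((j == 1) && (k == 0))%N%:R
       else if rel j k && (j <= k)%N then s ^+ (k.+1 - j) * acoef v j k else acoef v j k)
    (fun k j => if (j + k < 2)%N then ((j == 1) && (k == 0))%N%:R
       else if rel j k then (if (j <= k)%N then acoef v j k else s ^+ (j - k.+1) * acoef v j k)
       else bcoef v k j).

Lemma regular_param f : regular f -> regular (fun v => f (param v)).
Proof.
apply: regular_comp => j k le3.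
  apply: (regular_ext (fun v => acoef_form _ _ le3)) => /=.
  case: (j + k < 2)%N; first exact: regular_cst.
  case: (rel j k && (j <= k)%N); last exact: regular_acoef.
  by apply: regularM; [apply: regularX|]; apply: regular_acoef.
apply: (regular_ext (fun v => bcoef_form _ _ le3)) => /=.
case: (k + j < 2)%N; first exact: regular_cst.
case: (rel k j); last exact: regular_bcoef.
case: (k <= j)%N; first exact: regular_acoef.
by apply: regularM; [apply: regularX|]; apply: regular_acoef.
Qed.

Lemma related_image :
  related r = [set param v | v in [set v : cubic_form K | acoef v 0 0 != 0]].
Proof.
apply/seteqP; split=> [w [pw [s s0 sE]]|_ [v /= s0 <-]].
  have [[a00 b00] [a10 b01] [a01 b10]] := (poincareP w).1 pw.
  pose v := coef_form (fun j k => if (j + k == 0)%N then s else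
    if rel j k && (j <= k)%N then bcoef w k j else acoef w j k) (bcoef w).
  have vs : acoef v 0 0 = s by rewrite acoef_form.
  exists v; first by rewrite /= vs.
  apply: form_ext_low => j k le3; split.
    rewrite acoef_form // vs; case: ltnP => [|jk2].
      by case: j k {le3} => [|[|j]] [|[|k]] //= _; rewrite ?a00 ?a10 ?a01.
    rewrite acoef_form // (gtn_eqF (ltnW jk2)); case: (boolP (rel j k && _)) => [/andP[rjk lejk]|_ //].
    have sj : s ^+ j != 0 by rewrite expf_neq0.
    apply: (mulfI sj); rewrite -sE // mulrA -exprD mulrC.
    by rewrite subnKC // ltnW.
  have le3' : (k + j <= 3)%N by rewrite addnC.
  rewrite bcoef_form // vs; case: ltnP => [|jk2].
    by case: j k {le3 le3'} => [|[|j]] [|[|k]] //= _; rewrite ?b00 ?b10 ?b01.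
  rewrite !acoef_form // bcoef_form // (gtn_eqF (ltnW jk2)).
  case: (boolP (rel k j)) => [rkj|_ //] /=; case: leqP => [lekj|ltjk] //=.
  have sj : s ^+ j.+1 != 0 by rewrite expf_neq0.
  by apply: (mulIf sj); rewrite sE // mulrAC -exprD subnK.
have rel_qc j k : rel j k -> (2 <= j + k <= 3)%N.
  by rewrite -mem_quad_cubic inE => /orP[/eqP[-> ->]//|/r_sub].
split.
  by apply/poincareP; rewrite /param !acoef_form // !bcoef_form.
exists (acoef v 0 0) => // j k rjk; have /andP[jk2 jk3] := rel_qc j k rjk.
have kj3 : (k + j <= 3)%N by rewrite addnC.
rewrite /param bcoef_form // acoef_form // ltnNge jk2 /= rjk /=.
case: leqP => [lejk|ltkj].
  by rewrite mulrA -exprD subnKC 1?mulrC // ltnW.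
by rewrite mulrAC -exprD subnK.
Qed.

Lemma related_prime : prime_set (related r).
Proof.
rewrite related_image; apply: image_prime; [exact: regular_acoef| |exact: regular_param].
exists (coef_form (fun _ _ => 1) (fun _ _ => 0)).
by rewrite acoef_form // oner_neq0.
Qed.

End Parametrization.

Definition pivot_a w := acoef w 2 0.
Definition pivot_b w := bcoef w 0 2.

(** The relation (j, k) with s replaced by its value pivot_b / pivot_a. *)
Definition relation j k w :=
  bcoef w k j * pivot_b w ^+ k.+1 * pivot_a w ^+ j -
  pivot_b w ^+ j * pivot_a w ^+ k.+1 * acoef w j k.

Lemma regular_relation j k : regular (relation j k).
Proof.
have ra := @regular_acoef K; have rb := @regular_bcoef K.
apply: regularB; apply: regularM; [apply: regularM|..]; rewrite /pivot_a /pivot_b.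
- exact: rb.
- exact: regularX.
- exact: regularX.
- by apply: regularM; apply: regularX.
- exact: ra.
Qed.

Lemma related_relation r (j k : nat) w : (j, k) \in r -> related r w -> relation j k w = 0.
Proof.
move=> jk [_ [s s0 sE]].
have bs : pivot_b w = s * pivot_a w.
  have := sE 2%N 0%N (mem_head _ _); rewrite expr1 expr2 -mulrA [RHS]mulrC.
  by move/(mulIf s0) => e; rewrite /pivot_b e mulrC.
have e : bcoef w k j * s ^+ k.+1 = s ^+ j * acoef w j k by apply: sE; rewrite inE jk orbT.
rewrite /relation bs !exprMn; apply/eqP; rewrite subr_eq0; apply/eqP.
transitivity ((bcoef w k j * s ^+ k.+1) * (pivot_a w ^+ k.+1 * pivot_a w ^+ j)); first by ring.
by rewrite e; ring.
Qed.

(** For s = 1, a form whose only asymmetric coefficient is the one in the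
dropped relation. *)
Lemma related_witness r (j k : nat) : (j, k) \in sym_relations -> (j, k) \notin r ->
  exists2 w, related r w & relation j k w != 0.
Proof.
move=> jk njk.
pose w : cubic_form K := coef_form (fun j' k' => if (j', k') \in [:: (1, 0); (2, 0)]%N then 1 else 0)
  (fun k' j' => if (j', k') \in [:: (1, 0); (2, 0); (j, k)]%N then 1 else 0).
have jk23 : (2 <= j + k <= 3)%N by rewrite -mem_quad_cubic; apply: mem_behead.
have wA j' k' : (j' + k' <= 3)%N ->
    acoef w j' k' = if (j', k') \in [:: (1, 0); (2, 0)]%N then 1 else 0.
  by move=> le3; rewrite acoef_form.
have wB j' k' : (j' + k' <= 3)%N ->
    bcoef w k' j' = if (j', k') \in [:: (1, 0); (2, 0); (j, k)]%N then 1 else 0.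
  by move=> le3; rewrite bcoef_form // addnC.
have neq1 : (j, k) != (1, 0)%N by case: eqP jk23 => // -[-> ->].
have neq2 : (j, k) != (2, 0)%N by apply: contraTneq jk => ->.
exists w; last first.
  rewrite /relation /pivot_a /pivot_b !wA ?wB ?(andP jk23).2 // !inE !eqxx (negbTE neq1) (negbTE neq2).
  by rewrite !orbT !expr1n mulr0 subr0 !mulr1 oner_neq0.
split.
  apply/poincareP; rewrite !wA // (wB 0%N 0%N) // (wB 1%N 0%N) // (wB 0%N 1%N) //.
  rewrite !inE; have low x y : (x + y < 2)%N -> ((x, y) == (j, k)) = false.
    by move=> lt2; apply: contraTF jk23 => /eqP[<- <-]; rewrite leqNgt lt2.
  by rewrite !low.
exists 1 => [|j' k']; first exact: oner_neq0.
move=> rjk; rewrite !expr1n mulr1 mul1r.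
have [le3|gt3] := leqP (j' + k') 3; last by rewrite acoef_high // bcoef_high // addnC.
rewrite wA // wB // !inE [(j', k') == (j, k)](_ : _ = false) ?orbF //.
apply: contraTF rjk => /eqP ->; rewrite inE negb_or neq2; exact: njk.
Qed.

(** The six relations are dropped one after another; each inclusion is strict
because the dropped relation fails somewhere on the larger set. *)
Lemma symmetric_chain : irreducible_chain (symmetric_variety K) (poincare K) 6
  (fun i => zariski_closure (related (drop i sym_relations))).
Proof.
split.
- by rewrite drop0 -symmetric_related.
- move=> i _; split.
    apply/prime_irreducible_closure/related_prime => m /mem_drop.
    exact: mem_behead.
  by apply: closure_sub (@closed_poincare K) _ => w [].
move=> i lti; have szi : (i < size sym_relations)%N by [].
case jkE : (nth (0, 0)%N sym_relations i) => [j k].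
have dropE : drop i sym_relations = (j, k) :: drop i.+1 sym_relations.
  by rewrite (drop_nth (0, 0)%N szi) jkE.
split.
  apply: closureS => w [pw [s s0 sE]]; split=> //; exists s => // j' k' jk'.
  apply: sE; rewrite dropE; move: jk'; rewrite !inE => /orP[->//|->].
  by rewrite !orbT.
have jk : (j, k) \in sym_relations by rewrite -jkE mem_nth.
have njk : (j, k) \notin drop i.+1 sym_relations.
  by have := drop_uniq i (isT : uniq sym_relations); rewrite dropE /= => /andP[].
have [w rw /negP nw] := related_witness jk njk.
have vanish : related (drop i sym_relations) `<=` [set v | relation j k v = 0].
  by move=> v; apply: related_relation; rewrite dropE mem_head.
move=> sub; apply: nw; apply/eqP.
exact: (closure_sub (closed_zeros (regular_relation j k)) vanish (sub w (sub_closure rw))).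
Qed.

End SymmetricForms.

(** * The upper bound for chains, and maximality *)

Section UpperBound.
Variable (K : numClosedFieldType).
Implicit Types (w v : cubic_form K).

Definition poincare_coords w (t : 'I_14) : K :=
  let m := nth (0, 0)%N quad_cubic in
  if (t < 7)%N then acoef w (m t).1 (m t).2 else bcoef w (m (t - 7)%N).1 (m (t - 7)%N).2.

Lemma coefs_poly : 
  (forall j k, exists q : {mpoly K[14]}, forall w, poincare K w ->
     acoef w j k = q.@[poincare_coords w]) /\
  (forall j k, exists q : {mpoly K[14]}, forall w, poincare K w ->
     bcoef w j k = q.@[poincare_coords w]).
Proof.
have cst (l : cubic_form K -> K) c : (forall w, poincare K w -> l w = c) ->
    exists q : {mpoly K[14]}, forall w, poincare K w -> l w = q.@[poincare_coords w].
  by move=> lc; exists c%:MP => w pw; rewrite mevalC lc.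
have var (t : nat) : (t < 7)%N -> (t < 14)%N /\ (7 + t < 14)%N by lia.
have qc j k : (j, k) \in quad_cubic -> exists2 t, (t < 7)%N & nth (0, 0)%N quad_cubic t = (j, k).
  by move=> jk; exists (index (j, k) quad_cubic); rewrite ?nth_index // -[7%N]/(size quad_cubic) index_mem.
split=> j k; have [jk|njk] := boolP ((j, k) \in quad_cubic).
- have [t lt7 tE] := qc j k jk; exists 'X_(Ordinal (var t lt7).1) => w _.
  by rewrite mevalXU /poincare_coords /= lt7 tE.
- have [jk2|jk2] := leqP 2 (j + k); last first.
    case: j k jk2 {njk} => [|[|j]] [|[|k]] // _.
    - by apply: (cst _ 0) => w /poincareP[[-> _] _ _].
    - by apply: (cst _ 0) => w /poincareP[_ _ [-> _]].
    - by apply: (cst _ 1) => w /poincareP[_ [-> _] _].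
  by apply: (cst _ 0) => w _; rewrite acoef_high //; move: njk; rewrite mem_quad_cubic jk2 -ltnNge.
- have [t lt7 tE] := qc j k jk; exists 'X_(Ordinal (var t lt7).2) => w _.
  by rewrite mevalXU /poincare_coords -[nat_of_ord _]/(7 + t)%N ltnNge leq_addr addKn tE.
have [jk2|jk2] := leqP 2 (j + k); last first.
  case: j k jk2 {njk} => [|[|j]] [|[|k]] // _.
  - by apply: (cst _ 0) => w /poincareP[[_ ->] _ _].
  - by apply: (cst _ 1) => w /poincareP[_ [_ ->] _].
  - by apply: (cst _ 0) => w /poincareP[_ _ [_ ->]].
by apply: (cst _ 0) => w _; rewrite bcoef_high //; move: njk; rewrite mem_quad_cubic jk2 -ltnNge.
Qed.

Lemma regular_poincare f : regular f ->
  exists q : {mpoly K[14]}, forall w, poincare K w -> f w = q.@[poincare_coords w].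
Proof.
have [pa pb] := coefs_poly.
move: f; apply: regular_ind => [f g fg [q fq]|c|f g [q fq] [s gs]|f g [q fq] [s gs]|i].
- by exists q => w pw; rewrite -fg fq.
- by exists c%:MP => w _; rewrite mevalC.
- by exists (q + s) => w pw; rewrite mevalD fq // gs.
- by exists (q * s) => w pw; rewrite mevalM fq // gs.
have [|x [y xyE]] := linear_form_coef (l := coord (vbasis {:cubic_form K}) i).
  by move=> c v w; rewrite linearP.
have /choice[qa qaE] := fun m : nat * nat => pa m.1 m.2.
have /choice[qb qbE] := fun m : nat * nat => pb m.1 m.2.
exists (\sum_(j < 4) \sum_(k < 4) (x j k *: qa (j : nat, k : nat) + y j k *: qb (j : nat, k : nat))).
move=> w pw; rewrite xyE raddf_sum; apply: eq_bigr => j _ /=; rewrite raddf_sum.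
apply: eq_bigr => k _ /=; rewrite mevalD !mevalZ.
by rewrite -qaE // -qbE.
Qed.

(** The number with base k digits e. *)
Fixpoint exponent_code (k n : nat) : exponents k n -> nat :=
  match n with
  | 0 => fun _ => 0%N
  | n'.+1 => fun e => (exponent_code e.1 + e.2 * k ^ n')%N
  end.

Lemma exponent_code_lt k n (e : exponents k n) : (exponent_code e < k ^ n)%N.
Proof.
elim: n e => [//|n IHn] [e i] /=; rewrite expnS.
have := IHn e; have : (i.+1 * k ^ n <= k * k ^ n)%N by rewrite leq_mul2r ltn_ord orbT.
rewrite mulSn; lia.
Qed.

Lemma exponent_code_inj k n : injective (@exponent_code k n).
Proof.
elim: n => [[] []//|n IHn] [e i] [e' i'] /= eq.
have lt_e := exponent_code_lt e; have lt_e' := exponent_code_lt e'.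
have kn : (0 < k ^ n)%N by apply: leq_ltn_trans lt_e.
have ei : i = i'.
  apply: val_inj; have := congr1 (divn^~ (k ^ n)%N) eq.
  by rewrite /= !divnDMl // !divn_small.
by congr pair => //; apply: IHn; move: eq; rewrite ei => /addIn.
Qed.

Definition sym_coords (t : nat) : cubic_form K -> K :=
  let m := nth (0, 0)%N quad_cubic t in
  if (t < 7)%N then fun w => acoef w m.1 m.2 else fun w => bcoef w 0 2.

Lemma regular_sym_coords t : regular (sym_coords t).
Proof.
by rewrite /sym_coords; case: ifP => _; [apply: regular_acoef|apply: regular_bcoef].
Qed.

Lemma monomial_curve k n (xs : nat -> cubic_form K -> K) (e : exponents k n) x w :
  (forall t, (t < n)%N -> xs t w = x ^+ (k ^ t)) -> monomial xs e w = x ^+ exponent_code e.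
Proof.
elim: n e => [//|n IHn] e xsE /=.
rewrite IHn => [|t ltn]; last by apply: xsE; apply: ltnW.
by rewrite xsE // -exprM mulnC exprD.
Qed.

(** Along a curve where the t-th coordinate is x ^ (k ^ t), different monomials
with exponents below k restrict to different powers of x. *)
Lemma indep_on_curve k n (xs : nat -> cubic_form K -> K) Y :
  (forall x, x != 0 -> exists2 w, Y w & forall t, (t < n)%N -> xs t w = x ^+ (k ^ t)) ->
  indep_on Y (@monomial K (cubic_form K) k n xs).
Proof.
move=> curve c relc; pose P : {poly K} := \sum_(e : exponents k n) c e *: 'X^(exponent_code e).
have PE e : P`_(exponent_code e) = c e.
  rewrite coef_sum (bigD1 e) //= coefZ coefXn eqxx mulr1 big1 ?addr0 // => e' ne.
  rewrite coefZ coefXn (_ : (_ == _) = false) ?mulr0 //.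
  by apply: contraNF ne => /eqP/exponent_code_inj ->.
move=> e; rewrite -PE; suff -> : P = 0 by rewrite coef0.
apply: contrapT => /eqP P0; have XP0 : 'X * P != 0 by rewrite mulf_neq0 ?polyX_eq0.
have [x] := poly_nonroot XP0; rewrite hornerM hornerX mulf_eq0 negb_or => /andP[x0 /eqP].
apply; have [w Yw wE] := curve x x0.
rewrite -[RHS](relc w Yw) horner_sum; apply: eq_bigr => e' _.
by rewrite hornerZ hornerXn (monomial_curve _ wE).
Qed.

(** The seven acoef and s are free parameters of the symmetric forms. *)
Lemma symmetric_curve k (x : K) : x != 0 -> exists2 w, symmetric_variety K w &
  forall t, (t < 8)%N -> sym_coords t w = x ^+ (k ^ t).
Proof.
move=> x0; pose s := x ^+ (k ^ 7) / x ^+ (k ^ 0).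
have s0 : s != 0 by rewrite mulf_neq0 ?invr_eq0 ?expf_neq0.
pose low (j k : nat) (y : K) := if (j + k < 2)%N then ((j == 1) && (k == 0))%N%:R else y.
pose al (j l : nat) := x ^+ (k ^ index (j, l) quad_cubic).
pose w := coef_form (fun j l => low j l (al j l))
  (fun l j => low j l (s ^+ j * s ^- l.+1 * al j l)).
have wA j l : (2 <= j + l <= 3)%N -> acoef w j l = al j l.
  by move=> /andP[jl2 jl3]; rewrite acoef_form // /low ltnNge jl2.
have wB j l : (2 <= j + l <= 3)%N -> bcoef w l j = s ^+ j * s ^- l.+1 * al j l.
  by move=> /andP[jl2 jl3]; rewrite bcoef_form 1?addnC // /low ltnNge jl2.
exists w.
  apply: sub_closure; suff: related sym_relations w by rewrite -symmetric_related.
  split; first by apply/poincareP; rewrite !acoef_form // !bcoef_form.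
  exists s => // j l jl; rewrite wA ?wB -?mem_quad_cubic //.
  by rewrite mulrAC divfK // expf_neq0.
move=> t lt8; rewrite /sym_coords; case: ltnP => [lt7|ge7].
  have mem_t : nth (0, 0)%N quad_cubic t \in quad_cubic by apply: mem_nth.
  move: (mem_t); case E: (nth _ _ _) => [j l]; rewrite mem_quad_cubic => /wA -> /=.
  by rewrite /al -E index_uniq.
have -> : t = 7%N by lia.
rewrite wB // /al -[index _ _]/0%N expr2 expr1 mulfK //.
by rewrite /s divfK // expf_neq0.
Qed.

(** There are 8 independent functions on the symmetric forms and at most 14 on
the Poincare forms. *)
Lemma poincare_codim m Z :
  irreducible_chain (symmetric_variety K) (poincare K) m Z -> (m <= 6)%N.
Proof.
move=> [Z0 ZP ltZ].
have ind0 k : indep_on (Z 0%N) (@monomial K (cubic_form K) k 8 sym_coords).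
  by rewrite Z0; apply: indep_on_curve => x; apply: symmetric_curve.
have [ys rys indys] := chain_indep regular_sym_coords ind0 (fun i lei => (ZP i lei).1) ltZ.
suff : (m + 8 <= 14)%N by lia.
apply: (indep_monomials_le regular_poincare rys) => k c relc.
by apply: indys => w Zw; apply: relc; apply: (ZP m (leqnn m)).2.
Qed.

End UpperBound.

Section Maximality.
Variable (K : numClosedFieldType).
Implicit Types (w v : cubic_form K).

Let D w := pivot_a w * pivot_b w.

Lemma regular_pivots : regular D.
Proof. by apply: regularM; [apply: regular_acoef|apply: regular_bcoef]. Qed.

Lemma pivots_neq0 w : D w != 0 -> pivot_a w != 0 /\ pivot_b w != 0.
Proof. by rewrite mulf_eq0 negb_or => /andP[]. Qed.

(** The vcoef of the form with the same acoef that satisfies all symmetry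
relations for s = pivot_b / pivot_a. *)
Definition sym_vcoef w (k j : nat) : K :=
  (pivot_b w / pivot_a w) ^+ j / (pivot_b w / pivot_a w) ^+ k.+1 * acoef w j k.

Definition deviation (t : 'I_6) w : K :=
  let m := nth (0, 0)%N sym_relations t in bcoef w m.2 m.1 - sym_vcoef w m.2 m.1.

Definition base_form : cubic_form K :=
  coef_form (fun j k => if (j + k < 2)%N then ((j == 1) && (k == 0))%N%:R else zval K (base_point j k))
    (fun k j => if (j + k < 2)%N then ((j == 1) && (k == 0))%N%:R else zval K (base_point j k)).

Lemma base_acoef j k : (2 <= j + k <= 3)%N -> acoef base_form j k = zval K (base_point j k).
Proof. by move=> /andP[jk2 jk3]; rewrite acoef_form // ltnNge jk2. Qed.

Lemma base_bcoef j k : (2 <= j + k <= 3)%N -> bcoef base_form k j = zval K (base_point j k).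
Proof.
move=> /andP[jk2 jk3]; have kj3 : (k + j <= 3)%N by rewrite addnC.
by rewrite bcoef_form // ltnNge jk2.
Qed.

Lemma zval1 : zval K 1 = 1. Proof. by []. Qed.

Lemma base_pivots : pivot_a base_form = 1 /\ pivot_b base_form = 1.
Proof. by rewrite /pivot_a /pivot_b base_acoef // base_bcoef. Qed.

Lemma base_symmetric : symmetric_variety K base_form.
Proof.
apply: sub_closure; suff: related sym_relations base_form by rewrite -symmetric_related.
split; first by apply/poincareP; rewrite !acoef_form // !bcoef_form.
exists 1 => [|j k jk]; first exact: oner_neq0.
by rewrite base_acoef ?base_bcoef -?mem_quad_cubic // !expr1n mulr1 mul1r.
Qed.

Lemma ratfun_ratio : ratfun D (fun w => pivot_b w / pivot_a w) /\
  ratfun D (fun w => (pivot_b w / pivot_a w)^-1).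
Proof.
have ra : regular (@pivot_a K) by apply: regular_acoef.
have rb : regular (@pivot_b K) by apply: regular_bcoef.
split.
  exists 1%N, (fun w => pivot_b w * pivot_b w); split; first exact: regularM.
  by move=> w /pivots_neq0[a0 b0]; rewrite expr1 /D mulrA divfK.
exists 1%N, (fun w => pivot_a w * pivot_a w); split; first exact: regularM.
by move=> w /pivots_neq0[a0 b0]; rewrite expr1 /D invf_div [pivot_a w * pivot_b w]mulrC mulrA divfK.
Qed.

Lemma ratfun_sym_vcoef j k : ratfun D (fun w => sym_vcoef w k j).
Proof.
have [rs rsV] := ratfun_ratio.
apply: ratfunM; last by apply: regular_ratfun; apply: regular_acoef.
apply: ratfunM; first exact: ratfunX.
by apply: ratfun_ext (ratfunX k.+1 rsV) => w; rewrite exprVn.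
Qed.

Lemma sym_vcoefP w : D w != 0 -> forall j k,
  sym_vcoef w k j * (pivot_b w / pivot_a w) ^+ k.+1 = (pivot_b w / pivot_a w) ^+ j * acoef w j k.
Proof.
move=> /pivots_neq0[a0 b0] j k; rewrite /sym_vcoef mulrAC divfK //.
by rewrite expf_neq0 // mulf_neq0 // invr_eq0.
Qed.

Lemma sym_vcoef_pivot w : D w != 0 -> sym_vcoef w 0 2 = bcoef w 0 2.
Proof.
move=> /pivots_neq0[a0 b0]; rewrite /sym_vcoef expr2 expr1 mulfK; last first.
  by rewrite mulf_neq0 // invr_eq0.
by rewrite -/(pivot_a w) divfK.
Qed.

Lemma acoef_jet j k : (j, k) \in quad_cubic ->
  jet D base_form deviation (fun w => acoef w j k) (fun w => acoef w j k) (ucoef_jet j k).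
Proof.
move=> jk; apply: jet_same; first by apply: regular_ratfun; apply: regular_acoef.
by rewrite base_acoef // -mem_quad_cubic.
Qed.

(** A coefficient of vcoef differs from its symmetric value by at most one
deviation, so its derivatives are 0 or 1. *)
Lemma bcoef_jet j k : (j, k) \in quad_cubic ->
  jet D base_form deviation (fun w => bcoef w j k) (fun w => sym_vcoef w j k) (vcoef_jet j k).
Proof.
move=> jk; have kj23 : (2 <= k + j <= 3)%N by rewrite addnC -mem_quad_cubic.
split.
- by split; [apply: regular_ratfun; apply: regular_bcoef|apply: ratfun_sym_vcoef].
- by rewrite base_bcoef.
- rewrite /sym_vcoef; have [-> ->] := base_pivots.
  by rewrite divr1 !expr1n divr1 mul1r base_acoef.
exists (fun t _ => zval K (vcoef_jet j k t.+1)); split=> [t|w Dw].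
  by split=> //; apply: ratfun_cst.
have kj : (k, j) \in quad_cubic by rewrite mem_quad_cubic.
have [[ek ej]|npiv] := eqVneq (k, j) (2, 0)%N.
  rewrite ek ej sym_vcoef_pivot // subrr big1 // => t _.
  by case: t => -[|[|[|[|[|[|//]]]]]] ltt; rewrite /= mul0r.
have kjs : (k, j) \in sym_relations by move: kj; rewrite inE (negbTE npiv).
have lt6 : (index (k, j) sym_relations < 6)%N by rewrite -[6%N]/(size sym_relations) index_mem.
rewrite (bigD1 (Ordinal lt6)) //= nth_index // eqxx zval1 mul1r big1 ?addr0.
  by rewrite /deviation /= nth_index.
move=> t ne; rewrite (_ : (_ == _) = false) ?mul0r //.
apply: contraNF ne => /eqP e; apply/eqP/val_inj.
by rewrite -[val (Ordinal lt6)]/(index (k, j) sym_relations) -e index_uniq // (ltn_ord t).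
Qed.

(** All obstructions vanish on Z and on the symmetric forms, so on Z the six
deviations solve a homogeneous linear system. Its determinant is nonzero at
base_form, hence on a nonempty open subset of Z, which therefore consists of
symmetric forms. *)
Lemma maximal_symmetric (Z : set (cubic_form K)) : irreducible_closed Z ->
  symmetric_variety K `<=` Z -> Z `<=` center_variety K -> Z = symmetric_variety K.
Proof.
move=> [clZ irrZ] XZ ZX; apply/seteqP; split=> // z Zz; apply: contrapT => nXz.
have [f [rf fX fz]] := closed_separated (closed_closure _) nXz.
have rD := regular_pivots.
have lt15 (i : 'I_6) : (i.+2 + i.+2 <= 15)%N by have := ltn_ord i; lia.
have jets (i : 'I_6) := obstruction_jet rD acoef_jet bcoef_jet integral_table_ok
  (isT : (2 <= i.+2)%N) (lt15 i).
have /choice[H HP] : forall i : 'I_6, exists H : 'I_6 -> cubic_form K -> K,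
    (forall t : 'I_6, ratfun D (H t) /\ H t base_form = zval K (jacobian i t)) /\
    forall w, D w != 0 ->
      zval K table_scale * obstruction (acoef w) (bcoef w) i.+2 -
      zval K table_scale * obstruction (acoef w) (sym_vcoef w) i.+2 =
      \sum_t H t w * deviation t w.
  by move=> i; have [_ _ _ hH] := jets i.
(* D * q is regular and vanishes where the linear system may be singular. *)
have [N [q [rq qE]]] := ratfun_det rD (fun i t => proj1 ((HP i).1 t)).
have qZ w : Z w -> f w * (D w * q w) = 0.
  move=> Zw; have [->|Dw] := eqVneq (D w) 0; first by rewrite mul0r mulr0.
  have [->|qw] := eqVneq (q w) 0; first by rewrite !mulr0.
  rewrite fX ?mul0r //; have [pw _] := ZX w Zw; have s0 : pivot_b w / pivot_a w != 0.
    by have [a0 b0] := pivots_neq0 Dw; rewrite mulf_neq0 // invr_eq0.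
  have dev0 t : deviation t w = 0.
    pose M := \matrix_(i, j) H i j w; pose x := \col_t deviation t w.
    have Mx : M *m x = 0.
      apply/colP => i; rewrite !mxE; transitivity (\sum_t H i t w * deviation t w).
        by apply: eq_bigr => j _; rewrite !mxE.
      rewrite -(HP i).2 // ((center_varietyP pw).1 (ZX w Zw) i.+2 isT) mulr0 sub0r.
      rewrite (obstruction_symmetric s0) ?mulr0 ?oppr0 // => j k _.
      exact: sym_vcoefP.
    have uM : M \in unitmx.
      rewrite unitmxE unitfE; apply: contraNneq qw => M0.
      by rewrite -qE // -/M M0 mul0r.
    by have := mulKmx uM x; rewrite Mx mulmx0 => /colP/(_ t); rewrite !mxE.
  apply: sub_closure; suff: related sym_relations w by rewrite -symmetric_related.
  split=> //; exists (pivot_b w / pivot_a w) => // j k; rewrite inE => /orP[/eqP[-> ->]|jk].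
    by rewrite -sym_vcoef_pivot // sym_vcoefP.
  have lt6 : (index (j, k) sym_relations < 6)%N by rewrite -[6%N]/(size sym_relations) index_mem.
  have := dev0 (Ordinal lt6); rewrite /deviation /= nth_index //= => /eqP.
  by rewrite subr_eq0 => /eqP ->; rewrite sym_vcoefP.
have [_ primeZ] := irreducible_prime irrZ.
have [|f0|Dq0] := primeZ f (fun w => D w * q w) rf (regularM rD rq) _; first exact: qZ.
  by apply: fz; apply: f0.
have Zp := XZ _ base_symmetric; have [a1 b1] := base_pivots.
have Dp : D base_form = 1 by rewrite /D a1 b1 mulr1.
have /eqP := Dq0 _ Zp; rewrite Dp mul1r -qE Dp ?oner_neq0 // expr1n mulr1.
rewrite (_ : \matrix_(i, t) _ = \matrix_(i < 6, t < 6) zval K (jacobian i t)).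
  by rewrite (negbTE (det_zval_neq0 K jac_inverse)).
by apply/matrixP => i t; rewrite !mxE ((HP i).1 t).2.
Qed.

End Maximality.

Theorem proposition5p7 (R : realType) :
  irreducible_component (symmetric_variety R[i]%C) (center_variety R[i]%C) /\
  has_codim (symmetric_variety R[i]%C) (poincare R[i]%C) 6.
Proof.
have chain := symmetric_chain R[i]%C; have [_ irr _] := chain.
split; split.
- by have [+ _] := irr 0%N (leq0n _); rewrite drop0 -symmetric_related.
- exact: center_symmetric.
- exact: maximal_symmetric.
- by exists (fun i => zariski_closure (related (drop i sym_relations))).
- exact: poincare_codim.
Qed.
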